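(* Let $\rho:\Gamma\to\mathsf{SO}(p,p)$ be a representation that is Borel Anosov for $\mathsf{SO}(p,p)$ and satisfies the following transversality property: for all triples of pairwise distinct points $(x,y,z)$ in $\partial_\infty\Gamma$, $$\Theta(z)\ \pitchfork\ \Big(E_p(x,y)\oplus\big(E_{p-1}^o(x,y)\cap\overline\Theta(y)\big)\Big).$$ Then the image $M=\Theta(\partial_\infty\Gamma)$ of the isotropic limit curve $\Theta:\partial_\infty\Gamma\to\mathbf L$ is a smooth curve. Moreover, for all $x\neq y$ in $\partial_\infty\Gamma$, under the identification of $\mathsf T_{\Theta(x)}\mathbf L$ with $\mathsf\Lambda^2(\Theta(x)^* )$ described in the context, one has $$\mathsf T_{\Theta(x)}M=\mathsf\Lambda^2\big(E_{p-1}^*(x,y)\oplus E_p^*(x,y)\big).$$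
   Context: $\Sigma$ is a closed hyperbolic surface, $\Gamma=\pi_1(\Sigma)$, $\partial_\infty\Gamma=\partial_\infty\mathbf H^2$, $X$ is the unit tangent bundle of $\Sigma$ and $(\varphi_t)$ its geodesic flow. $E$ is a vector space with a quadratic form $Q$ (the associated bilinear form is also written $Q$) of signature $(p,p)$; $\mathsf{SO}(p,p)$ acts on $E$; $V^o$ is the $Q$-orthogonal of a subspace $V$; $\mathbf L$ is the space of maximal ($p$-dimensional) totally isotropic subspaces of $E$. Two subspaces of dimension $p$ are transverse ($\pitchfork$) if they intersect only in $0$. Given $\rho:\Gamma\to\mathsf{SO}(p,p)$, $\mathcal E_\rho$ is the associated flat bundle over $X$ with fibre $E$, i.e. the quotient by $\Gamma$ of $\widetilde X\times E$ with $\widetilde X$ the unit tangent bundle of $\mathbf H^2$, and $\Phi_t$ is the lift of $\varphi_t$ induced by $(u,v)\mapsto(\varphi_t u,v)$. A lifted flow contracts a bundle over a compact base if for some continuous metric there are $a,b>0$ with $\|\Phi_t u\|\leq ae^{-bt}\|u\|$ for all $t>0$. The representation $\rho$ is Borel Anosov for $\mathsf{SO}(p,p)$ if $\mathcal E_\rho$ splits as a sum of $2p$ continuous line bundles $\mathcal E_i,\overline{\mathcal E}_i$, $1\leq i\leq p$, such that: (1) they are $\Phi_t$-invariant and $Q$-paired, i.e. $\bigoplus_i\mathcal E_i$ and $\bigoplus_i\overline{\mathcal E}_i$ are totally isotropic, and $Q$ restricted to $\mathcal E_i\oplus\overline{\mathcal E}_j$ is zero for $i\neq j$ and nondegenerate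 for $i=j$; (2) $\Phi_t$ contracts $\mathcal E_i^*\otimes\overline{\mathcal E}_p$ for $i<p$, and $\mathcal E_i^*\otimes\mathcal E_j$ for $i<j$. Lifting these bundles to $\widetilde X$, for $x\neq y$ in $\partial_\infty\mathbf H^2$ let $E_i(x,y)$ and $\overline E_i(x,y)$ be the lines of $E$ given by the fibres of $\mathcal E_i$ and $\overline{\mathcal E}_i$ at any point of the oriented geodesic with backward endpoint $x$ and forward endpoint $y$. The space $\Theta(x)=\bigoplus_{i=1}^pE_i(x,y)$ depends only on $x$, and $\overline\Theta(y)=\bigoplus_{i=1}^p\overline E_i(x,y)$ depends only on $y$; $\Theta$ and $\overline\Theta$ are the isotropic limit curves $\partial_\infty\Gamma\to\mathbf L$. Identification: for transverse $\theta_0,\theta_1\in\mathbf L$, the elements of $\mathbf L$ transverse to $\theta_1$ are the graphs of those $f\in\operatorname{Hom}(\theta_0,\theta_1)$ for which $\omega_f(u,v)=Q(u,f(v))$ is a $2$-form on $\theta_0$, and $f\mapsto\omega_f$ identifies $\mathsf T_{\theta_0}\mathbf L$ with $\mathsf\Lambda^2(\theta_0^* )$. Here $\theta_0=\Theta(x)$, $\theta_1=\overline\Theta(y)$. Using $\Theta(x)=\bigoplus_iE_i(x,y)$, $\mathsf\Lambda^2(E_{p-1}^*\oplus E_p^* )$ is regarded as a line in $\mathsf\Lambda^2(\Theta(x)^* )$ (forms vanishing as soon as one argument lies in $E_i(x,y)$, $i\leq p-2$). *)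

(* Defs.v *)
From HB Require Import structures.
From mathcomp Require Import all_boot all_order all_algebra.
From mathcomp Require Import all_classical all_reals all_analysis.
From mathcomp Require Import ring lra.
Import Order.TTheory GRing.Theory Num.Theory.
Import numFieldNormedType.Exports.

Set Implicit Arguments.
Unset Strict Implicit.
Unset Printing Implicit Defensive.

Local Open Scope classical_set_scope.
Local Open Scope ring_scope.

(* The bilinear form with Gram matrix J; its quadratic form is v |-> bil J v v. *)
Definition bil (R : realType) (n : nat) (J : 'M[R]_n) (v w : 'cV[R]_n) : R :=
  (v^T *m J *m w) 0 0.

Section Hyperbolic.
Variable R : realType.

Definition lorentz : 'M[R]_3 := diag_mx (\row_j (if j == 0 then -1 else 1)).

(* Hyperboloid model: R^3 with the form -x_0^2 + x_1^2 + x_2^2. *)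
Definition H2 : set 'cV[R]_3 := [set v | bil lorentz v v = -1 /\ 0 < v 0 0].

(* Unit tangent bundle: (v, w) is a point v with a unit vector w tangent at v. *)
Definition T1H2 : set ('cV[R]_3 * 'cV[R]_3) :=
  [set u | [/\ H2 u.1, bil lorentz u.2 u.2 = 1 & bil lorentz u.1 u.2 = 0]].

(* The isometries of H2 are the matrices preserving the form and the sheet. *)
Definition isomH2 : set 'M[R]_3 :=
  [set g | g^T *m lorentz *m g = lorentz /\ 0 < g 0 0].

Definition isom_act (g : 'M[R]_3) (u : 'cV[R]_3 * 'cV[R]_3) :=
  (g *m u.1, g *m u.2).

(* (cosh t v + sinh t w, sinh t v + cosh t w) *)
Definition geoflow (t : R) (u : 'cV[R]_3 * 'cV[R]_3) :=
  let ch := (expR t + expR (- t)) / 2 in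
  let sh := (expR t - expR (- t)) / 2 in
  (ch *: u.1 + sh *: u.2, sh *: u.1 + ch *: u.2).

(* The circle at infinity: isotropic lines, normalised by x_0 = 1. *)
Definition bdry : set 'cV[R]_3 :=
  [set x | bil lorentz x x = 0 /\ x 0 0 = 1].

Definition forward_end (u : 'cV[R]_3 * 'cV[R]_3) : 'cV[R]_3 :=
  ((u.1 + u.2) 0 0)^-1 *: (u.1 + u.2).

Definition backward_end (u : 'cV[R]_3 * 'cV[R]_3) : 'cV[R]_3 :=
  ((u.1 - u.2) 0 0)^-1 *: (u.1 - u.2).

(* A point of the oriented geodesic from x to y (see geod_ptP). Flow-invariant
   objects on T1H2 are evaluated on a geodesic at this point; the choice of the
   point on the geodesic is then irrelevant. *)
Definition geod_pt (x y : 'cV[R]_3) : 'cV[R]_3 * 'cV[R]_3 :=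
  let s := (Num.sqrt (- (2 * bil lorentz x y)))^-1 in
  (s *: (x + y), s *: (y - x)).

Definition antipode (x : 'cV[R]_3) : 'cV[R]_3 :=
  \col_i (if i == 0 then x i 0 else - x i 0).

(* Gamma is the deck group of a closed hyperbolic surface Gamma \ H2:
   a group of isometries acting freely, properly discontinuously and
   cocompactly. *)
Definition closed_surface_group (Gamma : set 'M[R]_3) : Prop :=
  [/\ Gamma `<=` isomH2,
      [/\ Gamma 1%:M,
          forall g h, Gamma g -> Gamma h -> Gamma (g *m h) &
          forall g, Gamma g -> Gamma (invmx g)],
      forall g v, Gamma g -> H2 v -> g *m v = v -> g = 1%:M,
      forall K, K `<=` H2 -> compact K ->
        finite_set [set g | Gamma g /\ exists2 v, K v & K (g *m v)] &
      exists2 K, K `<=` H2 /\ compact K &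
        forall v, H2 v -> exists2 g, Gamma g & K (g *m v)].

End Hyperbolic.

Lemma bil_lorentzE (R : realType) (v w : 'cV[R]_3) :
  bil (lorentz R) v w =
  - (v 0 0 * w 0 0) + v 1 0 * w 1 0 + v (inord 2) 0 * w (inord 2) 0.
Proof.
rewrite /bil /lorentz mul_mx_diag !mxE !big_ord_recl big_ord0 addr0 !mxE /=.
have -> : lift ord0 ord0 = 1 :> 'I_3 by apply/val_inj.
have -> : lift ord0 (lift ord0 ord0) = inord 2 :> 'I_3.
  by apply/val_inj; rewrite /= inordK.
rewrite /=; ring.
Qed.

Lemma bdry_neg (R : realType) (x y : 'cV[R]_3) : bdry x -> bdry y -> x <> y ->
  bil (lorentz R) x y < 0.
Proof.
rewrite /bdry /= !bil_lorentzE => -[hx x0] [hy y0] xy; rewrite x0 y0 in hx hy *.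
rewrite lt_neqAle; apply/andP; split; last by
  have := sqr_ge0 (x 1 0 - y 1 0); have := sqr_ge0 (x (inord 2) 0 - y (inord 2) 0); nra.
apply/eqP => h; apply: xy.
have e : (x 1 0 - y 1 0)^+2 + (x (inord 2) 0 - y (inord 2) 0)^+2 = 0 by nra.
move/eqP: e; rewrite paddr_eq0 ?sqr_ge0 // !sqrf_eq0 !subr_eq0 => /andP[/eqP e1 /eqP e2].
apply/matrixP => i j; rewrite ord1; case: (unliftP 0 i) => [k ->|->]; last by rewrite x0 y0.
case: (unliftP 0 k) => [l ->|->].
  rewrite (ord1 l); have -> // : lift 0 (lift 0 0) = inord 2 :> 'I_3.
  by apply/val_inj; rewrite /= inordK.
by have -> // : lift 0 0 = 1 :> 'I_3; apply/val_inj.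
Qed.

Lemma geod_ptP (R : realType) (x y : 'cV[R]_3) : bdry x -> bdry y -> x <> y ->
  [/\ T1H2 (geod_pt x y), backward_end (geod_pt x y) = x &
      forward_end (geod_pt x y) = y].
Proof.
move=> bx by_ xy; have n := bdry_neg bx by_ xy.
move: bx by_ => [hx x0] [hy y0].
rewrite /geod_pt; set q := Num.sqrt _.
have q2 : q ^+ 2 = - (2 * bil (lorentz R) x y) by rewrite sqr_sqrtr //; lra.
have q0 : 0 < q by rewrite sqrtr_gt0; lra.
have qn : q != 0 by rewrite gt_eqF.
move: q2 hx hy; rewrite !bil_lorentzE x0 y0 => q2 hx hy.
set s := q^-1.
have s2 : s ^+ 2 * (- (2 * (- (1 * 1) + x 1 0 * y 1 0 + x (inord 2) 0 * y (inord 2) 0))) = 1.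
  by rewrite -q2 /s -exprMn mulVf // expr1n.
have s0 : 0 < s by rewrite invr_gt0.
have a1 := congr1 (fun r => s ^+ 2 * r) hx.
have a2 := congr1 (fun r => s ^+ 2 * r) hy.
rewrite /= in a1 a2.
split.
- split; [split| |]; rewrite /= ?bil_lorentzE !mxE ?x0 ?y0.
  + nra.
  + by lra.
  + nra.
  + nra.
- rewrite /backward_end /= -scalerBr !mxE x0 y0 scalerA.
  have -> : x + y - (y - x) = 2 *: x by rewrite scaler_nat mulr2n opprB addrA [x + y + x]addrAC addrK.
  rewrite scalerA (_ : _ * 2 = 1) ?scale1r //; field; rewrite ?gt_eqF //; lra.
- rewrite /forward_end /= -scalerDr !mxE x0 y0 scalerA.
  have -> : x + y + (y - x) = 2 *: y by rewrite scaler_nat mulr2n addrC addrA subrK.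
  rewrite scalerA (_ : _ * 2 = 1) ?scale1r //; field; rewrite ?gt_eqF //; lra.
Qed.

Section Quadratic.
Variables (R : realType) (n : nat).
Implicit Types (J A : 'M[R]_n) (U V K th : {vspace 'cV[R]_n}).

Definition SOform J : set 'M[R]_n :=
  [set A | A^T *m J *m A = J /\ \det A = 1].

Definition mximg A U : {vspace 'cV[R]_n} := (linfun (mulmx A) @: U)%VS.

Definition orth J U : {vspace 'cV[R]_n} :=
  (\bigcap_(v <- vbasis U) lker (linfun (mulmx (v^T *m J))))%VS.

Definition isotropic J U : Prop :=
  forall v w, v \in U -> w \in U -> bil J v w = 0.

Definition transverse U V : Prop := (U :&: V)%VS = 0%VS.

(* Hom(E/K, U), inside End(E). When E is the direct sum of W and K, this is
   Hom(W, U) = W^* (x) U, where W^* is the annihilator of K in E^*. *)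
Definition hom_space K U : set 'M[R]_n :=
  [set A | (forall v, v \in K -> A *m v = 0) /\ (forall v, A *m v \in U)].

(* 2-forms (u, v) |-> u^T W v on E vanishing as soon as one argument lies in K.
   When E is the direct sum of W and K, this is Lambda^2(W^* ). *)
Definition wedge2 K : set 'M[R]_n :=
  [set W | W^T = - W /\ forall v, v \in K -> W *m v = 0].

(* omega_f (u, v) = Q(u, f v) *)
Definition omega J (F : 'M[R]_n) : 'M[R]_n := J *m F.

Definition graph th (F : 'M[R]_n) : {vspace 'cV[R]_n} := mximg (1%:M + F) th.

(* The coordinate domain of the chart F |-> graph th0 F of the isotropic
   Grassmannian, for th0 transverse to th1: the F in Hom(th0, th1) such that
   omega_F is a 2-form. *)
Definition chart_dom J th1 : set 'M[R]_n :=
  [set F | hom_space th1 th1 F /\ (omega J F)^T = - omega J F].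

Definition velocity (c : R -> 'M[R]_n) (t : R) : 'M[R]_n :=
  \matrix_(i, j) derive1 (fun s : R => c s i j) t.

Definition C1_near (e : R) (c : R -> 'M[R]_n) : Prop :=
  forall i j,
    (forall t, `|t| < e -> derivable (fun s : R => c s i j) t 1) /\
    (forall t, `|t| < e -> {for t, continuous (derive1 (fun s : R => c s i j))}).

End Quadratic.

Lemma mem_orth (R : realType) n (J : 'M[R]_n) (U : {vspace 'cV[R]_n}) w :
  reflect (forall v, v \in U -> bil J v w = 0) (w \in orth J U).
Proof.
have E v : (w \in lker (linfun (mulmx (v^T *m J)))) = (bil J v w == 0).
  rewrite memv_ker lfunE /= /bil; apply/eqP/eqP => [->|h]; first by rewrite mxE.
  by apply/matrixP => i j; rewrite !ord1 h mxE.
have key (X : seq 'cV[R]_n) :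
    (w \in (\bigcap_(v <- X) lker (linfun (mulmx (v^T *m J))))%VS) =
    all (fun v => bil J v w == 0) X.
  elim: X => [|v X IH]; first by rewrite big_nil memvf.
  by rewrite big_cons memv_cap E IH.
rewrite /orth key; apply: (iffP allP) => h v vU; last by rewrite h // vbasis_mem.
rewrite (coord_vbasis vU) /bil !linear_sum /= !mulmx_suml summxE big1 // => i _.
rewrite linearZ /= -!scalemxAl mxE.
have iU : (i < size (vbasis U))%N by rewrite size_tuple.
have e := elimT eqP (h _ (mem_nth 0 iU)).
by move: e; rewrite /bil => ->; rewrite mulr0.
Qed.

Section Lagrangians.
Variables (R : realType) (p : nat).
Implicit Types (J : 'M[R]_(p + p)) (M : set {vspace 'cV[R]_(p + p)}).

Definition split_signature J : Prop :=
  exists2 P : 'M[R]_(p + p), P \in unitmx &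
    P^T *m J *m P = block_mx 1%:M 0 0 (- 1%:M).

Definition Lagr J : set {vspace 'cV[R]_(p + p)} :=
  [set th | isotropic J th /\ \dim th = p].

(* M is a one-dimensional embedded submanifold of class C^1 of Lagr J: in some
   chart around each of its points, it is parametrised by a C^1 immersion c of
   an interval which is a homeomorphism onto its image (with inverse g). *)
Definition smooth_curve J M : Prop :=
  M `<=` Lagr J /\
  forall th0, M th0 ->
  exists2 th1, Lagr J th1 /\ transverse th0 th1 &
  exists (e : R) (c : R -> 'M[R]_(p + p)) (g : 'M[R]_(p + p) -> R)
         (O : set 'M[R]_(p + p)),
    let I := [set t : R | `|t| < e] in
    [/\ 0 < e /\ c 0 = 0,
        C1_near e c,
        forall t, I t -> velocity c t != 0,
        open O /\
        c @` I = [set F | [/\ O F, chart_dom J th1 F & M (graph th0 F)]] &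
        (forall t, I t -> g (c t) = t) /\ {within c @` I, continuous g}].

(* The tangent space of M at th0, in the space of 2-forms on th0 (extended by
   zero on th1): the omega_f, for f the velocity at 0 of a C^1 curve drawn on M
   and read in the chart given by (th0, th1). *)
Definition tangent_space J M (th0 th1 : {vspace 'cV[R]_(p + p)}) :
    set 'M[R]_(p + p) :=
  [set W | exists (e : R) (c : R -> 'M[R]_(p + p)),
    [/\ 0 < e /\ c 0 = 0,
        C1_near e c,
        forall t, `|t| < e -> chart_dom J th1 (c t) /\ M (graph th0 (c t)) &
        W = omega J (velocity c 0)]].

End Lagrangians.

(* The flat bundle is the quotient by Gamma of T1H2 x E, with Gamma acting by
   (g u, rho(g) v) and flow (u, v) |-> (geoflow t u, v). Its subbundles,
   metrics, ... are given by their Gamma-invariant lifts to T1H2. Values outside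
   T1H2 are irrelevant. *)

Section FlatBundles.
Variables (R : realType) (n : nat).
Variables (Gamma : set 'M[R]_3) (rho : 'M[R]_3 -> 'M[R]_n).

Definition subbundle : Type := 'cV[R]_3 * 'cV[R]_3 -> {vspace 'cV[R]_n}.

Definition continuous_line_bundle (L : subbundle) : Prop :=
  forall u, T1H2 u -> exists2 U, nbhs u U &
  exists2 s : 'cV[R]_3 * 'cV[R]_3 -> 'cV[R]_n,
    {within U `&` @T1H2 R, continuous s} &
    forall v, (U `&` @T1H2 R) v -> s v != 0 /\ L v = <[s v]>%VS.

Definition equivariant (L : subbundle) : Prop :=
  forall g u, Gamma g -> T1H2 u -> L (isom_act g u) = mximg (rho g) (L u).

Definition flow_invariant (L : subbundle) : Prop :=
  forall t u, T1H2 u -> L (geoflow t u) = L u.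

(* The subbundle Hom(E/K, L) of the flat bundle End(E). *)
Definition hom_bundle (K L : subbundle) (u : 'cV[R]_3 * 'cV[R]_3) :
  set 'M[R]_n := hom_space (K u) (L u).

(* A continuous metric on (the quotient by Gamma of) a subbundle B of the flat
   bundle End(E), on which Gamma acts by conjugation. *)
Definition continuous_metric (B : 'cV[R]_3 * 'cV[R]_3 -> set 'M[R]_n)
    (N : 'cV[R]_3 * 'cV[R]_3 -> 'M[R]_n -> R) : Prop :=
  [/\ forall u A, T1H2 u -> B u A -> A != 0 -> 0 < N u A,
      forall u A a, T1H2 u -> B u A -> N u (a *: A) = `|a| * N u A,
      forall u A A', T1H2 u -> B u A -> B u A' -> N u (A + A') <= N u A + N u A',
      forall g u A, Gamma g -> T1H2 u -> B u A ->
        N (isom_act g u) (rho g *m A *m invmx (rho g)) = N u A &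
      {within [set z | T1H2 z.1 /\ B z.1 z.2],
        continuous (fun z : ('cV[R]_3 * 'cV[R]_3) * 'M[R]_n => N z.1 z.2)}].

Definition contracted (B : 'cV[R]_3 * 'cV[R]_3 -> set 'M[R]_n) : Prop :=
  exists2 N, continuous_metric B N &
  exists a b : R, [/\ 0 < a, 0 < b &
    forall t u A, 0 < t -> T1H2 u -> B u A ->
      N (geoflow t u) A <= a * expR (- (b * t)) * N u A].

End FlatBundles.

Section BorelAnosov.
Variables (R : realType) (p : nat) (J : 'M[R]_(p + p)).
Variables (Gamma : set 'M[R]_3) (rho : 'M[R]_3 -> 'M[R]_(p + p)).

(* rho is only relevant on Gamma. *)
Definition representation : Prop :=
  (forall g, Gamma g -> SOform J (rho g)) /\
  (forall g h, Gamma g -> Gamma h -> rho (g *m h) = rho g *m rho h).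

Variables E Eb : nat -> subbundle R (p + p).

Definition sumE (L : nat -> subbundle R (p + p)) : subbundle R (p + p) :=
  fun u => (\sum_(1 <= i < p.+1) L i u)%VS.

(* The sum of all the lines but E_i; the dual line E_i^* is its annihilator. *)
Definition others (i : nat) : subbundle R (p + p) :=
  fun u => (\sum_(1 <= k < p.+1 | k != i) E k u + sumE Eb u)%VS.

(* The lines E_1, ..., E_p, Eb_1, ..., Eb_p exhibit rho as Borel Anosov. Since
   there are 2p of them in dimension 2p, their sum is direct. *)
Definition borel_anosov_splitting : Prop :=
  [/\ forall i, (1 <= i <= p)%N ->
        [/\ continuous_line_bundle (E i), continuous_line_bundle (Eb i),
            equivariant Gamma rho (E i) & equivariant Gamma rho (Eb i)],
      forall u, T1H2 u -> (sumE E u + sumE Eb u)%VS = fullv,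
      forall i, (1 <= i <= p)%N -> flow_invariant (E i) /\ flow_invariant (Eb i),
      forall u, T1H2 u ->
        [/\ isotropic J (sumE E u), isotropic J (sumE Eb u),
            forall i j, (1 <= i <= p)%N -> (1 <= j <= p)%N -> i != j ->
              isotropic J (E i u + Eb j u)%VS &
            forall i, (1 <= i <= p)%N ->
              forall v, v \in (E i u + Eb i u)%VS ->
              (forall w, w \in (E i u + Eb i u)%VS -> bil J v w = 0) -> v = 0] &
      (forall i, (1 <= i < p)%N ->
         contracted Gamma rho (hom_bundle (others i) (Eb p))) /\
      (forall i j, (1 <= i)%N -> (i < j <= p)%N ->
         contracted Gamma rho (hom_bundle (others i) (E j)))].

End BorelAnosov.

Section LimitCurves.
Variables (R : realType) (p : nat).

(* The fibre of a flow-invariant bundle along the geodesic from x to y. *)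
Definition fib (L : subbundle R (p + p)) (x y : 'cV[R]_3) :=
  L (geod_pt x y).

(* The sum of the E_i(x, y) does not depend on y, nor that of the Eb_i(x, y)
   on x: the other endpoint is taken to be the antipode. *)
Definition Theta (E : nat -> subbundle R (p + p)) (x : 'cV[R]_3) :=
  fib (sumE E) x (antipode x).

Definition Thetab (Eb : nat -> subbundle R (p + p)) (y : 'cV[R]_3) :=
  fib (sumE Eb) (antipode y) y.

End LimitCurves.

(* Main.v *)
Require Import Defs.
From mathcomp Require Import all_boot all_order all_algebra.
From mathcomp Require Import all_classical all_reals all_analysis.
From mathcomp Require Import ring lra zify.
Import Order.TTheory GRing.Theory Num.Theory.
Import numFieldNormedType.Exports.
Set Implicit Arguments.
Unset Strict Implicit.
Unset Printing Implicit Defensive.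
Local Open Scope classical_set_scope.
Local Open Scope ring_scope.

(** A point of the boundary circle is compared with the others through slopes.
    Fix distinct points x and y and choose vectors V_1, ..., V_p of the lines
    E_i(x, y) and W_1, ..., W_p of the dual lines. A Lagrangian transverse to
    Thetab y is the graph of an antisymmetric matrix S, its slope
    (slope_antisym), defined up to the rescaling S_ij -> c_i c_j S_ij coming
    from the choice of the vectors. Transversality of the triple (x, y, z)
    forces the slope of Theta z to have a nonzero coefficient on the last two
    vectors (slope_neq0).

    The group acts cocompactly on frames, that is on triples of boundary points,
    the triple (x, y, z) being placed at the projection of z to the geodesic
    from x to y. Measured there with an invariant metric, the other coefficients
    of the slope are therefore bounded by a uniform multiple of that one
    (slope_ratio_bounded). When z tends to x its projection goes to the backward
    end of the geodesic. Moving from the projection back to a point that stays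
    in a compact set means flowing forwards for a long time, which contracts
    E_i^* (x) E_j for i < j and hence the ratio of each S_ij to the last
    coefficient: this ratio tends to 0 (slope_ratio_small). The chord from
    Theta x to Theta z thus becomes parallel to the line
    Lambda^2 (E_(p-1)^* + E_p^* ), and it does so uniformly in x.

    Read in a fixed chart, where a change of base point is a translation
    (chartmx_cocycle), this gives a continuous curve whose chords have strict
    slopes (curve_slope): whenever both end points of a chord converge to one
    point, its direction converges. Such a curve is continuously differentiable
    once it is parametrised by its last coordinate (strict_slope_param). It is
    embedded because Theta is injective on a compact circle (Theta_proper).
    The tangent line is the limit of the chords, and a differentiable curve
    drawn on the image cannot have another velocity (tangent_velocity).

    That Theta x depends on one end point only is proved with the same slopes.
    Two geodesics with the same backward end point come together under the
    backward flow, along a horocycle. Their slope with respect to each other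
    stays bounded while the flow expands each of its off-diagonal coefficients,
    so that these vanish; the diagonal vanishes by antisymmetry
    (horo_slope0). *)

(** * Limits of matrices *)

Lemma le_entry_norm (R : realType) m n (M : 'M[R]_(m, n)) i j : `|M i j| <= `|M|.
Proof.
rewrite {2}/Num.norm/= mx_normrE.
exact: (le_bigmax _ (fun ij : 'I_m * 'I_n => `|M ij.1 ij.2|) (i, j)).
Qed.

Section MatrixLimits.
Variables (R : realType) (T : Type) (F : set_system T).
Context {FF : Filter F}.

Lemma cvg_mx_entries m n (f : T -> 'M[R]_(m, n)) (M : 'M[R]_(m, n)) :
  (forall i j, f x i j @[x --> F] --> M i j) -> f @ F --> M.
Proof.
move=> fM; apply/cvgrPdist_lt => e e0.
have : \forall x \near F, forall ij : 'I_m * 'I_n, `|M ij.1 ij.2 - f x ij.1 ij.2| < e.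
  by apply: filter_forall => -[i j] /=; have /cvgrPdist_lt := fM i j; apply.
apply: filterS => x xe.
rewrite /Num.norm/= mx_normrE (bigmax_lt _ e0)// => -[i j] _.
by rewrite !mxE; apply: xe (i, j).
Qed.

Lemma cvg_mx_entry m n (f : T -> 'M[R]_(m, n)) (M : 'M[R]_(m, n)) i j :
  f @ F --> M -> f x i j @[x --> F] --> M i j.
Proof. by move=> fM; exact: (cvg_comp _ _ fM (@coord_continuous R m n i j M)). Qed.

Lemma cvg_sumr (I : finType) (P : pred I) (f : I -> T -> R) (l : I -> R) :
  (forall i, P i -> f i @ F --> l i) ->
  (\sum_(i | P i) f i x) @[x --> F] --> \sum_(i | P i) l i.
Proof.
move=> fl; rewrite [X in X --> _](_ : _ = (fun x => \sum_(i <- enum P) f i x) @ F).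
  rewrite -big_enum/=; have : {subset enum P <= P} by move=> i; rewrite mem_enum.
  elim: (enum P) => [_|i s IH si].
    by under eq_fun do rewrite big_nil; rewrite big_nil; exact: cvg_cst.
  under eq_fun do rewrite big_cons.
  rewrite big_cons; apply: cvgD; first by apply/fl/si/mem_head.
  by apply: IH => k ks; apply: si; rewrite inE ks orbT.
by congr (_ @ F); apply/funext => x; rewrite big_enum.
Qed.

Lemma cvg_prodr (I : finType) (f : I -> T -> R) (l : I -> R) :
  (forall i, f i @ F --> l i) ->
  (\prod_i f i x) @[x --> F] --> \prod_i l i.
Proof.
move=> fl; elim: (index_enum I) => [|i s IH].
  by under eq_fun do rewrite big_nil; rewrite big_nil; exact: cvg_cst.
under eq_fun do rewrite big_cons.
by rewrite big_cons; apply: cvgM => //; apply: fl.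
Qed.

Lemma cvg_mulmx m n k (f : T -> 'M[R]_(m, n)) (g : T -> 'M[R]_(n, k))
    (A : 'M[R]_(m, n)) (B : 'M[R]_(n, k)) :
  f @ F --> A -> g @ F --> B -> (f x *m g x) @[x --> F] --> A *m B.
Proof.
move=> fA gB; apply: cvg_mx_entries => i j; rewrite mxE.
under eq_fun do rewrite mxE.
by apply: cvg_sumr => l _; apply: cvgM; apply: cvg_mx_entry.
Qed.

Lemma cvg_trmx m n (f : T -> 'M[R]_(m, n)) (A : 'M[R]_(m, n)) :
  f @ F --> A -> (f x)^T @[x --> F] --> A^T.
Proof.
move=> fA; apply: cvg_mx_entries => i j; rewrite mxE.
by under eq_fun do rewrite mxE; exact: cvg_mx_entry.
Qed.

Lemma cvg_col m n (f : T -> 'M[R]_(m, n)) (A : 'M[R]_(m, n)) k :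
  f @ F --> A -> col k (f x) @[x --> F] --> col k A.
Proof.
move=> fA; apply: cvg_mx_entries => i j; rewrite mxE.
by under eq_fun do rewrite mxE; exact: cvg_mx_entry.
Qed.

Lemma cvg_det n (f : T -> 'M[R]_n) (A : 'M[R]_n) :
  f @ F --> A -> \det (f x) @[x --> F] --> \det A.
Proof.
move=> fA; apply: cvg_sumr => s _; apply: cvgM; first exact: cvg_cst.
by apply: cvg_prodr => i; apply: cvg_mx_entry.
Qed.

Lemma cvg_invmx n (f : T -> 'M[R]_n) (A : 'M[R]_n) :
  f @ F --> A -> A \in unitmx -> invmx (f x) @[x --> F] --> invmx A.
Proof.
move=> fA uA; have dA := cvg_det fA.
have dA0 : \det A != 0 by rewrite -unitfE.
have nd : \forall x \near F, (\det (f x))^-1 *: \adj (f x) = invmx (f x).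
  have : \forall x \near F, \det (f x) != 0.
    exact: cvgr_neq0 dA dA0.
  by apply: filterS => x dx; rewrite /invmx unitmxE unitfE dx.
apply: (cvg_trans (near_eq_cvg nd)); rewrite /invmx uA.
apply: cvg_mx_entries => i j; rewrite !mxE.
under eq_fun do rewrite !mxE.
apply: cvgM; first exact: cvgV.
apply: cvgM; first exact: cvg_cst.
apply: cvg_det; apply: cvg_mx_entries => a b; rewrite !mxE.
by under eq_fun do rewrite !mxE; exact: cvg_mx_entry.
Qed.

Lemma near_unitmx n (f : T -> 'M[R]_n) (A : 'M[R]_n) :
  f @ F --> A -> A \in unitmx -> \forall x \near F, f x \in unitmx.
Proof.
move=> fA uA; have dA := cvg_det fA.
have dA0 : \det A != 0 by rewrite -unitfE.
have : \forall x \near F, \det (f x) != 0.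
  exact: cvgr_neq0 dA dA0.
by apply: filterS => x dx; rewrite unitmxE unitfE dx.
Qed.

End MatrixLimits.

(** * Curves with a strict slope *)

Section StrictDifferentiability.
Variables (R : realType) (n : nat).

(** Strict differentiability of F with respect to the value of phi: near s1, all
    chords of F are almost parallel to T, which is normalised by phi. *)
Definition strict_slope (phi : 'M[R]_n -> R) (F : R -> 'M[R]_n) (s1 : R)
    (T : 'M[R]_n) : Prop :=
  forall e : R, 0 < e -> exists2 r : R, 0 < r &
    forall s s', `|s - s1| < r -> `|s' - s1| < r -> s != s' ->
    phi (F s') != phi (F s) /\
    `|F s' - F s - (phi (F s') - phi (F s)) *: T|
       <= e * `|phi (F s') - phi (F s)|.

Variables (phi : 'M[R]_n -> R) (F T : R -> 'M[R]_n) (d : R).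
Hypothesis phi_cont : continuous phi.
Hypothesis d_gt0 : 0 < d.
Hypothesis F_cont : forall s : R, `|s| < d -> {for s, continuous F}.
Hypothesis F_slope : forall s, `|s| < d -> strict_slope phi F s (T s).

(** A chord close to both points has a direction close to both slopes. *)
Lemma slope_cont s1 : `|s1| < d -> {for s1, continuous T}.
Proof.
move=> s1d; apply/cvgrPdist_le => e e0.
have e20 : 0 < e / 2 by lra.
have [r r0 Hr] := F_slope s1d e20.
have : \forall s \near s1, `|s| < d /\ `|s - s1| < r.
  near=> s; split; last by rewrite distrC; near: s; exact: cvgr_dist_lt.
  by near: s; apply: (cvgr_norm_lt (s1 : R^o)).
apply: filterS => s [sd sr].
have [r' r'0 Hr'] := F_slope sd e20.
pose m := Num.min (r - `|s - s1|) r'.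
have m0 : 0 < m by rewrite lt_min r'0 andbT; lra.
pose s' := s + m / 2.
have ss' : `|s' - s| = m / 2 by rewrite /s' addrC addKr gtr0_norm //; lra.
have m1 : m <= r - `|s - s1| by rewrite ge_min lexx.
have m2 : m <= r' by rewrite ge_min lexx orbT.
have ns : s != s' by rewrite eq_sym -subr_eq0 -normr_gt0 ss'; lra.
have [|n1 h1] := Hr s s' sr _ ns.
  by have := ler_distD s s' s1; lra.
have [||_ h2] := Hr' s s' _ _ ns; rewrite ?subrr ?normr0 //; first by lra.
set q := phi (F s') - phi (F s) in h1 h2.
have q0 : 0 < `|q| by rewrite normr_gt0 subr_eq0.
rewrite -(ler_pM2l q0) -normrZ.
have -> : q *: (T s1 - T s) = (F s' - F s - q *: T s) - (F s' - F s - q *: T s1).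
  by rewrite opprB [RHS]addrC addrA subrK scalerBr.
by apply: le_trans (ler_normB _ _) _; lra.
Unshelve. all: by end_near. Qed.

(** Strictness makes phi injective along the curve near 0, with a continuous
    inverse sigma since the parameter is real. The increment of phi then is the
    increment of the new parameter, so that a strict slope is a derivative. *)
Lemma strict_slope_param : F 0 = 0 -> phi 0 = 0 ->
  exists (d' : R) (e : R) (sigma : R -> R),
    [/\ 0 < d' <= d, 0 < e,
      forall t, `|t| < e -> `|sigma t| < d' /\ phi (F (sigma t)) = t,
      forall s, `|s| < d' -> `|phi (F s)| < e -> sigma (phi (F s)) = s &
      C1_near e (F \o sigma) /\
      forall t, `|t| < e -> velocity (F \o sigma) t = T (sigma t)].
Proof.
move=> F0 phi0.
have d0 : `|0 : R| < d by rewrite normr0.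
have [r r0 Hr] := F_slope d0 ltr01.
pose d' := Num.min r d.
have d'0 : 0 < d' by rewrite lt_min r0.
have d'd : d' <= d by rewrite ge_min lexx orbT.
have d'r : d' <= r by rewrite ge_min lexx.
pose a s := phi (F s).
have a_inj s s' : `|s| < d' -> `|s'| < d' -> a s = a s' -> s = s'.
  move=> sd s'd ass; apply: contrapT => /eqP ns.
  by have [||/eqP] := Hr s s' _ _ ns; rewrite ?subr0; try lra; case.
pose sigma t := xget 0 [set s : R | `|s| < d' /\ a s = t].
have sK s : `|s| < d' -> sigma (a s) = s.
  move=> sd; rewrite /sigma; case: xgetP => [x _ [xd ax]|/(_ s)]; first exact: a_inj.
  by case.
have a0 : a 0 = 0 by rewrite /a F0.
have near0 : \forall s \near (0 : R), `|s| < d'.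
  by near=> s; rewrite -[s]subr0 distrC; near: s; apply: cvgr_dist_lt.
have [sct scan] := @near_can_continuousAcan_sym R a sigma 0
   (filterS sK near0)
   (filterS (fun s sd => cvg_comp _ _ (F_cont (lt_le_trans sd d'd)) (phi_cont (x := F s))) near0).
rewrite a0 in sct scan.
have s0 : sigma 0 = 0 by rewrite -[X in sigma X]a0 sK ?normr0.
have near1 : \forall t \near (0 : R), `|sigma t| < d'.
  have /cvgrPdist_lt /(_ _ d'0) := nbhs_singleton sct.
  by apply: filterS => t; rewrite s0 sub0r normrN.
have [e /= e0 He] : exists2 e : R, 0 < e & forall t, `|t| < e ->
    [/\ {for t, continuous sigma}, a (sigma t) = t & `|sigma t| < d'].
  have /nbhs_ballP[e /= e0 He] : \forall t \near (0 : R),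
      [/\ {for t, continuous sigma}, a (sigma t) = t & `|sigma t| < d'].
    by near=> t; split; near: t.
  by exists e => // t te; apply: He; rewrite /ball/= sub0r normrN.
have nearE (t : R) : `|t| < e -> \forall t' \near t, `|t'| < e.
  by move=> te; have /cvgr_norm_lt/(_ e te) := @cvg_id _ (nbhs t).
have der (t : R) i j : `|t| < e ->
    is_derive t 1 (fun s => (F \o sigma) s i j) (T (sigma t) i j).
  move=> te; have [ct at_ dt] := He t te.
  have : (fun h => h^-1 *: (((fun s => (F \o sigma) s i j) \o shift t) (h *: 1) -
      (F \o sigma) t i j)) @ 0^' --> T (sigma t) i j.
    apply/cvgrPdist_le => eps eps0.
    have [r' r'0 Hr'] := F_slope (lt_le_trans dt d'd) eps0.
    have sh : (fun h : R => h + t) @ 0^' --> t.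
      apply/cvgrPdist_lt => e1 e10; apply: nbhs_dnbhs.
      have /cvgrPdist_lt/(_ _ e10) := @cvg_id _ (nbhs (0 : R)).
      by apply: filterS => h; rewrite sub0r opprD addrCA subrr addr0.
    have H1 : \forall h \near 0^', `|sigma t - sigma (h + t)| < r'.
      by have /cvgrPdist_lt/(_ _ r'0) Hb := ct; exact: (sh _ Hb).
    have H2 : \forall h \near 0^', `|h + t| < e by exact: (sh _ (nearE _ te)).
    have H3 : \forall h \near (0 : R)^', h != 0 by exact: nbhs_dnbhs_neq.
    near=> h.
    have h0 : h != 0 by near: h.
    have [_ at' dt'] : [/\ {for h + t, continuous sigma}, a (sigma (h + t)) = h + t & `|sigma (h + t)| < d'].
      by apply: He; near: h.
    have ns : sigma t != sigma (h + t).
      by apply/eqP => E; move: at'; rewrite -E at_ => /eqP; rewrite -subr_eq0 opprD addrCA subrr addr0 oppr_eq0; exact/negP.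
    have [||_] := Hr' (sigma t) (sigma (h + t)) _ _ ns; rewrite ?subrr ?normr0 //.
      by rewrite distrC; near: h.
    rewrite -/(a _) -/(a (sigma t)) at' at_ addrK => Hh.
    rewrite -(ler_pM2l (_ : 0 < `|h|)) ?normr_gt0 // -normrM mulrBr /=.
    rewrite [h * (_ *: _)]mulrA mulfV // mul1r distrC.
    rewrite [leRHS]mulrC; apply: le_trans Hh; apply: le_trans (le_entry_norm _ i j).
    by rewrite (_ : h%:A = h) ?mxE//; exact: mulr1.
  move=> H; split; last by apply: cvg_lim.
  by apply/cvg_ex; eexists; exact: H.
exists d', e, sigma; split => //.
- by rewrite d'0.
- by move=> t /He[].
- by move=> s sd _; rewrite sK.
split.
  move=> i j; split=> [t te|t te]; first by have [] := der t i j te.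
  have E : \forall t' \near t, T (sigma t') i j = derive1 (fun s : R => (F \o sigma) s i j) t'.
    by apply: filterS (nearE _ te) => t' t'e; rewrite derive1E; have [_ ->] := der t' i j t'e.
  have [ct at_ dt] := He t te.
  rewrite /prop_for /continuous_at -(nbhs_singleton E).
  apply: cvg_trans (near_eq_cvg E) _.
  apply: cvg_mx_entry.
  by apply: (cvg_comp _ _ ct); exact: (slope_cont (lt_le_trans dt d'd)).
move=> t te; apply/matrixP => i j; rewrite mxE derive1E.
by have [_ ->] := der t i j te.
Unshelve. all: by end_near. Qed.
End StrictDifferentiability.

(** * Frames of the hyperbolic plane *)

Section Bil.
Variables (R : realType) (n : nat) (J : 'M[R]_n).
Implicit Types (u v w : 'cV[R]_n) (a : R).

Lemma bilDl u v w : bil J (u + v) w = bil J u w + bil J v w.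
Proof. by rewrite /bil linearD !mulmxDl mxE. Qed.
Lemma bilDr u v w : bil J u (v + w) = bil J u v + bil J u w.
Proof. by rewrite /bil mulmxDr mxE. Qed.
Lemma bilZl a v w : bil J (a *: v) w = a * bil J v w.
Proof. by rewrite /bil linearZ -!scalemxAl mxE. Qed.
Lemma bilZr a v w : bil J v (a *: w) = a * bil J v w.
Proof. by rewrite /bil -scalemxAr mxE. Qed.
Lemma bilNl v w : bil J (- v) w = - bil J v w.
Proof. by rewrite -scaleN1r bilZl mulN1r. Qed.
Lemma bilNr v w : bil J v (- w) = - bil J v w.
Proof. by rewrite -scaleN1r bilZr mulN1r. Qed.
Lemma bil_sym v w : J^T = J -> bil J v w = bil J w v.
Proof.
move=> sJ; rewrite /bil.
have <- : (w^T *m J *m v)^T = v^T *m J *m w by rewrite !trmx_mul trmxK sJ mulmxA.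
by rewrite mxE.
Qed.

Definition bilE := (bilDl, bilDr, bilNl, bilNr, bilZl, bilZr).

Lemma bil_entries m k (A : 'M[R]_(n, m)) (B : 'M[R]_(n, k)) i j :
  (A^T *m J *m B) i j = bil J (col i A) (col j B).
Proof.
rewrite /bil !mxE; apply: eq_bigr => l _; rewrite !mxE; congr (_ * _).
by apply: eq_bigr => r _; rewrite !mxE.
Qed.

End Bil.

Section HypFrames.
Variable R : realType.
Local Notation L := (lorentz R).
Local Notation B := (bil (lorentz R)).
Implicit Types (h g a : 'M[R]_3) (x y z v w n : 'cV[R]_3).

Lemma lorentz_sym : L^T = L.
Proof. by rewrite /lorentz tr_diag_mx. Qed.

Lemma lorentzC v w : B v w = B w v.
Proof. exact: bil_sym lorentz_sym. Qed.

Definition o2 : 'I_3 := inord 2.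

Lemma o2_val : nat_of_ord o2 = 2. Proof. by rewrite /o2 inordK. Qed.
Lemma o2_n0 : (o2 == 0) = false. Proof. by rewrite -val_eqE /= o2_val. Qed.
Lemma o2_n1 : (o2 == 1) = false. Proof. by rewrite -val_eqE /= o2_val. Qed.

Lemma ord3P (P : 'I_3 -> Prop) : P 0 -> P 1 -> P o2 -> forall i, P i.
Proof.
move=> P0 P1 P2 i; case: (unliftP 0 i) => [k ->|-> //].
case: (unliftP 0 k) => [l ->|->].
  rewrite (ord1 l); suff <- : o2 = lift 0 (lift 0 0) by [].
  by apply/val_inj; rewrite /= o2_val.
by have <- : 1 = lift 0 0 :> 'I_3 by apply/val_inj.
Qed.

Lemma lorentzK : L *m L = 1%:M.
Proof.
rewrite /lorentz mulmx_diag -diag_const_mx; congr diag_mx.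
by apply/rowP => i; rewrite !mxE; case: ifP => _; rewrite ?mulrNN mulr1.
Qed.

(** A frame is an isometry, seen as the triple of its columns: a point of the
    hyperbolic plane followed by an orthonormal basis of its tangent plane. *)
Definition hypframe v w n : 'M[R]_3 :=
  \matrix_(i, j) (if j == 0 then v i 0 else if j == 1 then w i 0 else n i 0).

Lemma col0_hypframe v w n : col 0 (hypframe v w n) = v.
Proof. by apply/colP => i; rewrite !mxE. Qed.
Lemma col1_hypframe v w n : col 1 (hypframe v w n) = w.
Proof. by apply/colP => i; rewrite !mxE. Qed.
Lemma col2_hypframe v w n : col o2 (hypframe v w n) = n.
Proof. by apply/colP => i; rewrite !mxE o2_n0 o2_n1. Qed.

Definition hypframeE := (col0_hypframe, col1_hypframe, col2_hypframe).

Lemma hypframe_eta h : hypframe (col 0 h) (col 1 h) (col o2 h) = h.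
Proof.
by apply/matrixP => i; apply: ord3P; rewrite !mxE // o2_n0 o2_n1.
Qed.

Lemma isomH2P h : isomH2 h <->
  [/\ B (col 0 h) (col 0 h) = -1, B (col 1 h) (col 1 h) = 1,
      B (col o2 h) (col o2 h) = 1,
      [/\ B (col 0 h) (col 1 h) = 0, B (col 0 h) (col o2 h) = 0 &
          B (col 1 h) (col o2 h) = 0] & 0 < col 0 h 0 0].
Proof.
rewrite /isomH2/=.
have E : h^T *m L *m h = L <-> forall i j, B (col i h) (col j h) = L i j.
  split=> [H i j|H]; first by rewrite -bil_entries H.
  by apply/matrixP => i j; rewrite bil_entries.
have L2 i : L i i = if i == 0 then -1 else 1 by rewrite !mxE eqxx.
have L3 i j : i != j -> L i j = 0 by move=> /negPf ij; rewrite !mxE ij.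
have n02 : 0 != o2 :> 'I_3 by rewrite eq_sym o2_n0.
have n12 : 1 != o2 :> 'I_3 by rewrite eq_sym o2_n1.
rewrite mxE; split=> [[/E H h0]|[H1 H2 H3 [H4 H5 H6] h0]].
  by rewrite !H !L2 !L3 //= ?(negPf n02) eq_sym (negPf n02).
split => //; apply/E; apply: ord3P; apply: ord3P; rewrite ?L2 ?L3 // 1?eq_sym//= 1?lorentzC //.
by rewrite (negPf n02).
Qed.

Lemma isomH2_tr h : isomH2 h -> h *m L *m h^T = L.
Proof.
move=> [H _]; have E : (L *m h^T *m L) *m h = 1%:M by rewrite -!mulmxA (mulmxA h^T) H lorentzK.
have := mulmx1C E; rewrite !mulmxA => E2.
by rewrite -[LHS]mulmx1 -lorentzK mulmxA E2 mul1mx.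
Qed.

Lemma isomH2_row0 h : isomH2 h -> h 0 0 ^+ 2 = 1 + h 0 1 ^+ 2 + h 0 o2 ^+ 2.
Proof.
move=> /isomH2_tr H; have := congr1 (fun A : 'M[R]_3 => A 0 0) H.
rewrite /= -{1}[h]trmxK bil_entries bil_lorentzE !mxE /= -/o2; lra.
Qed.

Lemma isomH2M g h : isomH2 g -> isomH2 h -> isomH2 (g *m h).
Proof.
move=> ig ih; have [Hg g0] := ig; have [Hh h0] := ih; split.
  by rewrite trmx_mul -!mulmxA (mulmxA L) (mulmxA g^T) (mulmxA g^T) Hg mulmxA.
have rg := isomH2_row0 ig.
have /isomH2P[ch _ _ _ _] := ih; rewrite bil_lorentzE !mxE -/o2 in ch.
have -> : (g *m h) 0 0 = g 0 0 * h 0 0 + g 0 1 * h 1 0 + g 0 o2 * h o2 0.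
  rewrite !mxE !big_ord_recl big_ord0 addr0 addrA.
  have -> : lift ord0 ord0 = 1 :> 'I_3 by apply/val_inj.
  by have -> : lift ord0 (lift ord0 ord0) = o2 :> 'I_3 by apply/val_inj; rewrite /= o2_val.
set a := g 0 1 in rg *; set b := g 0 o2 in rg *; set c := h 1 0 in ch *; set e := h o2 0 in ch *.
set G := g 0 0 in rg g0 *; set H := h 0 0 in ch h0 *.
have cs : (a * c + b * e) ^+ 2 <= (a ^+ 2 + b ^+ 2) * (c ^+ 2 + e ^+ 2).
  by have := sqr_ge0 (a * e - b * c); nra.
have lt : (a * c + b * e) ^+ 2 < (G * H) ^+ 2.
  apply: le_lt_trans cs _; rewrite exprMn rg.
  have -> : H ^+ 2 = 1 + (c ^+ 2 + e ^+ 2) by lra.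
  have := sqr_ge0 a; have := sqr_ge0 b; have := sqr_ge0 c; have := sqr_ge0 e; nra.
have GH : 0 < G * H by apply: mulr_gt0.
rewrite -addrA; have : - (a * c + b * e) < G * H.
  rewrite ltNge; apply/negP => le; move: lt; rewrite ltNge => /negP; apply.
  by move: (G * H) (a * c + b * e) GH le => X m X0 le; nra.
lra.
Qed.

Definition base h : 'cV[R]_3 * 'cV[R]_3 := (col 0 h, col 1 h).

Lemma baseM g h : base (g *m h) = isom_act g (base h).
Proof. by rewrite /base /isom_act !colE !mulmxA. Qed.

Lemma base_T1H2 h : isomH2 h -> T1H2 (base h).
Proof. by case/isomH2P => a b c [d e f] g; split. Qed.

(** Isometries also act on frames on the right, by combining the columns. The
    four families below move a frame along its geodesic, slide it along the
    horocycle based at its backward end point, reverse it, and rotate it by a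
    right angle. *)
Lemma mul_frame h a : h *m a =
  hypframe (a 0 0 *: col 0 h + a 1 0 *: col 1 h + a o2 0 *: col o2 h)
           (a 0 1 *: col 0 h + a 1 1 *: col 1 h + a o2 1 *: col o2 h)
           (a 0 o2 *: col 0 h + a 1 o2 *: col 1 h + a o2 o2 *: col o2 h).
Proof.
have E j : col j (h *m a) = a 0 j *: col 0 h + a 1 j *: col 1 h + a o2 j *: col o2 h.
  apply/colP => i; rewrite !mxE !big_ord_recl big_ord0 addr0 addrA.
  have -> : lift ord0 ord0 = 1 :> 'I_3 by apply/val_inj.
  have -> : lift ord0 (lift ord0 ord0) = o2 :> 'I_3 by apply/val_inj; rewrite /= o2_val.
  by rewrite ![a _ _ * _]mulrC; congr (_ + _); congr (_ + _).
by rewrite -[LHS]hypframe_eta !E.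
Qed.

Definition boost (t : R) : 'M[R]_3 :=
  let ch := (expR t + expR (- t)) / 2 in
  let sh := (expR t - expR (- t)) / 2 in
  hypframe (\col_i [:: ch; sh; 0]`_i) (\col_i [:: sh; ch; 0]`_i)
           (\col_i [:: 0; 0; 1]`_i).

Definition horo (s : R) : 'M[R]_3 :=
  hypframe (\col_i [:: 1 + s ^+ 2 / 2; - (s ^+ 2 / 2); s]`_i)
           (\col_i [:: s ^+ 2 / 2; 1 - s ^+ 2 / 2; s]`_i)
           (\col_i [:: s; - s; 1]`_i).

Definition refl : 'M[R]_3 :=
  hypframe (\col_i [:: 1; 0; 0]`_i) (\col_i [:: 0; -1; 0]`_i) (\col_i [:: 0; 0; 1]`_i).

Definition turn : 'M[R]_3 :=
  hypframe (\col_i [:: 1; 0; 0]`_i) (\col_i [:: 0; 0; -1]`_i) (\col_i [:: 0; 1; 0]`_i).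

Definition frameE := (mxE, o2_n0, o2_n1, o2_val, eqxx).

Lemma base_boost h t : base (h *m boost t) = geoflow t (base h).
Proof.
rewrite /base mul_frame !hypframeE /geoflow /= /boost; do !rewrite !frameE /=.
by rewrite !scale0r !addr0.
Qed.

Lemma isomH2_boost t : isomH2 (boost t).
Proof.
apply/isomH2P; rewrite !hypframeE !bil_lorentzE -/o2; do !rewrite !frameE /=.
have e : expR t * expR (- t) = 1 by rewrite -expRD subrr expR0.
have := expR_gt0 t; have := expR_gt0 (- t) => h1 h2.
by split; [nra|nra|lra|split; lra|lra].
Qed.

Lemma isomH2_horo s : isomH2 (horo s).
Proof.
apply/isomH2P; rewrite !hypframeE !bil_lorentzE -/o2; do !rewrite !frameE /=.
by split; [field|field|ring|split; field|have := sqr_ge0 s; lra].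
Qed.

Lemma isomH2_refl : isomH2 refl.
Proof.
apply/isomH2P; rewrite !hypframeE !bil_lorentzE -/o2; do !rewrite !frameE /=.
by split; [ring|ring|ring|split; ring|lra].
Qed.

Lemma isomH2_turn : isomH2 turn.
Proof.
apply/isomH2P; rewrite !hypframeE !bil_lorentzE -/o2; do !rewrite !frameE /=.
by split; [ring|ring|ring|split; ring|lra].
Qed.

Lemma boostD s t : boost s *m boost t = boost (s + t).
Proof.
rewrite mul_frame /boost opprD !expRD !hypframeE.
move: (expR s) (expR (- s)) (expR t) (expR (- t)) => x x' y y'.
by congr hypframe; apply/colP; apply: ord3P; do !rewrite !frameE /=; field.
Qed.

Lemma boost0 : boost 0 = 1%:M.
Proof.
rewrite /boost oppr0 expR0 -[RHS]hypframe_eta.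
by congr hypframe; apply/colP; apply: ord3P; do !rewrite !frameE /=; rewrite ?[0 == o2]eq_sym ?[1 == o2]eq_sym ?o2_n0 ?o2_n1 //=; field.
Qed.

Lemma horo0 : horo 0 = 1%:M.
Proof.
rewrite /horo -[RHS]hypframe_eta.
by congr hypframe; apply/colP; apply: ord3P; do !rewrite !frameE /=; rewrite ?[0 == o2]eq_sym ?[1 == o2]eq_sym ?o2_n0 ?o2_n1 //=; field.
Qed.

(** The backward flow contracts the horocycles based at the backward end. *)
Lemma boost_horo t : boost (- t) *m horo (expR (- t)) = horo 1 *m boost (- t).
Proof.
have E : expR (- t) != 0 by rewrite gt_eqF ?expR_gt0.
have -> : boost (- t) = let x := expR (- t) in let ch := (x + x^-1) / 2 in
  let sh := (x - x^-1) / 2 in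
  hypframe (\col_i [:: ch; sh; 0]`_i) (\col_i [:: sh; ch; 0]`_i)
           (\col_i [:: 0; 0; 1]`_i) by rewrite /boost -!expRN.
move: (expR (- t)) E => x x0.
by rewrite !mul_frame !hypframeE; congr hypframe; apply/colP; apply: ord3P; do !rewrite !frameE /=; field.
Qed.

Lemma boost_refl t : boost t *m refl = refl *m boost (- t).
Proof.
rewrite /boost opprK; move: (expR t) (expR (- t)) => x y.
by rewrite !mul_frame !hypframeE; congr hypframe; apply/colP; apply: ord3P; do !rewrite !frameE /=; ring.
Qed.
End HypFrames.

Arguments turn {R}.
Arguments refl {R}.

Lemma horo_cont (R : realType) (s0 : R) : {for s0, continuous (@horo R)}.
Proof.
have id_ : (fun s : R => s) @ nbhs s0 --> s0 by exact: cvg_id.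
have sq : (fun s : R => s ^+ 2 / 2) @ nbhs s0 --> s0 ^+ 2 / 2.
  exact: (cvgM (cvgM id_ id_) (cvg_cst _)).
apply: cvg_mx_entries => i j; move: i; apply: ord3P; move: j; apply: ord3P;
  rewrite !mxE ?o2_n0 ?o2_n1 ?o2_val /=; under eq_fun do rewrite !mxE ?o2_n0 ?o2_n1 ?o2_val /=;
  by do ?[exact: id_|exact: sq|exact: cvg_cst|apply: cvgD|apply: cvgN].
Qed.

Section EndPoints.
Variable R : realType.
Local Notation L := (lorentz R).
Local Notation B := (bil (lorentz R)).
Implicit Types (h g a : 'M[R]_3) (x y z v w n : 'cV[R]_3) (u : 'cV[R]_3 * 'cV[R]_3).

(** A nonzero null vector spans an isotropic line, hence a boundary point. The
    third point of a frame is the forward end of the geodesic perpendicular to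
    it, so that a frame is the same thing as a triple of boundary points. *)
Definition proj_null v : 'cV[R]_3 := (v 0 0)^-1 *: v.
Definition third h := proj_null (col 0 h + col o2 h).

Lemma proj_nullZ c v : c != 0 -> proj_null (c *: v) = proj_null v.
Proof.
by move=> c0; rewrite /proj_null mxE invfM scalerA mulrAC mulVf // mul1r.
Qed.

Lemma proj_null_bdry x : bdry x -> proj_null x = x.
Proof. by move=> [_ x0]; rewrite /proj_null x0 invr1 scale1r. Qed.

Lemma bdry_proj_null v : B v v = 0 -> v 0 0 != 0 -> bdry (proj_null v).
Proof.
by move=> v0 n0; split; [rewrite !bilE v0 !mulr0|rewrite mxE mulVf].
Qed.

Lemma null_pos (v w : 'cV[R]_3) : B v v = 0 -> B w w = 0 -> B v w < 0 -> 0 < v 0 0 * w 0 0.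
Proof.
rewrite !bil_lorentzE -/o2 => h1 h2 h3.
move: (v 0 0) (v 1 0) (v o2 0) (w 0 0) (w 1 0) (w o2 0) h1 h2 h3 => a b c a' b' c' h1 h2 h3.
rewrite ltNge; apply/negP => le.
have : (b * b' + c * c') ^+ 2 <= (a * a') ^+ 2.
  rewrite [leRHS]exprMn (_ : a ^+ 2 = b ^+ 2 + c ^+ 2); last by lra.
  rewrite (_ : a' ^+ 2 = b' ^+ 2 + c' ^+ 2); last by lra.
  by have := sqr_ge0 (b * c' - c * b'); nra.
have : b * b' + c * c' < a * a' by lra.
by move: (a * a') (b * b' + c * c') le => X m X0 le; nra.
Qed.

Lemma bwdE h : backward_end (base h) = proj_null (col 0 h - col 1 h). Proof. by []. Qed.
Lemma fwdE h : forward_end (base h) = proj_null (col 0 h + col 1 h). Proof. by []. Qed.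

Lemma T1H2_ends u : T1H2 u ->
  [/\ B (u.1 - u.2) (u.1 - u.2) = 0, B (u.1 + u.2) (u.1 + u.2) = 0,
      0 < (u.1 - u.2) 0 0, 0 < (u.1 + u.2) 0 0 & B (u.1 - u.2) (u.1 + u.2) = - 2].
Proof.
case: u => v w [/= [vv v0] ww vw].
have h1 : B (v - w) (v - w) = 0 by rewrite !bilE (lorentzC w) vv ww vw; lra.
have h2 : B (v + w) (v + w) = 0 by rewrite !bilE (lorentzC w) vv ww vw; lra.
have h3 : B (v - w) (v + w) = - 2 by rewrite !bilE (lorentzC w) vv ww vw; lra.
have := null_pos h1 h2; rewrite h3 oppr_lt0 ltr0n => /(_ isT).
by rewrite !mxE => h4; split => //; nra.
Qed.

Lemma T1H2_bdry u : T1H2 u ->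
  [/\ bdry (backward_end u), bdry (forward_end u) & backward_end u <> forward_end u].
Proof.
move=> /T1H2_ends[h1 h2 h3 h4 h5]; split.
- by apply: bdry_proj_null => //; rewrite gt_eqF.
- by apply: bdry_proj_null => //; rewrite gt_eqF.
move=> E; have : B (backward_end u) (forward_end u) = 0.
  by rewrite E /forward_end bilZl bilZr h2 !mulr0.
rewrite /backward_end /forward_end bilZl bilZr h5.
by apply/eqP; rewrite !mulf_neq0 ?invr_neq0 ?(gt_eqF h3) ?(gt_eqF h4) //.
Qed.

(** Flow-invariant data at u can be read at the reference point of the geodesic
    of u; the time between them is obtained by comparing the two null vectors. *)
Lemma T1H2_geoflow u : T1H2 u ->
  u = geoflow (ln ((u.1 + u.2) 0 0 / (u.1 - u.2) 0 0) / 2)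
        (geod_pt (backward_end u) (forward_end u)).
Proof.
move=> /T1H2_ends[h1 h2 h3 h4 h5].
set p := (u.1 + u.2) 0 0 in h4 *; set q := (u.1 - u.2) 0 0 in h3 *.
pose P := Num.sqrt p; pose Q := Num.sqrt q.
have P0 : 0 < P by rewrite sqrtr_gt0.
have Q0 : 0 < Q by rewrite sqrtr_gt0.
have Pp : p = P ^+ 2 by rewrite sqr_sqrtr // ltW.
have Qq : q = Q ^+ 2 by rewrite sqr_sqrtr // ltW.
have et : expR (ln (p / q) / 2) = P / Q.
  rewrite Pp Qq -expr_div_n lnXn ?divr_gt0 // -[_ *+ 2]mulr_natr mulfK ?pnatr_eq0 //.
  by rewrite lnK // posrE divr_gt0.
have et' : expR (- (ln (p / q) / 2)) = Q / P by rewrite expRN et invf_div.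
rewrite /geoflow et et' /geod_pt.
set x := backward_end u; set y := forward_end u.
have xE : u.1 - u.2 = q *: x by rewrite /x /backward_end scalerA mulfV ?gt_eqF // scale1r.
have yE : u.1 + u.2 = p *: y by rewrite /y /forward_end scalerA mulfV ?gt_eqF // scale1r.
have Bxy : - (2 * B x y) = (2 / (P * Q)) ^+ 2.
  move: h5; rewrite xE yE bilZl bilZr => h5.
  have -> : B x y = - 2 / (p * q) by rewrite -h5; field; rewrite !gt_eqF.
  by rewrite Pp Qq; field; rewrite !gt_eqF.
rewrite Bxy sqrtr_sqr gtr0_norm; last by rewrite divr_gt0 // mulr_gt0.
have u1 : u.1 = 2^-1 *: (p *: y + q *: x).
  by rewrite -xE -yE addrACA subrr addr0 -mulr2n -[u.1 *+ 2]scaler_nat scalerA mulVf ?pnatr_eq0 // scale1r.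
have u2 : u.2 = 2^-1 *: (p *: y - q *: x).
  by rewrite -xE -yE opprB [u.1 + _]addrC addrACA subrr addr0 -mulr2n -[u.2 *+ 2]scaler_nat scalerA mulVf ?pnatr_eq0 // scale1r.
clearbody x y; rewrite [LHS]surjective_pairing u1 u2 Pp Qq /=; congr pair; apply/colP => i; rewrite !mxE;
  by field; rewrite (lt0r_neq0 P0) (lt0r_neq0 Q0).
Qed.

(** The effect of the fixed isometries on the three boundary points of a frame. *)
Lemma bwd_horo h s : backward_end (base (h *m horo s)) = backward_end (base h).
Proof.
rewrite !bwdE mul_frame !hypframeE; congr proj_null.
by apply/colP => i; do !rewrite !frameE /=; field.
Qed.

Lemma fwd_horo1 h : forward_end (base (h *m horo 1)) = third h.
Proof.
rewrite fwdE mul_frame !hypframeE /third.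
rewrite -[RHS](@proj_nullZ 2) ?pnatr_eq0 //; congr proj_null.
by apply/colP => i; do !rewrite !frameE /=; field.
Qed.

Lemma bwd_turn h : backward_end (base (h *m turn)) = third h.
Proof.
rewrite bwdE mul_frame !hypframeE /third; congr proj_null.
by apply/colP => i; do !rewrite !frameE /=; ring.
Qed.

Lemma bwd_refl h : backward_end (base (h *m refl)) = forward_end (base h).
Proof.
rewrite bwdE fwdE mul_frame !hypframeE; congr proj_null.
by apply/colP => i; do !rewrite !frameE /=; ring.
Qed.

Lemma fwd_refl h : forward_end (base (h *m refl)) = backward_end (base h).
Proof.
rewrite bwdE fwdE mul_frame !hypframeE; congr proj_null.
by apply/colP => i; do !rewrite !frameE /=; ring.
Qed.

Lemma third_refl h : third (h *m refl) = third h.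
Proof.
rewrite /third mul_frame !hypframeE; congr proj_null.
by apply/colP => i; do !rewrite !frameE /=; ring.
Qed.

(** Isometries act simply transitively on triples of distinct boundary points.
    The frame attached to a triple (x, y, z) sits at the projection of z to the
    geodesic from x to y, which lies far behind the reference point of that
    geodesic when z is close to x. *)
Lemma frame_of_triple x y z : bdry x -> bdry y -> bdry z ->
  x <> y -> y <> z -> x <> z ->
  exists h, [/\ isomH2 h, backward_end (base h) = x, forward_end (base h) = y,
    third h = z & base h = geoflow (ln (B x z / B y z) / 2) (geod_pt x y)].
Proof.
move=> bx by_ bz xy yz xz.
have Bxy := bdry_neg bx by_ xy; have Byz := bdry_neg by_ bz yz.
have Bxz := bdry_neg bx bz xz.
(* c0 + c1, c0 - c1 and c0 + c2 must be multiples of y, x and z: the factors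
   al, b and ga are forced by the Gram matrix of an orthonormal frame. *)
pose r := B x z / B y z.
have r0 : 0 < r by rewrite /r -mulrNN mulr_gt0 ?oppr_gt0 ?invr_lt0.
have rb : 0 < - (2 / (r * B x y)).
  by rewrite oppr_gt0 pmulr_rlt0 // invr_lt0 pmulr_rlt0.
pose b := Num.sqrt (- (2 / (r * B x y))).
have b0 : 0 < b by rewrite sqrtr_gt0.
have b2 : b ^+ 2 = - (2 / (r * B x y)) by rewrite sqr_sqrtr // ltW.
pose al := r * b.
have al0 : 0 < al by rewrite mulr_gt0.
pose ga := - (al * B y z)^-1.
pose c0 := 2^-1 *: (al *: y + b *: x).
pose c1 := 2^-1 *: (al *: y - b *: x).
pose c2 := ga *: z - c0.
have [[xx x0] [[yy y0] [zz z0]]] := (bx, (by_, bz)).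
have nz1 := lt0r_neq0 al0; have nz2 := lt0r_neq0 b0.
have nz3 : B x y != 0 by rewrite lt_eqF.
have nz4 : B y z != 0 by rewrite lt_eqF.
have nz5 := lt0r_neq0 r0.
have alb : al * b * B x y = - 2.
  by rewrite /al -[r * b * b]mulrA -expr2 b2; field; rewrite nz3 nz5.
have gal : ga * al * B y z = -1 by rewrite /ga; field; rewrite nz4 nz1.
have bxz : b * B x z = al * B y z by rewrite /al /r; field; rewrite nz4.
have G00 : B c0 c0 = -1.
  by rewrite /c0 !bilE xx yy (lorentzC y x); have := alb; lra.
have G11 : B c1 c1 = 1.
  by rewrite /c1 !bilE xx yy (lorentzC y x); have := alb; lra.
have G01 : B c0 c1 = 0 by rewrite /c0 /c1 !bilE xx yy (lorentzC y x); lra.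
have Gz0 : B (ga *: z) c0 = -1.
  rewrite /c0 !bilE (lorentzC z y) (lorentzC z x) bxz; have := gal; lra.
have Gz1 : B (ga *: z) c1 = 0.
  rewrite /c1 !bilE (lorentzC z y) (lorentzC z x) bxz; lra.
have Gzz : B (ga *: z) (ga *: z) = 0 by rewrite !bilE zz !mulr0.
exists (hypframe c0 c1 c2).
have ih : isomH2 (hypframe c0 c1 c2).
  apply/isomH2P; rewrite !hypframeE; split => //.
  - rewrite /c2 !(bilDl, bilDr, bilNl, bilNr) Gzz Gz0 G00 lorentzC Gz0; lra.
  - split => //.
      by rewrite /c2 !(bilDr, bilNr) lorentzC Gz0 G00 subrr.
    by rewrite /c2 !(bilDr, bilNr) lorentzC Gz1 lorentzC G01 subrr.
  - by rewrite /c0 !mxE x0 y0 !mulr1 mulr_gt0 ?invr_gt0 // addr_gt0.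
have cm : c0 - c1 = b *: x by apply/colP => i; rewrite !mxE; field.
have cp : c0 + c1 = al *: y by apply/colP => i; rewrite !mxE; field.
have e1 : backward_end (base (hypframe c0 c1 c2)) = x.
  by rewrite bwdE !hypframeE cm proj_nullZ ?proj_null_bdry.
have e2 : forward_end (base (hypframe c0 c1 c2)) = y.
  by rewrite fwdE !hypframeE cp proj_nullZ ?proj_null_bdry.
split => //.
  rewrite /third !hypframeE /c2 addrC subrK proj_nullZ ?proj_null_bdry //.
  by rewrite oppr_eq0 invr_eq0 mulf_neq0.
rewrite [LHS](T1H2_geoflow (base_T1H2 ih)) e1 e2; congr (geoflow (ln _ / 2) _).
by rewrite /base /= !hypframeE cm cp [(_ *: y) _ _]mxE [(_ *: x) _ _]mxE x0 y0 !mulr1 /al mulfK.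
Qed.

(** A unit tangent vector is completed to a frame by a Lorentz cross product. *)
Lemma base_surj u : T1H2 u -> exists2 h, isomH2 h & base h = u.
Proof.
case: u => a b [/= [aa a0] bb ab].
pose n : 'cV[R]_3 := \col_i [:: - (a 1 0 * b o2 0 - a o2 0 * b 1 0);
  a o2 0 * b 0 0 - a 0 0 * b o2 0; a 0 0 * b 1 0 - a 1 0 * b 0 0]`_i.
exists (hypframe a b n); last by rewrite /base !hypframeE.
have nn : B n n = B a b ^+ 2 - B a a * B b b.
  by rewrite !bil_lorentzE -/o2; do !rewrite !frameE /=; ring.
have an : B a n = 0 by rewrite !bil_lorentzE -/o2; do !rewrite !frameE /=; ring.
have bn : B b n = 0 by rewrite !bil_lorentzE -/o2; do !rewrite !frameE /=; ring.
apply/isomH2P; rewrite !hypframeE; split => //.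
by rewrite nn ab aa bb; ring.
Qed.

(** The first column of an isometry controls the others: its upper left entry
    bounds its first row, and the first row bounds each column, since rows and
    columns have Lorentz norm -1 or 1. *)
Lemma compact_frames (K : set 'cV[R]_3) : K `<=` @H2 R -> compact K ->
  compact [set h | isomH2 h /\ K (col 0 h)].
Proof.
move=> KH cK.
pose S : set 'M[R]_3 := [set h | isomH2 h /\ K (col 0 h)].
have ct1 (h0 : 'M[R]_3) : (fun h : 'M[R]_3 => h^T *m L *m h) @ nbhs h0 --> h0^T *m L *m h0.
  have FF : Filter (nbhs h0) by exact: nbhs_filter.
  exact: (cvg_mulmx (cvg_mulmx (cvg_trmx cvg_id) (cvg_cst L)) cvg_id).
have ct2 (h0 : 'M[R]_3) : (fun h : 'M[R]_3 => col 0 h) @ nbhs h0 --> col 0 h0.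
  have FF : Filter (nbhs h0) by exact: nbhs_filter.
  exact: (cvg_col cvg_id).
have S_closed : closed S.
  have -> : S = [set h | h^T *m L *m h = L] `&` [set h | K (col 0 h)].
    rewrite eqEsubset; split=> [h [[H _] Kh]|h [H Kh]]; first by [].
    by split => //; split => //; have [_] := KH _ Kh; rewrite mxE.
  apply: closedI.
    apply: (@closed_comp _ _ (fun h : 'M[R]_3 => h^T *m L *m h) [set L]); last first.
      by apply: accessible_closed_set1; apply: hausdorff_accessible; exact: norm_hausdorff.
    move=> h _; exact: ct1.
  apply: (@closed_comp _ _ (fun h : 'M[R]_3 => col 0 h) K).
    move=> h _; exact: ct2.
  by apply: compact_closed cK; exact: norm_hausdorff.
have [M [_ MK]] := compact_bounded cK.
pose m := `|M| + 1.
have M0 : M < m by rewrite /m; have := ler_norm M; lra.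
have S_bound h i j : S h -> `|h i j| <= m + 1.
  move=> [ih Kh]; have m1 : 0 < m by rewrite /m; have := normr_ge0 M; lra.
  have colb k : h k 0 ^+ 2 <= m ^+ 2.
    have le : `|col 0 h| <= m := MK _ M0 _ Kh.
    rewrite -[leLHS]real_normK ?num_real // ler_sqr ?nnegrE ?normr_ge0 ?(ltW m1) //.
    by apply: le_trans le; apply: le_trans (le_entry_norm _ k 0); rewrite mxE.
  have r0 := isomH2_row0 ih.
  have /isomH2P[_ c1 c2 _ _] := ih; rewrite !bil_lorentzE !mxE -/o2 in c1 c2.
  have sq : h i j ^+ 2 <= 1 + m ^+ 2.
    move: (sqr_ge0 (h 0 1)) (sqr_ge0 (h 1 1)) (sqr_ge0 (h o2 1)).
    move: (sqr_ge0 (h 0 o2)) (sqr_ge0 (h 1 o2)) (sqr_ge0 (h o2 o2)).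
    have := colb 0; have := colb 1; have := colb o2; have := sqr_ge0 m.
    by move: j; apply: ord3P; move: i; apply: ord3P; nra.
  rewrite -ler_sqr ?nnegrE ?normr_ge0 //; last by lra.
  rewrite real_normK ?num_real //; nra.
have ct3 (v : 'rV[R]_(3 * 3)) : (@vec_mx R 3 3) @ nbhs v --> vec_mx v.
  have FF : Filter (nbhs v) by exact: nbhs_filter.
  apply: cvg_mx_entries => i j; rewrite mxE; under eq_fun do rewrite mxE.
  exact: (cvg_mx_entry cvg_id).
have -> : [set h | isomH2 h /\ K (col 0 h)] = vec_mx @` (mxvec @` S).
  by rewrite image_comp; rewrite eqEsubset; split=> [h Sh|_ [h Sh <-]];
    [exists h|]; rewrite //= mxvecK.
apply: continuous_compact.
  by apply: continuous_subspaceT => v; exact: ct3.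
apply: bounded_closed_compact.
  exists (m + 1); split; first by rewrite num_real.
  move=> M' lt _ [h Sh <-]; apply: le_trans (ltW lt).
  rewrite /Num.norm/= mx_normrE; apply/bigmax_leP; split; first by rewrite /m; have := normr_ge0 M; lra.
  move=> [i k] _ /=; case/mxvec_indexP: k => a b; rewrite ord1 mxvecE.
  exact: S_bound.
have -> : mxvec @` S = [set v | S (vec_mx v)].
  by rewrite eqEsubset; split=> [_ [h Sh <-]|v Sv] /=; rewrite ?mxvecK //;
    exists (vec_mx v); rewrite ?vec_mxK.
apply: (@closed_comp _ _ (fun v : 'rV[R]__ => vec_mx v) S) => // v _.
exact: ct3.
Qed.

End EndPoints.

Section Antipode.
Variable R : realType.

Lemma antipode_bdry (x : 'cV[R]_3) : bdry x -> bdry (antipode x) /\ x <> antipode x.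
Proof.
rewrite /bdry /= !bil_lorentzE -/o2 => -[h1 h2].
rewrite !mxE /= !o2_n0; split; first by split => //; rewrite -[RHS]h1; ring.
move=> /colP e; have := e 1; have := e o2; rewrite !mxE o2_n0 /= => e1 e2.
have z1 : x 1 0 = 0 by lra.
have z2 : x o2 0 = 0 by lra.
by move: h1; rewrite h2 z1 z2; lra.
Qed.

End Antipode.

(** * The boundary circle seen from a point *)

Section Stereographic.
Variable R : realType.
Local Notation L := (lorentz R).
Local Notation B := (bil (lorentz R)).
Implicit Types (h : 'M[R]_3) (x y z : 'cV[R]_3).

Variables (h0 : 'M[R]_3).
Hypothesis ih0 : isomH2 h0.
Local Notation c0 := (col 0 h0).
Local Notation c1 := (col 1 h0).
Local Notation c2 := (col o2 h0).
Local Notation y := (forward_end (base h0)).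

(** These frames share their forward end point, being obtained by sliding along
    the horocycle based at it; their backward end points parametrise the rest of
    the circle. *)
Definition slide (s : R) : 'M[R]_3 := h0 *m refl *m horo s *m refl.
Definition stereo (s : R) : 'cV[R]_3 := backward_end (base (slide s)).
Definition stereo_inv z : R := - (B z c2 / B z (c0 + c1)).

Lemma isomH2_slide s : isomH2 (slide s).
Proof.
by do ?[apply: isomH2M]; [exact: ih0|exact: isomH2_refl|exact: isomH2_horo|exact: isomH2_refl].
Qed.

Lemma fwd_slide s : forward_end (base (slide s)) = y.
Proof. by rewrite fwd_refl bwd_horo bwd_refl. Qed.

Lemma slide0 : slide 0 = h0.
Proof.
rewrite /slide horo0 mulmx1 -mulmxA.
suff -> : (refl : 'M[R]_3) *m refl = 1%:M by rewrite mulmx1.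
rewrite mul_frame -[RHS]hypframe_eta.
by congr hypframe; apply/colP; apply: ord3P; do !rewrite !frameE /=; rewrite ?[0 == o2]eq_sym ?[1 == o2]eq_sym ?o2_n0 ?o2_n1 //=; ring.
Qed.

Lemma slide_cols s :
  col 0 (slide s) - col 1 (slide s) = (c0 - c1) + (2 * s) *: c2 + s ^+ 2 *: (c0 + c1) /\
  col 0 (slide s) + col 1 (slide s) = c0 + c1.
Proof.
rewrite /slide; do 3!(rewrite mul_frame !hypframeE).
by split; apply/colP => i; do !rewrite !frameE /=; field.
Qed.

Lemma slide_cont (s0 : R) : {for s0, continuous slide}.
Proof.
have FF : Filter (nbhs s0) by exact: nbhs_filter.
have hc : horo s @[s --> nbhs s0] --> horo s0 by exact: horo_cont.
have := cvg_mulmx (cvg_mulmx (cvg_cst (h0 *m refl)) hc) (cvg_cst refl).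
by move=> H; exact: H.
Qed.

Let gram := (isomH2P h0).1 ih0.

Lemma stereo_bdry s : [/\ bdry (stereo s), bdry y & stereo s <> y].
Proof. by have [] := T1H2_bdry (base_T1H2 (isomH2_slide s)); rewrite fwd_slide. Qed.

Lemma stereo0 : stereo 0 = backward_end (base h0).
Proof. by rewrite /stereo slide0. Qed.

Lemma stereoK s : stereo_inv (stereo s) = s.
Proof.
have [g00 g11 g22 [g01 g02 g12] _] := gram.
have [_ _ q0 _ _] := T1H2_ends (base_T1H2 (isomH2_slide s)).
rewrite /stereo_inv /stereo /backward_end !bilZl /=.
rewrite /base /= in q0; move: q0; set q := (col 0 (slide s) - col 1 (slide s)) 0 0 => q0.
have [-> _] := slide_cols s.
set v := _ - _ + _ + _.
have -> : B v c2 = 2 * s.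
  by rewrite /v !bilE g22 g02 g12; ring.
have -> : B v (c0 + c1) = - 2.
  rewrite /v !bilE g00 g11 g01 !(lorentzC c1 c0) !(lorentzC c2 c0) !(lorentzC c2 c1) g01 g02 g12; ring.
by field; rewrite lt0r_neq0.
Qed.

Lemma stereo_inj s s' : stereo s = stereo s' -> s = s'.
Proof. by move=> e; rewrite -(stereoK s) e stereoK. Qed.

Lemma fwd_neg z : bdry z -> z <> y -> B z (c0 + c1) < 0.
Proof.
move=> bz zy; have [_ by_ _] := stereo_bdry 0.
have [_ _ _ f0 _] := T1H2_ends (base_T1H2 ih0).
have := bdry_neg bz by_ zy; rewrite /forward_end bilZr pmulr_rlt0 //.
by rewrite invr_gt0.
Qed.

Lemma stereo_invK z : bdry z -> z <> y -> stereo (stereo_inv z) = z.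
Proof.
move=> bz zy; have P0 := fwd_neg bz zy; have [zz _] := bz.
have ez : z = - B z c0 *: c0 + B z c1 *: c1 + B z c2 *: c2.
  have e : z = h0 *m (L *m (h0^T *m L *m z)).
    by rewrite -{1}[z]mul1mx -lorentzK -{1}(isomH2_tr ih0) !mulmxA.
  have E j : (h0^T *m L *m z) j 0 = B z (col j h0).
    rewrite lorentzC -[z in RHS](_ : col 0 z = z) -?bil_entries //.
    by apply/colP => i; rewrite mxE.
  have Lv (v : 'cV[R]_3) j : (L *m v) j 0 = (if j == 0 then -1 else 1) * v j 0.
    by rewrite /lorentz mul_diag_mx !mxE.
  have hv (v : 'cV[R]_3) : h0 *m v = v 0 0 *: c0 + v 1 0 *: c1 + v o2 0 *: c2.
    apply/colP => i; rewrite !mxE !big_ord_recl big_ord0 addr0 addrA.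
    have -> : lift ord0 ord0 = 1 :> 'I_3 by apply/val_inj.
    have -> : lift ord0 (lift ord0 ord0) = o2 :> 'I_3 by apply/val_inj; rewrite /= o2_val.
    by rewrite ![h0 _ _ * _]mulrC.
  by rewrite {1}e hv !Lv !E o2_n0 /= mulN1r !mul1r.
set P := B z (c0 + c1) in P0.
have P0' : P != 0 by rewrite lt_eqF.
have bsq : B z c2 ^+ 2 = P * B z (c0 - c1).
  have [g00 g11 g22 [g01 g02 g12] _] := gram.
  have := zz; rewrite {1}ez !bilE !(lorentzC _ z) /P !bilE; lra.
rewrite /stereo /backward_end /= -/(proj_null _) (slide_cols _).1.
rewrite -[RHS](proj_null_bdry bz) -(@proj_nullZ _ (- (P / 2))); last by rewrite oppr_eq0 mulf_neq0 // invr_eq0 pnatr_eq0.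
congr proj_null; rewrite [RHS]ez /stereo_inv -/P.
have bsq' : (- (B z c2 / P)) ^+ 2 = B z (c0 - c1) / P.
  by rewrite sqrrN expr_div_n bsq; field.
rewrite bsq' /P; apply/colP => i; rewrite !mxE.
move: P0'; rewrite /P !bilE => P0'.
by field; rewrite P0'.
Qed.

Lemma stereo_inv_near (d : R) : 0 < d ->
  \forall z \near backward_end (base h0), bdry z -> z <> y /\ `|stereo_inv z| < d.
Proof.
move=> d0; set x0 := backward_end (base h0).
have [b0 b1 b2] := stereo_bdry 0; rewrite stereo0 in b0 b2.
have FF : Filter (nbhs x0) by exact: nbhs_filter.
have cB v : B z v @[z --> nbhs x0] --> B x0 v.
  have H := cvg_mulmx (cvg_mulmx (cvg_trmx (@cvg_id _ (nbhs x0))) (cvg_cst L)) (cvg_cst v).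
  by apply: cvg_mx_entry; exact: H.
have P0 := fwd_neg b0 b2.
have yy : B y (c0 + c1) = 0.
  by have [_ h _ _ _] := T1H2_ends (base_T1H2 ih0); rewrite /forward_end bilZl h mulr0.
have ci : stereo_inv z @[z --> nbhs x0] --> 0.
  have -> : 0 = stereo_inv x0 by rewrite /x0 -stereo0 stereoK.
  apply: cvgN; apply: cvgM; first exact: cB.
  by apply: cvgV; [rewrite lt_eqF|exact: cB].
have n1 : \forall z \near x0, B z (c0 + c1) < 0 by exact: (cvgr_lt _ (cB _)).
have n2 : \forall z \near x0, `|stereo_inv z| < d.
  by have /cvgr_norm_lt := ci; rewrite normr0; apply.
apply: filterS2 n1 n2 => z z1 z2 _; split => // zy.
by move: z1; rewrite zy yy ltxx.
Qed.

End Stereographic.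

Lemma compact_bdry (R : realType) : compact (@bdry R).
Proof.
have -> : @bdry R = trmx @` [set v : 'rV[R]_3 | bdry v^T].
  rewrite eqEsubset; split=> [x bx|_ [v bv <-]] //.
  by exists x^T; rewrite /= trmxK.
apply: continuous_compact.
  apply: continuous_subspaceT => v; have FF : Filter (nbhs v) by exact: nbhs_filter.
  exact: (cvg_trmx cvg_id).
apply: bounded_closed_compact.
  exists 1; split; first by rewrite num_real.
  move=> M M1 v [h1 h2]; apply: le_trans (ltW M1).
  rewrite /Num.norm/= mx_normrE; apply/bigmax_leP; split; first by [].
  move=> [i k] _ /=; rewrite ord1 -ler_sqr ?nnegrE ?normr_ge0 // real_normK ?num_real // expr1n.
  move: h1 h2; rewrite bil_lorentzE !mxE -/o2 => h1 h2.
  move: (sqr_ge0 (v 0 1)) (sqr_ge0 (v 0 o2)).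
  by move: k; apply: ord3P; rewrite ?h2; nra.
have ct (v : 'rV[R]_3) : trmx @ nbhs v --> v^T.
  have FF : Filter (nbhs v) by exact: nbhs_filter.
  exact: (cvg_trmx cvg_id).
have -> : [set v : 'rV[R]_3 | bdry v^T] =
    [set v | bil (lorentz R) v^T v^T = 0] `&` [set v | v^T 0 0 = 1] by [].
apply: closedI.
  apply: (@closed_comp _ _ (fun v : 'rV[R]_3 => bil (lorentz R) v^T v^T) [set 0]); last exact: closed_eq.
  move=> v _; have FF : Filter (nbhs v) by exact: nbhs_filter.
  apply: cvg_mx_entry.
  exact: (cvg_mulmx (cvg_mulmx (cvg_trmx (ct v)) (cvg_cst (lorentz R))) (ct v)).
apply: (@closed_comp _ _ (fun v : 'rV[R]_3 => v^T 0 0) [set 1]); last exact: closed_eq.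
move=> v _; have FF : Filter (nbhs v) by exact: nbhs_filter.
by apply: cvg_mx_entry; exact: ct.
Qed.

(** * Isotropic subspaces and slopes *)

Section ColumnSpan.
Variables (R : realType) (n k : nat).
Implicit Types (M : 'M[R]_(n, k)) (v : 'cV[R]_n).

Definition cspan M : {vspace 'cV[R]_n} := limg (linfun (mulmx M)).

Lemma mem_cspan M v : v \in cspan M <-> exists a, v = M *m a.
Proof.
split=> [/memv_imgP[a _ ->]|[a ->]]; first by exists a; rewrite lfunE.
by apply/memv_imgP; exists a; rewrite ?memvf ?lfunE.
Qed.

Lemma cspan_col M j : col j M \in cspan M.
Proof. by apply/mem_cspan; exists (delta_mx j 0); rewrite colE. Qed.

Lemma cspan_mulr M (g : 'M[R]_k) : g \in unitmx -> cspan (M *m g) = cspan M.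
Proof.
move=> ug; apply/vspaceP => v; apply/idP/idP => /mem_cspan[a ->]; apply/mem_cspan.
  by exists (g *m a); rewrite mulmxA.
by exists (invmx g *m a); rewrite -mulmxA (mulmxA g) mulmxV // mul1mx.
Qed.

Lemma sum_lines_cspan M : (\sum_(j < k) <[col j M]>)%VS = cspan M.
Proof.
apply/vspaceP => v; apply/idP/idP.
  move=> /memv_sumP[u uP ->]; rewrite rpred_sum // => j _.
  have /vlineP[a ->] := uP j isT; rewrite rpredZ //; exact: cspan_col.
move=> /mem_cspan[a ->].
have -> : M *m a = \sum_j a j 0 *: col j M.
  apply/colP => i; rewrite mxE summxE; apply: eq_bigr => j _.
  by rewrite !mxE mulrC.
apply: memv_sumr => j _; rewrite rpredZ //; exact: memv_line.
Qed.

Lemma isotropic_cspan J M : isotropic J (cspan M) <-> M^T *m J *m M = 0.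
Proof.
split=> [iso|H v w /mem_cspan[a ->] /mem_cspan[b ->]].
  by apply/matrixP => i j; rewrite bil_entries mxE iso // cspan_col.
by rewrite /bil trmx_mul -!mulmxA (mulmxA J) (mulmxA M^T) (mulmxA M^T) H mul0mx mulmx0 mxE.
Qed.

End ColumnSpan.

Section Slope.
Variables (R : realType) (p : nat) (J : 'M[R]_(p + p)).
Local Notation vect := ('M[R]_(p + p, p)).
Implicit Types (V W U : vect) (c : 'rV[R]_p).

Definition row_inv c : 'rV[R]_p := \row_k (c 0 k)^-1.

Lemma row_invK c : row_inv (row_inv c) = c.
Proof. by apply/rowP => k; rewrite !mxE invrK. Qed.

(** The columns of V and W span two transverse Lagrangians and are dual to each
    other for the form of J. *)
Definition dual_bases V W : Prop :=
  [/\ W^T *m J *m V = 1%:M, V^T *m J *m W = 1%:M,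
      V^T *m J *m V = 0 & W^T *m J *m W = 0].

(** The Lagrangian spanned by U is the graph over that of V, along that of W, of
    a linear map whose associated form has this matrix in the basis V. *)
Definition slope V W U : 'M[R]_p := (V^T *m J *m U) *m invmx (W^T *m J *m U).

Lemma invmx_mul n (A C : 'M[R]_n) : A \in unitmx -> C \in unitmx ->
  invmx (A *m C) = invmx C *m invmx A.
Proof.
move=> uA uC; have u : A *m C \in unitmx by rewrite unitmx_mul uA.
by rewrite -[RHS](mulmxK u) !mulmxA mulmxKV // mulVmx // mul1mx.
Qed.

Lemma dual_expand V W m (X : 'M[R]_(p + p, m)) : dual_bases V W ->
  X = V *m (W^T *m J *m X) + W *m (V^T *m J *m X).
Proof.
move=> [WV VW VV WW].
have E : col_mx (W^T *m J) (V^T *m J) *m row_mx V W = 1%:M.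
  by rewrite mul_col_row WV VW VV WW -scalar_mx_block.
have := mulmx1C E; rewrite mul_row_col !mulmxA => M.
by rewrite -mulmxDl M mul1mx.
Qed.

Lemma slope_antisym V W U : dual_bases V W -> U^T *m J *m U = 0 ->
  W^T *m J *m U \in unitmx -> (slope V W U)^T = - slope V W U.
Proof.
move=> d UU ua; have eU := dual_expand U d; have [WV VW VV WW] := d.
rewrite /slope; set a := W^T *m J *m U in ua eU *; set b := V^T *m J *m U in eU *.
clearbody a b.
have H : a^T *m b + b^T *m a = 0.
  rewrite -UU [in RHS]eU [(_ + _)^T]linearD /= !trmx_mul !mulmxDl !mulmxDr.
  have e (A C : vect) (x y : 'M[R]_p) : x^T *m A^T *m J *m (C *m y) = x^T *m (A^T *m J *m C) *m y.
    by rewrite !mulmxA.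
  by rewrite !e WV VW VV WW !mulmx0 !mul0mx !mulmx1 add0r addr0.
have uaT : a^T \in unitmx by rewrite unitmx_tr.
rewrite trmx_mul trmx_inv -[LHS](mulmxK ua) -[_ *m b^T *m a]mulmxA.
have -> : b^T *m a = - (a^T *m b) by apply/eqP; rewrite -addr_eq0 addrC H.
by rewrite mulmxN mulKmx // mulNmx.
Qed.

Lemma diag_row_inv c : (forall k, c 0 k != 0) ->
  diag_mx c *m diag_mx (row_inv c) = 1%:M.
Proof.
move=> c0; rewrite mulmx_diag -diag_const_mx; congr diag_mx.
by apply/rowP => k; rewrite !mxE mulfV.
Qed.

Lemma diag_unit c : (forall k, c 0 k != 0) -> diag_mx c \in unitmx.
Proof. by move=> /diag_row_inv E1; have [] := mulmx1_unit E1. Qed.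

Lemma mul_diag_form m k (X : 'M[R]_(m, p)) c (Y : 'M[R]_(m, k)) (K : 'M[R]_m) :
  (X *m diag_mx c)^T *m K *m Y = diag_mx c *m (X^T *m K *m Y).
Proof. by rewrite trmx_mul tr_diag_mx !mulmxA. Qed.

Lemma unit_scale W U c (g : 'M[R]_p) : (forall k, c 0 k != 0) -> g \in unitmx ->
  W^T *m J *m U \in unitmx -> (W *m diag_mx (row_inv c))^T *m J *m (U *m g) \in unitmx.
Proof.
move=> c0 ug u; rewrite mulmxA !unitmx_mul mul_diag_form unitmx_mul ug u.
by rewrite diag_unit // => k; rewrite mxE invr_eq0.
Qed.

Lemma slope_mulr V W U (g : 'M[R]_p) : g \in unitmx -> W^T *m J *m U \in unitmx ->
  slope V W (U *m g) = slope V W U.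
Proof. by move=> ug u; rewrite /slope !mulmxA invmx_mul // !mulmxA mulmxK. Qed.

(** The slope is a form on the span of V, so that its coefficients are rescaled
    like the pairs of dual vectors. *)
Lemma slope_scale V W U c (g : 'M[R]_p) i j : (forall k, c 0 k != 0) -> g \in unitmx ->
  W^T *m J *m U \in unitmx ->
  slope (V *m diag_mx c) (W *m diag_mx (row_inv c)) (U *m g) i j =
    c 0 i * c 0 j * slope V W U i j.
Proof.
move=> c0 ug u.
have u1 : diag_mx (row_inv c) \in unitmx by have [] := mulmx1_unit (diag_row_inv c0).
have u2 := unit_scale c0 (unitmx1 _ _) u; rewrite mulmx1 in u2.
have iE : invmx (diag_mx (row_inv c)) = diag_mx c.
  by rewrite -[RHS]mulmx1 -(mulmxV u1) mulmxA diag_row_inv // mul1mx.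
rewrite slope_mulr // /slope !mul_diag_form invmx_mul // iE !mulmxA.
rewrite mul_mx_diag mxE -!mulmxA mul_diag_mx mxE mulrAC; congr (_ * _ * _).
Qed.

Lemma slope_eq0 V W U : W^T *m J *m U \in unitmx -> slope V W U = 0 -> V^T *m J *m U = 0.
Proof. by move=> u /(congr1 (mulmx^~ (W^T *m J *m U))); rewrite mul0mx /slope mulmxKV. Qed.

Lemma cvg_slope (T : Type) (F : set_system T) (FF : Filter F) (V W U : T -> vect) V0 W0 U0 :
  V @ F --> V0 -> W @ F --> W0 -> U @ F --> U0 -> W0^T *m J *m U0 \in unitmx ->
  (fun x => slope (V x) (W x) (U x)) @ F --> slope V0 W0 U0.
Proof.
move=> cV cW cU u.
have c1 : (V x)^T *m J *m U x @[x --> F] --> V0^T *m J *m U0.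
  exact: (cvg_mulmx (cvg_mulmx (cvg_trmx cV) (cvg_cst J)) cU).
have c2 : (W x)^T *m J *m U x @[x --> F] --> W0^T *m J *m U0.
  exact: (cvg_mulmx (cvg_mulmx (cvg_trmx cW) (cvg_cst J)) cU).
exact: (cvg_mulmx c1 (cvg_invmx c2 u)).
Qed.

Lemma dual_bases_span V W V' W' : dual_bases V W -> dual_bases V' W' ->
  V^T *m J *m V' = 0 -> cspan V' = cspan V.
Proof.
move=> d [D _ _ _] VV'; have e := dual_expand V' d; rewrite VV' mulmx0 addr0 in e.
move: D; rewrite e mulmxA => /mulmx1_unit[_ ua].
exact: cspan_mulr.
Qed.

End Slope.

Section Charts.
Variables (R : realType) (p : nat) (J : 'M[R]_(p + p)).
Hypothesis sJ : J^T = J.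
Local Notation vect := ('M[R]_(p + p, p)).
Implicit Types (V W U : vect) (F G : 'M[R]_(p + p)).

(** The F of which the Lagrangian cspan U is the graph, in the chart given by
    cspan V and cspan W. *)
Definition chartmx V W U : 'M[R]_(p + p) := W *m slope J V W U *m (W^T *m J).

Lemma mximg_cspan n (A : 'M[R]_n) k (M : 'M[R]_(n, k)) : mximg A (cspan M) = cspan (A *m M).
Proof.
apply/vspaceP => v; apply/idP/idP.
  move=> /memv_imgP[w /mem_cspan[a ->] ->]; rewrite lfunE; apply/mem_cspan.
  by exists a; rewrite /= mulmxA.
move=> /mem_cspan[a ->]; apply/memv_imgP; exists (M *m a); last by rewrite lfunE /= mulmxA.
by apply/mem_cspan; exists a.
Qed.

Lemma chartmxW V W U : dual_bases J V W -> chartmx V W U *m W = 0.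
Proof. by move=> [_ _ _ WW]; rewrite /chartmx -mulmxA WW mulmx0. Qed.

Lemma chartmxV V W U : dual_bases J V W -> chartmx V W U *m V = W *m slope J V W U.
Proof. by move=> [D _ _ _]; rewrite /chartmx -mulmxA D mulmx1. Qed.

Lemma chartmx_img V W U : dual_bases J V W -> W^T *m J *m chartmx V W U = 0.
Proof. by move=> [_ _ _ WW]; rewrite /chartmx !mulmxA WW !mul0mx. Qed.

Lemma graph_chartmx V W U : dual_bases J V W -> W^T *m J *m U \in unitmx ->
  exists2 g, g \in unitmx & (1%:M + chartmx V W U) *m V = U *m g.
Proof.
move=> d u; exists (invmx (W^T *m J *m U)); first by rewrite unitmx_inv.
have eU := dual_expand U d; rewrite mulmxDl mul1mx chartmxV // /slope.
set a := W^T *m J *m U in u eU *; set b := V^T *m J *m U in eU *; clearbody a b.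
by rewrite eU mulmxDl -!mulmxA mulmxV // mulmx1.
Qed.

Lemma chart_unique V W F U g : dual_bases J V W -> F *m W = 0 -> W^T *m J *m F = 0 ->
  g \in unitmx -> (1%:M + F) *m V = U *m g -> F = chartmx V W U.
Proof.
move=> d FW WF ug e; have [D D' VV WW] := d.
have FV : F *m V = W *m (V^T *m J *m F *m V).
  by rewrite {1}(dual_expand (F *m V) d) (mulmxA (W^T *m J) F) WF mul0mx mulmx0 add0r (mulmxA (V^T *m J) F).
have WU : W^T *m J *m (U *m g) = 1%:M.
  by rewrite -e mulmxDl mul1mx mulmxDr D mulmxA WF mul0mx addr0.
have u : W^T *m J *m U \in unitmx.
  by move: WU; rewrite mulmxA => /mulmx1_unit[].
have sE : slope J V W U = V^T *m J *m F *m V.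
  rewrite -(slope_mulr V ug u) /slope WU invmx1 mulmx1 -e mulmxDl mul1mx mulmxDr VV add0r.
  by rewrite !mulmxA.
rewrite /chartmx sE -FV -mulmxA.
by rewrite -[LHS]mulmx1 {1}(dual_expand 1%:M d) !mulmx1 mulmxDr (mulmxA F W) FW mul0mx addr0.
Qed.

Lemma chart_domP th1 W F : th1 = cspan W -> W^T *m J *m W = 0 ->
  chart_dom J th1 F -> F *m W = 0 /\ W^T *m J *m F = 0.
Proof.
move=> -> WW [[F0 Fi] _]; split; apply/matrixP => i j.
  by have := F0 _ (cspan_col W j); rewrite colE mulmxA -colE => /colP/(_ i); rewrite !mxE.
rewrite [RHS]mxE bil_entries.
have iso := (isotropic_cspan J W).2 WW.
have -> : col j F = F *m delta_mx j 0 by rewrite colE.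
by apply: iso (cspan_col W i) (Fi _).
Qed.

Lemma chartmx_dom V W U : dual_bases J V W -> U^T *m J *m U = 0 ->
  W^T *m J *m U \in unitmx -> chart_dom J (cspan W) (chartmx V W U).
Proof.
move=> d UU u; split; first split.
- move=> v /mem_cspan[a ->]; by rewrite mulmxA chartmxW // mul0mx.
- by move=> v; apply/mem_cspan; eexists; rewrite /chartmx -!mulmxA.
have sa := slope_antisym d UU u.
rewrite /omega /chartmx; move: sa; move: (slope J V W U) => S sa.
by rewrite !trmx_mul trmxK sJ sa !mulmxA !(mulmxN, mulNmx).
Qed.

(** When the second Lagrangian is kept, a change of base point of the chart is a
    translation: chart values map into it and vanish on it, so that the product
    of 1 + F' and 1 + F is 1 + F + F'. *)
Lemma chartmx_cocycle V W V' W' U m : dual_bases J V W -> dual_bases J V' W' ->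
  W' = W *m m -> W^T *m J *m V' \in unitmx -> W'^T *m J *m U \in unitmx ->
  chartmx V W U = chartmx V W V' + chartmx V' W' U.
Proof.
move=> d d' Wm u u'; apply/esym.
have [D _ _ WW] := d; have [D' _ _ WW'] := d'.
have [g ug e] := graph_chartmx d u; have [g' ug' e'] := graph_chartmx d' u'.
have um : m \in unitmx.
  by move: D'; rewrite Wm trmx_mul -!mulmxA => /mulmx1_unit[]; rewrite unitmx_tr.
have WE : W = W' *m invmx m by rewrite Wm mulmxK.
apply: (chart_unique (g := g' *m g)) => //.
- by rewrite mulmxDl chartmxW // add0r WE mulmxA chartmxW // mul0mx.
- by rewrite mulmxDr chartmx_img // add0r WE trmx_mul -!mulmxA (mulmxA W'^T J) chartmx_img // mulmx0.
- by rewrite unitmx_mul ug'.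
have -> : 1%:M + (chartmx V W V' + chartmx V' W' U) =
    (1%:M + chartmx V' W' U) *m (1%:M + chartmx V W V').
  rewrite mulmxDl !mul1mx mulmxDr mulmx1.
  have -> : chartmx V' W' U *m chartmx V W V' = 0.
    by rewrite {2}/chartmx WE !mulmxA chartmxW // !mul0mx.
  by rewrite addr0 addrA.
by rewrite -mulmxA e mulmxA e' -mulmxA.
Qed.

Lemma chartmx_mulr (V W U : vect) g : g \in unitmx -> W^T *m J *m U \in unitmx ->
  chartmx V W (U *m g) = chartmx V W U.
Proof. by move=> ug u; rewrite /chartmx slope_mulr. Qed.

(** The direction of Lambda^2 (E_(p-1)^* + E_p^* ), written with the dual basis. *)
Definition last2 (k l : 'I_p) : 'M[R]_p := delta_mx k l - delta_mx l k.
Definition dirmx (k l : 'I_p) W : 'M[R]_(p + p) := W *m last2 k l *m (W^T *m J).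

End Charts.

Section Conclusion.
Variables (R : realType) (p : nat) (J : 'M[R]_(p + p)).
Hypothesis sJ : J^T = J.
Local Notation vect := ('M[R]_(p + p, p)).
Implicit Types (V W : vect).

Lemma dim_cspan V W : W^T *m J *m V = 1%:M -> \dim (cspan V) = p.
Proof.
move=> D; rewrite /cspan limg_dim_eq ?dimvf /dim /= ?muln1 //.
have key (v : 'cV[R]_p) : V *m v = 0 -> v = 0.
  by move=> Vv; rewrite -[v]mul1mx -D -mulmxA Vv mulmx0.
rewrite capfv; apply/vspaceP => v; rewrite memv_ker memv0 lfunE /=.
by apply/idP/idP => [/eqP/key/eqP//|/eqP ->]; rewrite mulmx0.
Qed.

Lemma transverse_cspan V W : dual_bases J V W -> transverse (cspan V) (cspan W).
Proof.
move=> [D _ _ WW]; apply/eqP; rewrite -subv0; apply/subvP => v.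
rewrite memv_cap => /andP[/mem_cspan[a ->] /mem_cspan[b e]].
have : a = 0 by rewrite -[a]mul1mx -D -mulmxA e mulmxA WW mul0mx.
by move=> ->; rewrite mulmx0 mem0v.
Qed.

Variables k l : 'I_p.
Hypothesis lp : l.+1 = p.
Hypothesis kl : k.+1 = l.

(** K is spanned by all the vectors but the last two of V. A 2-form killed by K
    is thus determined by its value on these two. *)
Lemma wedge2_last V W (K : {vspace 'cV[R]_(p + p)}) : dual_bases J V W ->
  (forall v, v \in K <-> exists (i : 'I_p -> R) w, v = \sum_(j < p | (j < k)%N) i j *: col j V + W *m w) ->
  wedge2 K = [set A | exists a : R, A = a *: (J *m dirmx J k l W)].
Proof.
move=> d KP; have [D D' VV WW] := d.
have lastT : (last2 R k l)^T = - last2 R k l.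
  by rewrite /last2 linearB /= !trmx_delta opprB.
rewrite eqEsubset; split=> [A [At AK]|A [a ->]].
  pose S := V^T *m A *m V.
  have AW : A *m W = 0.
    apply/matrixP => i j; rewrite [RHS]mxE.
    have : A *m col j W = 0.
      apply: AK; apply/KP; exists (fun=> 0), (delta_mx j 0).
      by rewrite big1 ?add0r ?colE // => m _; rewrite scale0r.
    by rewrite colE mulmxA -colE => /colP/(_ i); rewrite !mxE.
  have WA : W^T *m A = 0.
    by apply: trmx_inj; rewrite trmx_mul trmxK At trmx0 mulNmx AW oppr0.
  have I1 : 1%:M = V *m (W^T *m J) + W *m (V^T *m J) by rewrite {1}(dual_expand 1%:M d) !mulmx1.
  have AE : A = (J *m W) *m S *m (W^T *m J).
    have e1 : A = A *m V *m (W^T *m J).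
      by rewrite -{1}[A]mulmx1 I1 mulmxDr !mulmxA AW !mul0mx addr0.
    have e2 : A = (J *m W) *m (V^T *m A).
      have := congr1 trmx I1; rewrite trmx1 linearD /= !trmx_mul !trmxK sJ => I2.
      rewrite -{1}[A]mul1mx I2 mulmxDl.
      by rewrite -[J *m V *m W^T *m A]mulmxA WA mulmx0 addr0 mulmxA.
    by rewrite {1}e1 {1}e2 /S !mulmxA.
  have St : S^T = - S by rewrite /S !trmx_mul trmxK At mulNmx mulmxN mulmxA.
  have Santi i j : S i j = - S j i by have /matrixP/(_ j i) := St; rewrite [LHS]mxE [RHS]mxE.
  have Slow (i j : 'I_p) : (j < k)%N -> S i j = 0.
    move=> jk; have : A *m col j V = 0.
      apply: AK; apply/KP; exists (fun j' => (j' == j)%:R), 0.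
      rewrite mulmx0 addr0 (bigD1 j) //= eqxx scale1r big1 ?addr0 // => j' /andP[_ /negPf ->].
      by rewrite scale0r.
    move=> AV; rewrite /S -mulmxA mxE big1 // => a _.
    have -> : (A *m V) a j = (A *m col j V) a 0 by rewrite [in RHS]colE mulmxA -colE !mxE.
    by rewrite AV [X in _ * X]mxE mulr0.
  clearbody S.
  have SE : S = S k l *: last2 R k l.
    apply/matrixP => i j; rewrite /last2 !mxE.
    have Sd m : S m m = 0.
      by have /eqP := Santi m m; rewrite -addr_eq0 -mulr2n mulrn_eq0 /= => /eqP.
    have dich (m : 'I_p) : [\/ (m < k)%N, m = k | m = l].
      case: (ltngtP m k) => [|km|/val_inj]; [by constructor 1| |by constructor 2].
      by constructor 3; apply: val_inj => /=; have := ltn_ord m; move: lp kl; lia.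
    have nlk : (l == k) = false by rewrite -val_eqE /= -kl; lia.
    have nkl : (k == l) = false by rewrite eq_sym.
    have ne (m : 'I_p) : (m < k)%N -> (m == k = false) * (m == l = false).
      by move=> mk; split; rewrite -val_eqE /=; move: kl; lia.
    case: (dich j) => [jk|->|->].
    - by rewrite Slow // !(ne _ jk) !andbF subrr mulr0.
    - case: (dich i) => [ik|->|->].
      + by rewrite Santi Slow // !(ne _ ik) /= subrr mulr0 oppr0.
      + by rewrite Sd !eqxx nkl /= subrr mulr0.
      + by rewrite Santi !eqxx nlk /= sub0r mulrN1.
    - case: (dich i) => [ik|->|->].
      + by rewrite Santi Slow // !(ne _ ik) /= subrr mulr0 oppr0.
      + by rewrite !eqxx nkl /= subr0 mulr1.
      + by rewrite Sd !eqxx nlk /= subrr mulr0.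
  exists (S k l); rewrite {1}AE SE /dirmx -scalemxAr -scalemxAl.
  by rewrite -SE !mulmxA.
split.
  rewrite linearZ /= -scalerN; congr (_ *: _).
  by rewrite /dirmx !trmx_mul trmxK sJ lastT !mulmxA !(mulmxN, mulNmx).
move=> v /KP[i [w ->]]; rewrite -scalemxAl; apply/eqP; rewrite scaler_eq0; apply/orP; right; apply/eqP.
rewrite mulmxDr /dirmx; have -> : J *m (W *m last2 R k l *m (W^T *m J)) *m (W *m w) = 0.
  by rewrite -!mulmxA (mulmxA J W w) (mulmxA W^T) (mulmxA W^T J W) WW mul0mx !mulmx0.
rewrite addr0 mulmx_sumr big1 // => j jk; rewrite -scalemxAr.
suff -> : J *m (W *m last2 R k l *m (W^T *m J)) *m col j V = 0 by rewrite scaler0.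
rewrite colE -!mulmxA (mulmxA J V) (mulmxA W^T) (mulmxA W^T J V) D mul1mx.
suff -> : last2 R k l *m delta_mx j (0 : 'I_1) = 0 by rewrite !mulmx0.
have jk' : (k == j = false) * (l == j = false).
  by split; rewrite -val_eqE /=; move: kl; lia.
by rewrite /last2 mulmxBl !mul_delta_mx_cond [in l == j]jk' [in k == j]jk' !mulr0n subrr.
Qed.

End Conclusion.

Lemma cspan_eq_unit (R : realType) p (J : 'M[R]_(p + p)) (A A' X : 'M[R]_(p + p, p)) :
  cspan A = cspan A' ->
  X^T *m J *m A = 1%:M -> exists2 g, g \in unitmx & A = A' *m g.
Proof.
move=> sp XA.
have ex (j : 'I_p) : exists a, col j A = A' *m a.
  by apply/mem_cspan; rewrite -sp cspan_col.
pose g := \matrix_(i, j) projT1 (cid (ex j)) i 0.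
have Ag : A = A' *m g.
  apply/matrixP => i j; have := projT2 (cid (ex j)) => /colP/(_ i).
  by rewrite !mxE => ->; apply: eq_bigr => k _; rewrite !mxE.
exists g => //; move: XA; rewrite Ag mulmxA => /mulmx1_unit[_] //.
Qed.

(** * Weights and uniformity over the closed surface *)

Section Representation.
Variables (R : realType) (p : nat) (J : 'M[R]_(p + p)).
Variables (Gamma : set 'M[R]_3) (rho : 'M[R]_3 -> 'M[R]_(p + p)).
Hypothesis hrho : representation J Gamma rho.

Lemma rho_iso g : Gamma g -> (rho g)^T *m J *m rho g = J.
Proof. by case: hrho => H _ /H[]. Qed.

Lemma rho_unit g : Gamma g -> rho g \in unitmx.
Proof. by case: hrho => H _ /H[_ d]; rewrite unitmxE d unitr1. Qed.

Lemma rho_bil g m k (A : 'M[R]_(p + p, m)) (B : 'M[R]_(p + p, k)) : Gamma g ->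
  (rho g *m A)^T *m J *m (rho g *m B) = A^T *m J *m B.
Proof.
move=> Gg; rewrite trmx_mul -!mulmxA (mulmxA J) (mulmxA (rho g)^T) (mulmxA (rho g)^T).
by rewrite rho_iso // !mulmxA.
Qed.

Lemma slope_rho g (V W U : 'M[R]_(p + p, p)) : Gamma g ->
  slope J (rho g *m V) (rho g *m W) (rho g *m U) = slope J V W U.
Proof. by move=> Gg; rewrite /slope !rho_bil. Qed.

End Representation.

Section Weights.
Variables (R : realType) (p : nat) (J : 'M[R]_(p + p)).
Variables (Gamma : set 'M[R]_3) (rho : 'M[R]_3 -> 'M[R]_(p + p)).
Local Notation vect := ('M[R]_(p + p, p)).
Implicit Types (V W U : vect) (h g : 'M[R]_3) (c : 'rV[R]_p).

(** What the argument uses of the dual bases of an equivariant pair of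
    transverse Lagrangians over the frames of the hyperbolic plane. It is stated
    abstractly because it also holds after reversing the geodesics and exchanging
    the two Lagrangians, see frame_system_rev. *)
Record frame_system (Fr : 'M[R]_3 -> vect -> vect -> Prop) : Prop := FrameSystem {
  fs_iso : forall h V W, isomH2 h -> Fr h V W -> dual_bases J V W;
  fs_local : forall (T : Type) (F : set_system T) (FF : Filter F)
      (f : T -> 'M[R]_3) h0, isomH2 h0 -> f @ F --> h0 ->
    (\forall x \near F, isomH2 (f x)) ->
    exists (V W : T -> vect) (V0 W0 : vect),
    [/\ Fr h0 V0 W0, V @ F --> V0, W @ F --> W0 &
        \forall x \near F, Fr (f x) (V x) (W x)];
  fs_scale : forall h V W V' W', isomH2 h -> Fr h V W -> Fr h V' W' ->
    exists c, [/\ forall k, c 0 k != 0, V' = V *m diag_mx c &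
      W' = W *m diag_mx (row_inv c)];
  fs_equiv : forall g h V W, Gamma g -> isomH2 h -> Fr h V W ->
    Fr (g *m h) (rho g *m V) (rho g *m W);
  fs_flow : forall t h V W, isomH2 h -> Fr (h *m boost t) V W <-> Fr h V W }.

(** A weight is a continuous positive invariant function of the frames which is
    exponentially contracted by the geodesic flow; chi is its character under
    rescaling of the lines. *)
Record weight (Fr : 'M[R]_3 -> vect -> vect -> Prop) (chi : 'rV[R]_p -> R)
    (r : 'M[R]_3 -> vect -> vect -> R) : Prop := Weight {
  w_pos : forall h V W, isomH2 h -> Fr h V W -> 0 < r h V W;
  w_scale : forall h V W c, isomH2 h -> Fr h V W -> (forall k, c 0 k != 0) ->
    r h (V *m diag_mx c) (W *m diag_mx (row_inv c)) = chi c * r h V W;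
  w_equiv : forall g h V W, Gamma g -> isomH2 h -> Fr h V W ->
    r (g *m h) (rho g *m V) (rho g *m W) = r h V W;
  w_base : forall h h' V W, base h = base h' -> r h V W = r h' V W;
  w_cont : forall (T : Type) (F : set_system T) (FF : Filter F)
      (f : T -> 'M[R]_3) (V W : T -> vect) h0 V0 W0,
    isomH2 h0 -> f @ F --> h0 -> V @ F --> V0 -> W @ F --> W0 -> Fr h0 V0 W0 ->
    (\forall x \near F, isomH2 (f x)) ->
    (\forall x \near F, Fr (f x) (V x) (W x)) ->
    (fun x => r (f x) (V x) (W x)) @ F --> r h0 V0 W0;
  w_contr : exists a b : R, [/\ 0 < a, 0 < b & forall t h V W, 0 < t ->
    isomH2 h -> Fr h V W -> r (h *m boost t) V W <= a * expR (- (b * t)) * r h V W] }.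

Lemma eq_weight Fr chi chi' r :
  (forall c, (forall k, c 0 k != 0) -> chi c = chi' c) ->
  weight Fr chi r -> weight Fr chi' r.
Proof.
move=> e [a b c d f g]; split => // h V W c0 ih fr n0.
by rewrite b // e.
Qed.

Lemma weight_mul Fr chi chi' r r' : frame_system Fr ->
  weight Fr chi r -> weight Fr chi' r' ->
  weight Fr (fun c => chi c * chi' c) (fun h V W => r h V W * r' h V W).
Proof.
move=> fs w w'; split.
- by move=> h V W ih fr; rewrite mulr_gt0 ?(w_pos w) ?(w_pos w').
- by move=> h V W c ih fr c0; rewrite (w_scale w) // (w_scale w') // mulrACA.
- by move=> g h V W Gg ih fr; rewrite (w_equiv w) // (w_equiv w').
- by move=> h h' V W bh; rewrite (w_base w _ _ bh) (w_base w' _ _ bh).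
- move=> T F FF f V W h0 V0 W0 *.
  by apply: cvgM; [apply: (w_cont w)|apply: (w_cont w')].
have [a [b [a0 b0 H]]] := w_contr w; have [a' [b' [a'0 b'0 H']]] := w_contr w'.
exists (a * a'), (b + b'); split; rewrite ?mulr_gt0 ?addr_gt0 // => t h V W t0 ih fr.
have fr' := (fs_flow fs t V W ih).2 fr.
have ih' : isomH2 (h *m boost t) by apply: isomH2M => //; exact: isomH2_boost.
have -> : a * a' * expR (- ((b + b') * t)) * (r h V W * r' h V W) =
  (a * expR (- (b * t)) * r h V W) * (a' * expR (- (b' * t)) * r' h V W).
  by rewrite mulrDl opprD expRD; ring.
by apply: ler_pM; rewrite ?H ?H' // ltW // ?(w_pos w) ?(w_pos w').
Qed.

(** Contraction forwards is expansion backwards; this is the form used when a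
    frame is moved backwards to the projection of a boundary point. *)
Lemma weight_expand Fr chi r : frame_system Fr -> weight Fr chi r ->
  exists a b : R, [/\ 0 < a, 0 < b & forall t h V W, 0 < t ->
    isomH2 h -> Fr h V W -> r h V W * expR (b * t) <= a * r (h *m boost (- t)) V W].
Proof.
move=> fs w; have [a [b [a0 b0 H]]] := w_contr w.
exists a, b; split => // t h V W t0 ih fr.
have ih' : isomH2 (h *m boost (- t)) by apply: isomH2M => //; exact: isomH2_boost.
have fr' := (fs_flow fs (- t) V W ih).2 fr.
have := H t _ V W t0 ih' fr'.
have -> : h *m boost (- t) *m boost t = h.
  rewrite -mulmxA boostD addNr boost0 mulmx1 //.
rewrite expRN -mulrA mulrCA mulrC ler_pdivlMr ?expR_gt0 //.
Qed.

(** Reversing a geodesic exchanges the roles of V and W. *)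
Definition rev_frames (Fr : 'M[R]_3 -> vect -> vect -> Prop) h V W :=
  Fr (h *m refl) W V.

Lemma frame_system_rev Fr : frame_system Fr -> frame_system (rev_frames Fr).
Proof.
move=> fs.
have ir h : isomH2 h -> isomH2 (h *m refl) by move=> ?; apply: isomH2M => //; exact: isomH2_refl.
split; rewrite /rev_frames.
- by move=> h V W /ir ih /(fs_iso fs ih)[D D' VV WW]; split.
- move=> T F FF f h0 ih0 fh0 fi.
  have [||V [W [V0 [W0 [H1 H2 H3 H4]]]]] := fs_local fs FF (f := fun x => f x *m refl) (ir _ ih0).
  + by apply: cvg_mulmx fh0 _; exact: cvg_cst.
  + by apply: filterS fi => x; exact: ir.
  + by exists W, V, W0, V0.
- move=> h V W V' W' /ir ih fr fr'; have [c [c0 -> ->]] := fs_scale fs ih fr fr'.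
  exists (row_inv c); rewrite row_invK; split => // k.
  by rewrite mxE invr_eq0.
- by move=> g h V W Gg /ir ih fr; rewrite -mulmxA; exact: fs_equiv.
- move=> t h V W ih; rewrite -mulmxA boost_refl mulmxA.
  exact: fs_flow (ir _ ih).
Qed.

(** The reversed flow contracts the inverse of a weight, so that statements about
    Theta yield the corresponding statements about Thetab. *)
Lemma weight_rev Fr chi r : frame_system Fr -> weight Fr chi r ->
  weight (rev_frames Fr) (fun c => (chi (row_inv c))^-1)
    (fun h V W => (r (h *m refl) W V)^-1).
Proof.
move=> fs w.
have ir h : isomH2 h -> isomH2 (h *m refl) by move=> ?; apply: isomH2M => //; exact: isomH2_refl.
split; rewrite /rev_frames.
- by move=> h V W /ir ih fr; rewrite invr_gt0 (w_pos w).
- move=> h V W c /ir ih fr c0; rewrite -invfM -(w_scale w ih fr) ?row_invK // => k.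
  by rewrite mxE invr_eq0.
- by move=> g h V W Gg /ir ih fr; rewrite -mulmxA (w_equiv w).
- move=> h h' V W bh; congr (_^-1); apply: (w_base w).
  by move: bh; rewrite /base !mul_frame !hypframeE => -[-> ->]; do !rewrite !frameE /=; rewrite !scale0r.
- move=> T F FF f V W h0 V0 W0 /ir ih0 fh0 VV0 WW0 fr0 fi ff.
  apply: cvgV; first by rewrite gt_eqF // (w_pos w).
  apply: (w_cont w) => //; first by apply: cvg_mulmx fh0 _; exact: cvg_cst.
  by apply: filterS fi => x; exact: ir.
have [a [b [a0 b0 H]]] := weight_expand fs w.
exists a, b; split => // t h V W t0 /ir ih fr.
have := H t _ _ _ t0 ih fr.
have ih' : isomH2 (h *m refl *m boost (- t)) by apply: isomH2M => //; exact: isomH2_boost.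
have fr' := (fs_flow fs (- t) W V ih).2 fr.
have -> : h *m boost t *m refl = h *m refl *m boost (- t).
  by rewrite -mulmxA boost_refl mulmxA.
have := w_pos w ih fr; have := w_pos w ih' fr'.
rewrite expRN; set x := r _ _ _; set y := r _ _ _ => x0 y0 H1.
rewrite -mulrA -invfM ler_pdivlMr ?mulr_gt0 ?expR_gt0 // [leLHS]mulrC ler_pdivrMr //.
by rewrite [_ * y]mulrC.
Qed.

End Weights.

Section Cocompact.
Variables (R : realType) (Gamma : set 'M[R]_3).
Hypothesis hGamma : closed_surface_group Gamma.

(** An invariant property that holds locally holds uniformly: by cocompactness
    every frame can be moved over a fixed compact set. *)
Lemma cocompact_near (I : Type) (F : set_system I) (FF : Filter F)
    (P : I -> 'M[R]_3 -> Prop) :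
  (forall i g h, Gamma g -> isomH2 h -> P i (g *m h) -> P i h) ->
  (forall h0, isomH2 h0 -> \forall h \near h0 & i \near F, isomH2 h -> P i h) ->
  \forall i \near F, forall h, isomH2 h -> P i h.
Proof.
move=> Pinv Ploc; have [GH _ _ _ [K [KH cK] Kcov]] := hGamma.
have cS := compact_frames KH cK.
have cov : \forall i \near F, [set h | isomH2 h /\ K (col 0 h)] `<=`
    (fun h => isomH2 h -> P i h).
  apply: ((compact_near_coveringP _).1 cS I F (fun i h => isomH2 h -> P i h) FF).
  by move=> h [ih _]; exact: Ploc.
move: cov; apply: filterS => i H h ih.
have Hh : H2 (col 0 h).
  have /isomH2P[a _ _ _ b] := ih; by split.
have [g Gg Kg] := Kcov _ Hh.
apply: (Pinv _ g) => //; apply: H; last by apply: isomH2M => //; exact: GH.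
split; first by apply: isomH2M => //; exact: GH.
by rewrite colE -mulmxA -colE.
Qed.
End Cocompact.

Lemma exp_bounded_eq0 (R : realType) (x b K t0 : R) : 0 <= x -> 0 < b ->
  (forall t, t0 < t -> x * expR (b * t) <= K) -> x = 0.
Proof.
move=> x0 b0 H; apply/eqP; case: (eqVneq x 0) => // xn.
have {xn}x0 : 0 < x by rewrite lt_neqAle eq_sym xn.
pose t := `|t0| + 1 + (`|K| + 1) / (x * b).
have xb : 0 < x * b by rewrite mulr_gt0.
have d0 : 0 < (`|K| + 1) / (x * b) by rewrite divr_gt0 // ltr_wpDl.
have lt : t0 < t by rewrite /t; have := ler_norm t0; lra.
have := H t lt; have := expR_ge1Dx (b * t); have := ler_norm K.
have : x * b * t >= `|K| + 1.
  rewrite -[leLHS](mulfVK (lt0r_neq0 xb)) [leRHS]mulrC ler_pM2r // /t.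
  by have := normr_ge0 t0; lra.
by move: (expR (b * t)) => e h1 h2 h3 h4; nra.
Qed.

Section Independence.
Variables (R : realType) (p : nat) (J : 'M[R]_(p + p)).
Variables (Gamma : set 'M[R]_3) (rho : 'M[R]_3 -> 'M[R]_(p + p)).
Local Notation vect := ('M[R]_(p + p, p)).
Hypothesis hGamma : closed_surface_group Gamma.
Hypothesis hrho : representation J Gamma rho.
Variable Fr : 'M[R]_3 -> vect -> vect -> Prop.
Hypothesis fs : frame_system J Gamma rho Fr.
Implicit Types (V W U : vect) (h : 'M[R]_3).

(** Along a short horocyclic arc the two Lagrangians are close, uniformly by
    cocompactness. The bound C is a parameter tending to infinity, which turns
    the existence of a common bound into a property holding near infinity. *)
Lemma horo_slope_bounded (j k : 'I_p) r :
  weight Gamma rho Fr (fun c => `|c 0 j * c 0 k|^-1) r ->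
  exists C d : R, 0 < d /\ forall h s V W V' W', isomH2 h -> `|s| < d ->
    Fr h V' W' -> Fr (h *m horo s) V W -> W^T *m J *m V' \in unitmx /\
    `|slope J V W V' j k| * r (h *m horo s) V W <= C.
Proof.
move=> w.
pose P (x : R * R) h := forall V W V' W', Fr h V' W' -> Fr (h *m horo x.2) V W ->
  W^T *m J *m V' \in unitmx /\ `|slope J V W V' j k| * r (h *m horo x.2) V W <= x.1.
have ihs h s : isomH2 h -> isomH2 (h *m horo s).
  by move=> ih; apply: isomH2M => //; exact: isomH2_horo.
pose F : set_system (R * R) := filter_prod (pinfty_nbhs R) (nbhs (0 : R)).
have FF : Filter F by exact: filter_prod_filter.
suff : \forall x \near F, forall h, isomH2 h -> P x h.
  move=> [[A B] /= [[M [_ MA]] /nbhs_ballP[d /= d0 dB]] AB].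
  exists (M + 1), d; split => // h s V W V' W' ih sd fr fr'.
  apply: (AB (M + 1, s) _ h ih V W V' W' fr fr').
  split; first by apply: MA; rewrite ltrDl.
  by apply: dB; rewrite /ball /= sub0r normrN.
apply: (cocompact_near hGamma) => [[C s] g h Gg ih Pg V W V' W' fr fr'|h0 ih0].
  have := Pg _ _ _ _ (fs_equiv fs Gg ih fr); rewrite -mulmxA.
  move=> /(_ _ _ (fs_equiv fs Gg (ihs _ _ ih) fr')).
  by rewrite (rho_bil hrho) // (slope_rho hrho) // (w_equiv w) //; exact: ihs.
pose G0 : set_system ('M[R]_3 * (R * R)) := filter_prod (nbhs h0) F.
have FG0 : Filter G0 by exact: filter_prod_filter.
pose G := within [set x | isomH2 x.1] G0.
have FG : Filter G by exact: within_filter.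
have cG A : G0 A -> G A by apply: filterS.
have c1 : (fun x : 'M[R]_3 * (R * R) => x.1) @ G --> h0.
  by move=> A hA; apply: cG; exact: (cvg_fst hA).
have cF : (fun x : 'M[R]_3 * (R * R) => x.2) @ G --> F.
  by move=> A hA; apply: cG; exact: (cvg_snd hA).
have c2 : (fun x : 'M[R]_3 * (R * R) => x.2.2) @ G --> (0 : R).
  by move=> A hA; apply: (cF _ (cvg_snd hA)).
have c3 : (fun x : 'M[R]_3 * (R * R) => x.2.1) @ G --> pinfty_nbhs R.
  by move=> A hA; apply: (cF _ (cvg_fst hA)).
have ch : (fun x : 'M[R]_3 * (R * R) => x.1 *m horo x.2.2) @ G --> h0.
  have chs : (fun x : 'M[R]_3 * (R * R) => horo x.2.2) @ G --> horo 0.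
    by move=> A /horo_cont hA; exact: (c2 _ hA).
  by have := cvg_mulmx c1 chs; rewrite horo0 mulmx1; exact.
have i1 : \forall x \near G, isomH2 x.1 by exact: withinT.
have i2 : \forall x \near G, isomH2 (x.1 *m horo x.2.2) by apply: filterS i1 => x; exact: ihs.
have [U [W1 [U0 [W10 [fr0 UU0 _ frU]]]]] := fs_local fs FG ih0 c1 i1.
have [V [W [V0 [W0 [frV0 VV0 WW0 frV]]]]] := fs_local fs FG ih0 ch i2.
have [c [c0 V0E W0E]] := fs_scale fs ih0 fr0 frV0.
have [WV0 _ _ _] := fs_iso fs ih0 fr0.
have u0 : W0^T *m J *m U0 \in unitmx.
  rewrite W0E -[U0]mulmx1; apply: unit_scale; rewrite ?unitmx1 //.
  by rewrite WV0 unitmx1.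
have cu : \forall x \near G, (W x)^T *m J *m U x \in unitmx.
  exact: (near_unitmx (cvg_mulmx (cvg_mulmx (cvg_trmx WW0) (cvg_cst J)) UU0) u0).
have cq : (fun x => `|slope J (V x) (W x) (U x) j k| * r (x.1 *m horo x.2.2) (V x) (W x)) @ G -->
    `|slope J V0 W0 U0 j k| * r h0 V0 W0.
  apply: cvgM; last exact: (w_cont w).
  by apply: cvg_norm; apply: cvg_mx_entry; exact: cvg_slope.
set q0 := `|slope J V0 W0 U0 j k| * r h0 V0 W0 in cq.
have b1 : \forall x \near G, `|slope J (V x) (W x) (U x) j k| * r (x.1 *m horo x.2.2) (V x) (W x) < q0 + 1.
  by apply: (cvgr_lt _ cq); rewrite ltrDl.
have b2 : \forall x \near G, q0 + 1 < x.2.1 by apply: (c3 (fun y => q0 + 1 < y)); exists (q0 + 1); split; rewrite ?num_real.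
have H : \forall x \near G, P x.2 x.1.
  near=> x => V1 Wx V' W' fr fr'.
  have ix : isomH2 x.1 by near: x.
  have frx1 : Fr x.1 (U x) (W1 x) by near: x.
  have [c' [c'0 V'E _]] := fs_scale fs ix frx1 fr.
  have frx : Fr (x.1 *m horo x.2.2) (V x) (W x) by near: x.
  have [c1' [c1'0 -> ->]] := fs_scale fs (ihs _ _ ix) frx fr'.
  have ux : (W x)^T *m J *m U x \in unitmx by near: x.
  have ud := diag_unit c'0.
  rewrite V'E; split; first exact: unit_scale.
  rewrite slope_scale // (w_scale w) //; last exact: ihs.
  rewrite normrM mulrACA mulfV ?mul1r; last by rewrite normr_eq0 mulf_neq0.
  by apply: ltW; apply: lt_trans (_ : q0 + 1 < _); near: x.
have [[A B] /= [hA hB] AB] : G0 [set x | isomH2 x.1 -> P x.2 x.1] by exact: H.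
by exists (A, B) => //= -[a b] /= [Aa Bb]; exact: (AB (a, b)).
Unshelve. all: by end_near. Qed.

(** The Lagrangian spanned by the vectors V of a frame is unchanged when the
    frame slides along the horocycle based at its backward end point: flowing
    backwards, both frames come together, so that the slope stays bounded while
    the weights expand. *)
Lemma horo_slope0 h V W V' W' : (1 < p)%N -> isomH2 h ->
  (forall j k : 'I_p, j != k -> exists r, weight Gamma rho Fr (fun c => `|c 0 j * c 0 k|^-1) r) ->
  Fr h V' W' -> Fr (h *m horo 1) V W -> V^T *m J *m V' = 0.
Proof.
move=> p1 ih ws fr' fr.
have ib t : isomH2 (h *m boost t) by apply: isomH2M => //; exact: isomH2_boost.
have ih1 : isomH2 (h *m horo 1) by apply: isomH2M => //; exact: isomH2_horo.
have fr't t : Fr (h *m boost t) V' W' by apply/(fs_flow fs).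
have frt t : Fr (h *m boost (- t) *m horo (expR (- t))) V W.
  by rewrite -mulmxA boost_horo mulmxA; apply/(fs_flow fs).
have key (j k : 'I_p) : j != k -> W^T *m J *m V' \in unitmx /\ slope J V W V' j k = 0.
  move=> /ws[r w]; have [C [d [d0 H]]] := horo_slope_bounded w.
  have [a [b [a0 b0 ex]]] := weight_expand fs w.
  have Ht t : 1 - ln d < t -> W^T *m J *m V' \in unitmx /\
      `|slope J V W V' j k| * r (h *m horo 1 *m boost (- t)) V W <= C.
    move=> lt; have := H (h *m boost (- t)) (expR (- t)) V W V' W' (ib _) _ (fr't _) (frt _).
    rewrite -[h *m boost (- t) *m _]mulmxA boost_horo mulmxA; apply.
    by rewrite gtr0_norm ?expR_gt0 // -ltr_ln ?posrE ?expR_gt0 // expRK; lra.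
  have [u _] : W^T *m J *m V' \in unitmx /\ _ := Ht (1 - ln d + 1) (ltac:(by rewrite ltrDl)).
  split => //; apply/eqP; rewrite -normr_eq0; apply/eqP.
  have r0 := w_pos w ih1 fr.
  apply: (@exp_bounded_eq0 _ _ b (a * C / r (h *m horo 1) V W) `|1 - ln d|) => // t lt.
  have t0 : 0 < t by apply: le_lt_trans lt.
  have [|_ le] := Ht t; first by apply: le_lt_trans lt; exact: ler_norm.
  have e := ex t _ _ _ t0 ih1 fr.
  rewrite ler_pdivlMr // mulrAC -mulrA.
  have := ler_wpM2l (normr_ge0 (slope J V W V' j k)) e.
  have := ler_wpM2l (ltW a0) le.
  set x := slope _ _ _ _ _ _; set y := r _ _ _; set z := r _ _ _; set q := expR _.
  by move=> h1 h2; apply: le_trans h2 _; rewrite mulrCA.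
have d := fs_iso fs ih1 fr; have [_ _ UU _] := fs_iso fs ih fr'.
have [u _] := key (Ordinal (ltnW p1)) (Ordinal p1) isT.
apply: (slope_eq0 u); apply/matrixP => j k; rewrite [RHS]mxE.
case: (eqVneq j k) => [->|jk]; last by have [] := key _ _ jk.
have /matrixP/(_ k k) := slope_antisym d UU u; rewrite [LHS]mxE [RHS]mxE => /eqP.
by rewrite -addr_eq0 -mulr2n mulrn_eq0 /= => /eqP.
Qed.

Lemma horo_span h V W V' W' : (1 < p)%N -> isomH2 h ->
  (forall j k : 'I_p, j != k -> exists r, weight Gamma rho Fr (fun c => `|c 0 j * c 0 k|^-1) r) ->
  Fr h V' W' -> Fr (h *m horo 1) V W -> cspan V' = cspan V.
Proof.
move=> p1 ih ws fr' fr.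
have ih1 : isomH2 (h *m horo 1) by apply: isomH2M => //; exact: isomH2_horo.
apply: dual_bases_span (fs_iso fs ih1 fr) (fs_iso fs ih fr') _.
exact: horo_slope0 fr' fr.
Qed.

End Independence.

(** * Frames adapted to the splitting *)

Section Anosov.
Variables (R : realType) (p : nat) (J : 'M[R]_(p + p)).
Variables (Gamma : set 'M[R]_3) (rho : 'M[R]_3 -> 'M[R]_(p + p)).
Variables E Eb : nat -> subbundle R (p + p).
Hypothesis hp : (1 < p)%N.
Hypothesis hJ : split_signature J.
Hypothesis hGamma : closed_surface_group Gamma.
Hypothesis hrho : representation J Gamma rho.
Hypothesis hBA : borel_anosov_splitting J Gamma rho E Eb.
Local Notation vect := ('M[R]_(p + p, p)).
Local Notation B := (bil (lorentz R)).
Implicit Types (V W U : vect) (u : 'cV[R]_3 * 'cV[R]_3) (h : 'M[R]_3)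
  (c : 'rV[R]_p).

Lemma J_sym : J^T = J.
Proof.
have [P uP H] := hJ.
have : (P^T *m J *m P)^T = P^T *m J *m P.
  by rewrite H tr_block_mx !trmx0 trmx1 linearN /= trmx1.
rewrite !trmx_mul trmxK mulmxA => /(congr1 (fun A => A *m invmx P)).
rewrite !mulmxK // => /(congr1 (fun A => invmx P^T *m A)).
by rewrite !mulKmx // unitmx_tr.
Qed.

(** Dual bases of the two Lagrangians of the splitting at u, made of vectors of
    the lines. Everything below is invariant under rescaling of these lines. *)
Definition adapted u V W : Prop :=
  [/\ W^T *m J *m V = 1%:M, forall k : 'I_p, E k.+1 u = <[col k V]>%VS &
      forall k : 'I_p, Eb k.+1 u = <[col k W]>%VS].

Lemma sumE_cspan (L : nat -> subbundle R (p + p)) u V :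
  (forall k : 'I_p, L k.+1 u = <[col k V]>%VS) -> sumE L u = cspan V.
Proof.
move=> H; rewrite /sumE big_add1 big_mkord -sum_lines_cspan.
by apply: eq_bigr => k _; rewrite H.
Qed.

Lemma adapted_E u V W : adapted u V W -> sumE E u = cspan V.
Proof. by move=> [_ H _]; exact: sumE_cspan. Qed.

Lemma adapted_Eb u V W : adapted u V W -> sumE Eb u = cspan W.
Proof. by move=> [_ _ H]; exact: sumE_cspan. Qed.

Lemma adapted_iso u V W : T1H2 u -> adapted u V W -> dual_bases J V W.
Proof.
move=> Tu ad; have [D _ _] := ad; have [_ _ _ /(_ u Tu)[i1 i2 _ _] _] := hBA.
split => //.
- have <- : (W^T *m J *m V)^T = V^T *m J *m W by rewrite !trmx_mul trmxK J_sym mulmxA.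
  by rewrite D trmx1.
- by apply/isotropic_cspan; rewrite -(adapted_E ad).
- by apply/isotropic_cspan; rewrite -(adapted_Eb ad).
Qed.

(** Continuous local sections of the lines give the vectors; those of the second
    Lagrangian are divided by the pairing, which does not vanish because the form
    is nondegenerate on E_i + Eb_i. The filter is arbitrary in order to cover
    families of frames depending on parameters. *)
Lemma adapted_local (T : Type) (F : set_system T) (FF : Filter F)
    (f : T -> 'cV[R]_3 * 'cV[R]_3) (u0 : 'cV[R]_3 * 'cV[R]_3) :
  T1H2 u0 -> f @ F --> u0 -> (\forall x \near F, T1H2 (f x)) ->
  exists (V W : T -> vect) (V0 W0 : vect),
    [/\ adapted u0 V0 W0, V @ F --> V0, W @ F --> W0 &
        \forall x \near F, adapted (f x) (V x) (W x)].
Proof.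
move=> Tu0 fu0 fT.
have [cont _ _ iso _] := hBA.
have loc (L : subbundle R (p + p)) : continuous_line_bundle L ->
    exists s : 'cV[R]_3 * 'cV[R]_3 -> 'cV[R]_(p + p),
    [/\ s u0 != 0 /\ L u0 = <[s u0]>%VS, s \o f @ F --> s u0 &
    \forall x \near F, s (f x) != 0 /\ L (f x) = <[s (f x)]>%VS].
  move=> /(_ u0 Tu0)[A uA [s sc sP]]; exists s.
  have Au0 : (A `&` @T1H2 R) u0 by split => //; exact: nbhs_singleton.
  have fA : \forall x \near F, (A `&` @T1H2 R) (f x).
    by apply: filterI fT; exact: fu0.
  split; [exact: sP| |by apply: filterS fA => x /sP].
  move/subspace_continuousP : sc => /(_ u0 Au0) sc.
  apply: (@cvg_trans _ (s @ within (A `&` @T1H2 R) (nbhs u0))) sc => B sB.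
  have fB := fu0 _ sB.
  by apply: filterS2 fA fB => x Ax; apply.
have locE (k : 'I_p) := loc _ (let: And4 c _ _ _ := cont k.+1 (ltn_ord k) in c).
have locEb (k : 'I_p) := loc _ (let: And4 _ c _ _ := cont k.+1 (ltn_ord k) in c).
pose s k := projT1 (cid (locE k)).
have sP k : [/\ s k u0 != 0 /\ E k.+1 u0 = <[s k u0]>%VS, s k \o f @ F --> s k u0 &
    \forall x \near F, s k (f x) != 0 /\ E k.+1 (f x) = <[s k (f x)]>%VS].
  by rewrite /s; case: cid.
pose sb k := projT1 (cid (locEb k)).
have sbP k : [/\ sb k u0 != 0 /\ Eb k.+1 u0 = <[sb k u0]>%VS, sb k \o f @ F --> sb k u0 &
    \forall x \near F, sb k (f x) != 0 /\ Eb k.+1 (f x) = <[sb k (f x)]>%VS].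
  by rewrite /sb; case: cid.
pose Vu u : vect := \matrix_(i, k) s k u i 0.
pose Wu u : vect := \matrix_(i, k) ((bil J (s k u) (sb k u))^-1 * sb k u i 0).
have cV k u : col k (Vu u) = s k u by apply/colP => i; rewrite !mxE.
have cW k u : col k (Wu u) = (bil J (s k u) (sb k u))^-1 *: sb k u.
  by apply/colP => i; rewrite !mxE.
have Jc v w : bil J v w = bil J w v by apply: bil_sym; exact: J_sym.
have nz u : T1H2 u ->
   (forall k, s k u != 0 /\ E k.+1 u = <[s k u]>%VS) ->
   (forall k, sb k u != 0 /\ Eb k.+1 u = <[sb k u]>%VS) ->
   forall k, bil J (s k u) (sb k u) != 0.
  move=> Tu sE sbE k; apply/negP => /eqP b0.
  have [_ _ _ nd] := iso u Tu; have [s0 Es] := sE k; have [_ Esb] := sbE k.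
  have [e1 e2 _ _] := iso u Tu.
  have s1 : s k u \in sumE E u.
    rewrite /sumE big_add1 big_mkord (bigD1 k) //= -[s k u]addr0.
    by apply: memv_add; rewrite ?mem0v // Es memv_line.
  move/eqP: s0; apply; apply: (nd k.+1 (ltn_ord k)).
    by rewrite -[s k u]addr0; apply: memv_add; rewrite ?mem0v // Es memv_line.
  move=> w /memv_addP[a]; rewrite Es Esb => /vlineP[x ->] [_ /vlineP[y ->] ->].
  by rewrite bilDr !bilZr b0 mulr0 addr0 e1 ?mulr0.
have good u : T1H2 u ->
   (forall k, s k u != 0 /\ E k.+1 u = <[s k u]>%VS) ->
   (forall k, sb k u != 0 /\ Eb k.+1 u = <[sb k u]>%VS) -> adapted u (Vu u) (Wu u).
  move=> Tu sE sbE; have nzu := nz u Tu sE sbE; split=> [|k|k].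
  - apply/matrixP => i k; rewrite bil_entries cV cW bilZl !mxE.
    case: eqVneq => [->|ik]; first by rewrite (Jc (sb _ _)) mulVf.
    have [_ _ io _] := iso u Tu.
    have m1 : sb i u \in (E k.+1 u + Eb i.+1 u)%VS.
      by have [_ ->] := sbE i; rewrite (subvP (addvSr _ _)) // memv_line.
    have m2 : s k u \in (E k.+1 u + Eb i.+1 u)%VS.
      by have [_ ->] := sE k; rewrite (subvP (addvSl _ _)) // memv_line.
    have ki : k.+1 != i.+1 :> nat by rewrite eqSS eq_sym.
    by rewrite (io k.+1 i.+1 (ltn_ord k) (ltn_ord i) ki _ _ m1 m2) mulr0.
  - by rewrite cV; have [] := sE k.
  - rewrite cW; have [_ ->] := sbE k; apply/vspaceP => v.
    have bn := nzu k; apply/vlineP/vlineP => -[a ->].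
      by exists (a * bil J (s k u) (sb k u)); rewrite scalerA mulfK.
    by exists (a / bil J (s k u) (sb k u)); rewrite scalerA.
exists (Vu \o f), (Wu \o f), (Vu u0), (Wu u0).
have g0 : adapted u0 (Vu u0) (Wu u0).
  by apply: good => // k; [have [] := sP k|have [] := sbP k].
split => //.
- apply: cvg_mx_entries => i k; rewrite mxE; under eq_fun do rewrite /= mxE.
  by have [_ c _] := sP k; exact: (cvg_mx_entry c).
- apply: cvg_mx_entries => i k; rewrite mxE; under eq_fun do rewrite /= mxE.
  have [_ c _] := sP k; have [_ cb _] := sbP k.
  apply: cvgM; last exact: (cvg_mx_entry cb).
  apply: cvgV; first by apply: nz => // j; [have [] := sP j|have [] := sbP j].
  by apply: (cvg_mx_entry (i := 0) (j := 0)); exact: (cvg_mulmx (cvg_mulmx (cvg_trmx c) (cvg_cst J)) cb).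
- have a1 : \forall x \near F, forall k, s k (f x) != 0 /\ E k.+1 (f x) = <[s k (f x)]>%VS.
    by apply: filter_forall => k; have [] := sP k.
  have a2 : \forall x \near F, forall k, sb k (f x) != 0 /\ Eb k.+1 (f x) = <[sb k (f x)]>%VS.
    by apply: filter_forall => k; have [] := sbP k.
  by apply: filterS3 fT a1 a2 => x; exact: good.
Qed.

Lemma adapted_ex u : T1H2 u -> exists V W, adapted u V W.
Proof.
move=> Tu.
have [||V [W [V0 [W0 [ad _ _ _]]]]] := @adapted_local unit _ (globally_filter setT) (fun=> u) u Tu.
- by apply: cvg_cst.
- by [].
by exists V0, W0.
Qed.

Lemma adapted_scale u V W V' W' : T1H2 u -> adapted u V W -> adapted u V' W' ->
  exists c : 'rV[R]_p, [/\ forall k, c 0 k != 0, V' = V *m diag_mx c &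
    W' = W *m diag_mx (row_inv c)].
Proof.
move=> Tu [D vE wE] [D' vE' wE'].
have ex k : exists c : R, col k V' = c *: col k V.
  by have : col k V' \in <[col k V]>%VS; [rewrite -vE vE' memv_line|move/vlineP].
have exb k : exists c : R, col k W' = c *: col k W.
  by have : col k W' \in <[col k W]>%VS; [rewrite -wE wE' memv_line|move/vlineP].
pose c := \row_k projT1 (cid (ex k)).
have cP k : col k V' = c 0 k *: col k V by rewrite mxE; case: cid.
pose d := \row_k projT1 (cid (exb k)).
have dP k : col k W' = d 0 k *: col k W by rewrite mxE; case: cid.
have cd k : d 0 k * c 0 k = 1.
  have := congr1 (fun A : 'M[R]_p => A k k) D'; rewrite /= bil_entries cP dP bilZl bilZr.
  by rewrite -bil_entries D !mxE eqxx mulr1.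
have c0 k : c 0 k != 0.
  by apply/eqP => z; move: (cd k); rewrite z mulr0 => /esym/eqP; rewrite oner_eq0.
have dE : d = row_inv c.
  by apply/rowP => k; rewrite [RHS]mxE -[LHS](mulfK (c0 k)) cd mul1r.
exists c; split => //; rewrite -?dE; apply/matrixP => i k.
  by rewrite mul_mx_diag [RHS]mxE; have /colP/(_ i) := cP k; rewrite !mxE mulrC.
by rewrite mul_mx_diag [RHS]mxE; have /colP/(_ i) := dP k; rewrite !mxE mulrC.
Qed.

Lemma mximg_line n (A : 'M[R]_n) v : mximg A <[v]> = <[A *m v]>%VS.
Proof. by rewrite /mximg limg_line lfunE. Qed.

Lemma adapted_equiv g u V W : Gamma g -> T1H2 u -> adapted u V W ->
  adapted (isom_act g u) (rho g *m V) (rho g *m W).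
Proof.
move=> Gg Tu [D vE wE]; have [cont _ _ _ _] := hBA.
split=> [|k|k]; first by rewrite (rho_bil hrho).
- by have [_ _ /(_ g u Gg Tu) -> _] := cont k.+1 (ltn_ord k); rewrite vE mximg_line !colE mulmxA.
- by have [_ _ _ /(_ g u Gg Tu) ->] := cont k.+1 (ltn_ord k); rewrite wE mximg_line !colE mulmxA.
Qed.

Lemma adapted_flow t u V W : T1H2 u -> adapted (geoflow t u) V W <-> adapted u V W.
Proof.
move=> Tu; have [_ _ fl _ _] := hBA; rewrite /adapted.
have e1 (k : 'I_p) : E k.+1 (geoflow t u) = E k.+1 u.
  by have [/(_ t u Tu)] := fl k.+1 (ltn_ord k).
have e2 (k : 'I_p) : Eb k.+1 (geoflow t u) = Eb k.+1 u.
  by have [_ /(_ t u Tu)] := fl k.+1 (ltn_ord k).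
by split=> -[D h1 h2]; split=> // k; rewrite -?h1 -?h2 ?e1 ?e2.
Qed.

Definition frames h V W := adapted (base h) V W.

Lemma cvg_base (T : Type) (F : set_system T) (FF : Filter F) (f : T -> 'M[R]_3) h0 :
  f @ F --> h0 -> (fun x => base (f x)) @ F --> base h0.
Proof. by move=> fh; exact: (cvg_pair (cvg_col fh) (cvg_col fh)). Qed.

Lemma frames_system : frame_system J Gamma rho frames.
Proof.
split; rewrite /frames.
- by move=> h V W /base_T1H2 Tu; exact: adapted_iso.
- move=> T F FF f h0 /base_T1H2 Tu fh0 fi.
  apply: (adapted_local FF (f := fun x => base (f x))) => //; first exact: cvg_base.
  by apply: filterS fi => x; exact: base_T1H2.
- by move=> h V W V' W' /base_T1H2 Tu; exact: (adapted_scale Tu).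
- by move=> g h V W Gg /base_T1H2 Tu; rewrite baseM; exact: adapted_equiv.
- by move=> t h V W /base_T1H2 Tu; rewrite base_boost; exact: adapted_flow.
Qed.

(** The elementary matrix of Hom(E_i, L), for L spanned by l. *)
Definition hom_mx (l : vect -> vect -> 'cV[R]_(p + p)) (i : 'I_p) V W : 'M[R]_(p + p) :=
  l V W *m (J *m col i W)^T.

Lemma hom_mx_space (L : subbundle R (p + p)) l (i : 'I_p) u V W : T1H2 u ->
  adapted u V W -> L u = <[l V W]>%VS ->
  hom_bundle (others E Eb i.+1) L u (hom_mx l i V W).
Proof.
move=> Tu ad Ll; have [D vE wE] := ad; have [_ _ _ WW] := adapted_iso Tu ad.
have Js := J_sym.
split=> [v|v]; last first.
  rewrite Ll /hom_mx -mulmxA; apply/vlineP; exists (((J *m col i W)^T *m v) 0 0).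
  by apply/colP => a; rewrite !mxE big_ord1 !mxE mulrC.
move=> vK; rewrite /hom_mx -mulmxA.
suff -> : (J *m col i W)^T *m v = 0 by rewrite mulmx0.
suff /subvP/(_ v vK) : (others E Eb i.+1 u <= lker (linfun (mulmx (J *m col i W)^T)))%VS.
  by rewrite memv_ker lfunE => /eqP.
rewrite /others subv_add; apply/andP; split.
  rewrite big_add1 big_mkord; apply/subv_sumP => k; rewrite eqSS => ki.
  rewrite vE; apply/subvP => w /vlineP[a ->]; rewrite memv_ker lfunE /=.
  rewrite -scalemxAr trmx_mul Js.
  have -> : (col i W)^T *m J *m col k V = ((W^T *m J *m V) i k)%:M.
    by rewrite bil_entries /bil [LHS]mx11_scalar.
  have ik : ((i : 'I_p) == (k : 'I_p)) = false by apply/negbTE; rewrite eq_sym.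
  by rewrite D mxE ik raddf0 scaler0.
rewrite (adapted_Eb ad); apply/subvP => w /mem_cspan[a ->].
rewrite memv_ker lfunE /= trmx_mul Js tr_col -!row_mul mulmxA.
by rewrite WW mul0mx row0.
Qed.

(** The fibre Hom(E_i, L) is a line, spanned by an elementary matrix built from
    the frame: a weight is the norm of this matrix in the contracted metric. *)
Lemma contracted_weight (L : subbundle R (p + p)) l (chi : 'rV[R]_p -> R) (i : 'I_p) :
  (forall h V W, isomH2 h -> frames h V W -> L (base h) = <[l V W]>%VS /\ l V W != 0) ->
  (forall V W c, (forall k, c 0 k != 0) ->
    l (V *m diag_mx c) (W *m diag_mx (row_inv c)) = chi c *: l V W) ->
  (forall g V W, l (g *m V) (g *m W) = g *m l V W) ->
  (forall (T : Type) (F : set_system T) (FF : Filter F) (V W : T -> vect) V0 W0,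
     V @ F --> V0 -> W @ F --> W0 -> (fun x => l (V x) (W x)) @ F --> l V0 W0) ->
  contracted Gamma rho (hom_bundle (others E Eb i.+1) L) ->
  exists r, weight Gamma rho frames (fun c => `|chi c / c 0 i|) r.
Proof.
move=> Ll lscale lequiv lcont [N [Npos Nscale _ Nequiv Ncont] [a [b [a0 b0 Ncontr]]]].
pose r h V W := N (base h) (hom_mx l i V W).
have hom h V W : isomH2 h -> frames h V W ->
    hom_bundle (others E Eb i.+1) L (base h) (hom_mx l i V W).
  by move=> ih fr; apply: hom_mx_space => //; [exact: base_T1H2|have [] := Ll _ _ _ ih fr].
exists r; split.
- move=> h V W ih fr; apply: Npos; [exact: base_T1H2|exact: hom|].
  have [D _ _ _] := fs_iso frames_system ih fr; have [_ l0] := Ll _ _ _ ih fr.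
  apply: contra_neq l0 => A0; have : hom_mx l i V W *m col i V = 0 by rewrite A0 mul0mx.
  rewrite /hom_mx -mulmxA trmx_mul J_sym.
  have -> : (col i W)^T *m J *m col i V = ((W^T *m J *m V) i i)%:M.
    by rewrite bil_entries /bil [LHS]mx11_scalar.
  by rewrite D mxE eqxx mulmx1.
- move=> h V W c ih fr c0; rewrite /r.
  have -> : hom_mx l i (V *m diag_mx c) (W *m diag_mx (row_inv c)) =
      (chi c / c 0 i) *: hom_mx l i V W.
    rewrite /hom_mx lscale //.
    have -> : col i (W *m diag_mx (row_inv c)) = (c 0 i)^-1 *: col i W.
      by apply/colP => k; rewrite mul_mx_diag !mxE mulrC.
    by rewrite -scalemxAr linearZ /= -scalemxAl -scalemxAr scalerA.
  by rewrite Nscale //; [exact: base_T1H2|exact: hom].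
- move=> g h V W Gg ih fr; rewrite /r baseM.
  rewrite -(Nequiv g (base h) _ Gg (base_T1H2 ih) (hom _ _ _ ih fr)); congr N.
  rewrite /hom_mx lequiv -!mulmxA; congr (_ *m (_ *m _)).
  have ug := rho_unit hrho Gg.
  have E1 : J *m rho g = (invmx (rho g))^T *m J.
    by rewrite -[in RHS](rho_iso hrho Gg) !mulmxA -trmx_mul mulmxV // trmx1 mul1mx.
  rewrite colE -mulmxA -colE mulmxA E1 -mulmxA trmx_mul trmxK.
  by [].
- by move=> h h' V W bh; rewrite /r bh.
- move=> T F FF f V W h0 V0 W0 ih0 fh0 VV0 WW0 fr0 fi ff.
  move/subspace_continuousP : Ncont => /(_ (base h0, hom_mx l i V0 W0)) Ncont.
  have in0 : T1H2 (base h0) /\ hom_bundle (others E Eb i.+1) L (base h0) (hom_mx l i V0 W0).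
    by split; [exact: base_T1H2|exact: hom].
  have cA : (fun x => hom_mx l i (V x) (W x)) @ F --> hom_mx l i V0 W0.
    apply: cvg_mulmx; first exact: lcont.
    by apply: cvg_trmx; apply: cvg_mulmx; [exact: cvg_cst|exact: cvg_col].
  have cz : (fun x => (base (f x), hom_mx l i (V x) (W x))) @ F --> (base h0, hom_mx l i V0 W0).
    by exact: (cvg_pair (cvg_base FF fh0) cA).
  move=> B /(Ncont in0) nB; have := cz _ nB.
  apply: filterS3 fi ff => x ix fx; apply; split; [exact: base_T1H2|exact: hom].
exists a, b; split => // t h V W t0 ih fr; rewrite /r base_boost.
by apply: Ncontr => //; [exact: base_T1H2|exact: hom].
Qed.

Lemma weight_E (i j : 'I_p) : (i < j)%N ->
  exists r, weight Gamma rho frames (fun c => `|c 0 j / c 0 i|) r.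
Proof.
move=> ij; have [_ _ _ _ [_ cE]] := hBA.
apply: (@contracted_weight (E j.+1) (fun V W => col j V) (fun c => c 0 j)).
- move=> h V W ih fr; have [_ vE _] := fr; rewrite vE; split => //.
  apply/eqP => z; have [D _ _ _] := fs_iso frames_system ih fr.
  have := congr1 (fun A : 'M[R]_p => A j j) D; rewrite /= bil_entries z /bil mulmx0 !mxE eqxx.
  by move/esym/eqP; rewrite oner_eq0.
- by move=> V W c c0; apply/colP => k; rewrite mul_mx_diag !mxE mulrC.
- by move=> g V W; rewrite !colE mulmxA.
- by move=> T F FF V W V0 W0 VV0 WW0; exact: cvg_col.
- by apply: cE => //; rewrite ltnS ij ltn_ord.
Qed.

Lemma weight_Eb (i k : 'I_p) : k.+1 = p -> (i < k)%N ->
  exists r, weight Gamma rho frames (fun c => `|(c 0 k)^-1 / c 0 i|) r.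
Proof.
move=> kp ik; have [_ _ _ _ [cEb _]] := hBA.
apply: (@contracted_weight (Eb p) (fun V W => col k W) (fun c => (c 0 k)^-1)).
- move=> h V W ih fr; have [_ _ wE] := fr; rewrite -[in Eb p]kp wE; split => //.
  apply/eqP => z; have [D _ _ _] := fs_iso frames_system ih fr.
  have := congr1 (fun A : 'M[R]_p => A k k) D; rewrite /= bil_entries z /bil linear0 !mul0mx !mxE eqxx.
  by move/esym/eqP; rewrite oner_eq0.
- by move=> V W c c0; apply/colP => l; rewrite mul_mx_diag !mxE mulrC.
- by move=> g V W; rewrite !colE mulmxA.
- by move=> T F FF V W V0 W0 VV0 WW0; exact: cvg_col.
- by apply: cEb; have := ik; rewrite -ltnS kp.
Qed.

(** The weights used to compare two Lagrangians: on Lambda^2 of the dual, the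
    component along e_j and e_k is normalised by E_j -> Eb_p and E_k -> E_p. *)
Lemma weight_pair (j k : 'I_p) : j != k ->
  exists r, weight Gamma rho frames (fun c => `|c 0 j * c 0 k|^-1) r.
Proof.
move=> jk; wlog lt : j k jk / (j < k)%N => [wl|].
  case: (ltngtP j k) => [/wl|/wl|/val_inj e]; first exact.
    by rewrite eq_sym => /(_ jk)[r w]; exists r; apply: eq_weight w => c _; rewrite mulrC.
  by rewrite e eqxx in jk.
have p0 : (0 < p)%N by apply: leq_ltn_trans (ltn_ord k).
have qp : (p.-1 < p)%N by rewrite ltn_predL.
pose q := Ordinal qp; have q1 : q.+1 = p by rewrite /= prednK.
have jq : (j < q)%N by rewrite -ltnS q1; apply: leq_ltn_trans (ltn_ord k).
have [r1 w1] := weight_Eb q1 jq.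
case: (eqVneq k q) => [->|kq].
  exists r1; apply: eq_weight w1 => c c0 /=.
  by rewrite !normrM !normfV invfM mulrC.
have kq' : (k < q)%N by rewrite ltn_neqAle kq -ltnS q1 ltn_ord.
have [r2 w2] := weight_E kq'.
exists (fun h V W => r1 h V W * r2 h V W).
apply: eq_weight (weight_mul frames_system w1 w2) => c c0 /=.
rewrite !normrM !normfV invfM.
have nq : `|c 0 q| != 0 by rewrite normr_eq0.
have nj : `|c 0 j| != 0 by rewrite normr_eq0.
have nk : `|c 0 k| != 0 by rewrite normr_eq0.
by field; rewrite nq nj nk.
Qed.

(** The weights used to compare the components of one form: the component
    along e_i and e_j relative to the one along the last two vectors. *)
Lemma weight_ratio (i j k l : 'I_p) : l.+1 = p -> k.+1 = l -> (i < j)%N -> (i < k)%N ->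
  exists r, weight Gamma rho frames (fun c => `|c 0 k * c 0 l| / `|c 0 i * c 0 j|) r.
Proof.
move=> lp kl ij ik; have [r1 w1] := weight_E ik.
case: (eqVneq j l) => [->|jl].
  exists r1; apply: eq_weight w1 => c c0 /=.
  rewrite !normrM normfV.
  have nq : `|c 0 i| != 0 by rewrite normr_eq0.
  have nl : `|c 0 l| != 0 by rewrite normr_eq0.
  by field; rewrite nq nl.
have jl' : (j < l)%N by rewrite ltn_neqAle jl -ltnS lp ltn_ord.
have [r2 w2] := weight_E jl'.
exists (fun h V W => r1 h V W * r2 h V W).
apply: eq_weight (weight_mul frames_system w1 w2) => c c0 /=.
rewrite !normrM !normfV.
have nj : `|c 0 j| != 0 by rewrite normr_eq0.
have ni : `|c 0 i| != 0 by rewrite normr_eq0.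
by field; rewrite ni nj.
Qed.

(** * The limit curves *)

Lemma adapted_geod_pt u V W : T1H2 u ->
  adapted u V W <-> adapted (geod_pt (backward_end u) (forward_end u)) V W.
Proof.
move=> Tu; have [b1 b2 b3] := T1H2_bdry Tu; have [Tg _ _] := geod_ptP b1 b2 b3.
by rewrite {1}(T1H2_geoflow Tu); apply: adapted_flow.
Qed.

(** The frame of the triple (x, y, y'), slid along the horocycle based at x, has
    y' as forward end point. *)
Lemma sumE_fwd x y y' : bdry x -> bdry y -> bdry y' -> x <> y -> x <> y' ->
  fib (sumE E) x y = fib (sumE E) x y'.
Proof.
move=> bx by_ by' xy xy'; have [<- //|yy'] := pselect (y = y').
have [h [ih e1 e2 e3 _]] := frame_of_triple bx by_ by' xy yy' xy'.
have Tu := base_T1H2 ih.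
have ih1 : isomH2 (h *m horo 1) by apply: isomH2M => //; exact: isomH2_horo.
have Tu1 := base_T1H2 ih1.
have [V' [W' a']] := adapted_ex Tu.
have [V [W a]] := adapted_ex Tu1.
have sp := horo_span hGamma hrho frames_system hp ih weight_pair a' a.
rewrite /fib (adapted_E (V := V') (W := W')); last first.
  by rewrite -e1 -e2; apply/(adapted_geod_pt _ _ Tu).
rewrite (adapted_E (V := V) (W := W)) //.
by rewrite -e1 -e3 -fwd_horo1 -(bwd_horo h 1); apply/(adapted_geod_pt _ _ Tu1).
Qed.

(** The same argument for the reversed geodesics. *)
Lemma sumEb_bwd x x' y : bdry x -> bdry x' -> bdry y -> x <> y -> x' <> y ->
  fib (sumE Eb) x y = fib (sumE Eb) x' y.
Proof.
move=> bx bx' by_ xy xy'; have [<- //|xx'] := pselect (x = x').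
have [h [ih e1 e2 e3 _]] := frame_of_triple by_ bx bx' (nesym xy) xx' (nesym xy').
have Tu := base_T1H2 ih.
have ih1 : isomH2 (h *m horo 1) by apply: isomH2M => //; exact: isomH2_horo.
have ir h1 : isomH2 h1 -> isomH2 (h1 *m refl) by move=> ?; apply: isomH2M => //; exact: isomH2_refl.
have Tu' := base_T1H2 (ir _ ih); have Tu1' := base_T1H2 (ir _ ih1).
have [V' [W' a']] := adapted_ex Tu'.
have [V [W a]] := adapted_ex Tu1'.
have ws (j k : 'I_p) : j != k -> exists r,
    weight Gamma rho (rev_frames frames) (fun c => `|c 0 j * c 0 k|^-1) r.
  move=> /weight_pair[r w]; eexists; apply: eq_weight (weight_rev frames_system w) => c c0 /=.
  by rewrite !mxE invrK -invfM normfV.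
have sp := horo_span hGamma hrho (frame_system_rev frames_system) hp ih ws a' a.
rewrite /fib (adapted_Eb (V := V') (W := W')); last first.
  by rewrite -e1 -e2 -(bwd_refl h) -(fwd_refl h); apply/(adapted_geod_pt _ _ Tu').
rewrite (adapted_Eb (V := V) (W := W)) //.
rewrite -e1 -e3 -fwd_horo1 -(bwd_horo h 1) -(bwd_refl (h *m horo 1)) -(fwd_refl (h *m horo 1)).
by apply/(adapted_geod_pt _ _ Tu1').
Qed.

Lemma Theta_cspan u V W : T1H2 u -> adapted u V W ->
  Theta E (backward_end u) = cspan V.
Proof.
move=> Tu a; have [b1 b2 b3] := T1H2_bdry Tu; have [b4 b5] := antipode_bdry b1.
rewrite /Theta (sumE_fwd b1 b4 b2 b5 b3) /fib.
exact: (adapted_E ((adapted_geod_pt V W Tu).1 a)).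
Qed.

Lemma Thetab_cspan u V W : T1H2 u -> adapted u V W ->
  Thetab Eb (forward_end u) = cspan W.
Proof.
move=> Tu a; have [b1 b2 b3] := T1H2_bdry Tu; have [b4 b5] := antipode_bdry b2.
rewrite /Thetab (sumEb_bwd b4 b1 b2 (nesym b5) b3) /fib.
exact: (adapted_Eb ((adapted_geod_pt V W Tu).1 a)).
Qed.

Lemma transverse_Theta x y z V W U : bdry x -> bdry y -> bdry z -> x <> y -> z <> y ->
  adapted (geod_pt x y) V W -> cspan U = Theta E z ->
  (exists X : vect, X^T *m J *m U = 1%:M) -> W^T *m J *m U \in unitmx.
Proof.
move=> bx by_ bz xy zy ad sU [X XU].
have [Tu e1 e2] := geod_ptP bx by_ xy; have [Tz f1 f2] := geod_ptP bz by_ zy.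
have [V' [W' a']] := adapted_ex Tz.
have [D' D'' _ _] := adapted_iso Tz a'.
have [_ D _ _] := adapted_iso Tu ad.
have sz := Theta_cspan Tz a'; rewrite f1 -sU in sz.
have sy := Thetab_cspan Tu ad; rewrite e2 in sy.
have sy' := Thetab_cspan Tz a'; rewrite f2 sy in sy'.
have [g ug ->] := cspan_eq_unit sz XU.
have [g' ug' ->] := cspan_eq_unit sy' D.
by rewrite mulmxA trmx_mul -!mulmxA (mulmxA W'^T) (mulmxA _ V') D' mul1mx unitmx_mul unitmx_tr ug'.
Qed.

(** * The tangent cone of the limit curve *)

Hypothesis htrans : forall x y z : 'cV[R]_3, bdry x -> bdry y -> bdry z ->
    x <> y -> y <> z -> x <> z ->
    transverse (Theta E z)
      (fib (E p) x y + (orth J (fib (E p.-1) x y) :&: Thetab Eb y))%VS.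

(** Linear independence is expressed by a left inverse for the form of J, the
    shape in which it is used in slopes. *)
Definition Theta_basis z U : Prop :=
  cspan U = Theta E z /\ exists X : vect, X^T *m J *m U = 1%:M.

Lemma Theta_basis_adapted u V W : T1H2 u -> adapted u V W ->
  Theta_basis (backward_end u) V.
Proof.
move=> Tu ad; split; first by rewrite (Theta_cspan Tu ad).
by exists W; case: ad.
Qed.

Lemma Theta_basis_iso z U : bdry z -> Theta_basis z U -> U^T *m J *m U = 0.
Proof.
move=> bz [sU _]; have [b1 b2] := antipode_bdry bz.
have [Tu e1 e2] := geod_ptP bz b1 b2.
have [V [W ad]] := adapted_ex Tu.
apply/isotropic_cspan; rewrite sU -e1 (Theta_cspan Tu ad).
by apply/isotropic_cspan; have [] := adapted_iso Tu ad.
Qed.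

Lemma Theta_basis_eq z U U' : Theta_basis z U -> Theta_basis z U' ->
  exists2 g, g \in unitmx & U = U' *m g.
Proof. by move=> [s [X XU]] [s' _]; apply: cspan_eq_unit XU; rewrite s. Qed.

Variables k l : 'I_p.
Hypothesis lp : l.+1 = p.
Hypothesis kl : k.+1 = l.

(** Theta z contains a vector V_l + w with w in Thetab y, whose pairing with V_k
    is the coefficient on the last two vectors. If it vanished, w would be
    orthogonal to E_(p-1), against transversality. *)
Lemma slope_neq0 (x : 'cV[R]_3) y z V W U : bdry x -> bdry y -> bdry z ->
  x <> y -> y <> z -> x <> z ->
  adapted (geod_pt x y) V W -> Theta_basis z U ->
  W^T *m J *m U \in unitmx /\ slope J V W U k l != 0.
Proof.
move=> bx by_ bz xy yz xz ad bU; have [sU XU] := bU.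
have [Tu e1 e2] := geod_ptP bx by_ xy.
have u := transverse_Theta bx by_ bz xy (nesym yz) ad sU XU.
split => //; apply/eqP => s0.
have d := adapted_iso Tu ad; have [WV VW VV WW] := d.
have [_ vE _] := ad.
have eU := dual_expand U d; move: s0 u eU; rewrite /slope.
set a := W^T *m J *m U; set b := V^T *m J *m U => s0 ua eU.
pose w := b *m invmx a *m delta_mx l (0 : 'I_1).
have w0 : w k 0 = 0 by rewrite /w -colE mxE s0.
pose v := U *m (invmx a *m delta_mx l (0 : 'I_1)).
have vV : v = col l V + W *m w.
  rewrite /v {1}eU mulmxDl -(mulmxA V) mulKVmx // -(mulmxA W) !mulmxA colE.
  by [].
have v0 : v = 0.
  apply/eqP; rewrite -memv0 -(htrans bx by_ bz xy yz xz) memv_cap -sU.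
  apply/andP; split; first by apply/mem_cspan; eexists.
  rewrite vV; apply: memv_add.
    by rewrite /fib -[in E p]lp vE memv_line.
  have WT : W *m w \in Thetab Eb y.
    rewrite -e2 (Thetab_cspan Tu ad); apply/mem_cspan.
    by exists w.
  rewrite memv_cap WT andbT; apply/mem_orth => v'.
  have -> : p.-1 = k.+1 by move: lp kl; lia.
  rewrite /fib vE => /vlineP[t ->]; rewrite bilZl.
  have -> : bil J (col k V) (W *m w) = (V^T *m J *m W *m w) k 0.
    rewrite -mulmxA bil_entries; congr (bil _ _ _).
    by apply/colP => i; rewrite !mxE.
  by rewrite VW mul1mx w0 mulr0.
have : W^T *m J *m v = delta_mx l 0.
  by rewrite /v mulmxA -/a mulKVmx.
rewrite v0 mulmx0 => /matrixP/(_ l 0); rewrite !mxE !eqxx => /esym/eqP.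
by rewrite oner_eq0.
Qed.

(** The last coefficient does not vanish, so that locally it bounds the others;
    the bound is invariant under Gamma and rescaling, hence uniform over all
    triples by cocompactness. The frame h stands for the triple of its end points
    and its third point. *)
Lemma slope_ratio_bounded (i j : 'I_p) r :
  weight Gamma rho frames (fun c => `|c 0 k * c 0 l| / `|c 0 i * c 0 j|) r ->
  exists C : R, forall h V W U, isomH2 h -> frames h V W -> Theta_basis (third h) U ->
    `|slope J V W U i j| * r h V W <= C * `|slope J V W U k l|.
Proof.
move=> w.
have it h : isomH2 h -> isomH2 (h *m turn).
  by move=> ih; apply: isomH2M => //; exact: isomH2_turn.
(* The frames slid along the two horocycles show that the third point differs
   from both end points. *)
have nz h V W U : isomH2 h -> frames h V W -> Theta_basis (third h) U ->
    W^T *m J *m U \in unitmx /\ slope J V W U k l != 0.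
  move=> ih fr bU; have Tu := base_T1H2 ih; have Tt := base_T1H2 (it _ ih).
  have ih1 : isomH2 (h *m horo 1) by apply: isomH2M => //; exact: isomH2_horo.
  have T1 := base_T1H2 ih1.
  have [b1 b2 b3] := T1H2_bdry Tu.
  have [b4 b5 b6] := T1H2_bdry T1; rewrite bwd_horo fwd_horo1 in b4 b5 b6.
  have ihr : isomH2 (h *m refl) by apply: isomH2M => //; exact: isomH2_refl.
  have ihr1 : isomH2 (h *m refl *m horo 1) by apply: isomH2M => //; exact: isomH2_horo.
  have [c4 c5 c6] := T1H2_bdry (base_T1H2 ihr1).
  rewrite bwd_horo fwd_horo1 third_refl bwd_refl in c4 c5 c6.
  by apply: (slope_neq0 b1 b2 b5) => //; apply/(adapted_geod_pt _ _ Tu).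
pose P (C : R) h := forall V W U X, frames h V W -> frames (h *m turn) U X ->
    `|slope J V W U i j| * r h V W <= C * `|slope J V W U k l|.
suff : \forall C \near pinfty_nbhs R, forall h, isomH2 h -> P C h.
  move=> [M [_ MP]]; exists (M + 1) => h V W U ih fr bU.
  have lt : M < M + 1 by rewrite ltrDl.
  have ith := it _ ih; have [U' [X aU']] := adapted_ex (base_T1H2 ith).
  have bU' := Theta_basis_adapted (base_T1H2 ith) aU'.
  rewrite bwd_turn in bU'; have [g ug Ug] := Theta_basis_eq bU bU'.
  have [ux _] := nz h V W U' ih fr bU'.
  by rewrite Ug !slope_mulr //; exact: (MP _ lt h ih V W U' X fr aU').
apply: (cocompact_near hGamma) => [C g h Gg ih Pg V W U X fr fr'|h0 ih0].
  have := Pg _ _ _ _ (fs_equiv frames_system Gg ih fr); rewrite -mulmxA.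
  move=> /(_ _ _ (fs_equiv frames_system Gg (it _ ih) fr')).
  by rewrite !(slope_rho hrho) // (w_equiv w).
pose G0 : set_system ('M[R]_3 * R) := filter_prod (nbhs h0) (pinfty_nbhs R).
have FG0 : Filter G0 by exact: filter_prod_filter.
pose G := within [set x | isomH2 x.1] G0.
have FG : Filter G by exact: within_filter.
have cG A : G0 A -> G A by apply: filterS.
have c1 : (fun x : 'M[R]_3 * R => x.1) @ G --> h0.
  by move=> A hA; apply: cG; exact: (cvg_fst hA).
have c3 : (fun x : 'M[R]_3 * R => x.2) @ G --> pinfty_nbhs R.
  by move=> A hA; apply: cG; exact: (cvg_snd hA).
have ct : (fun x : 'M[R]_3 * R => x.1 *m turn) @ G --> h0 *m turn.
  exact: (cvg_mulmx c1 (cvg_cst turn)).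
have i1 : \forall x \near G, isomH2 x.1 by exact: withinT.
have i2 : \forall x \near G, isomH2 (x.1 *m turn) by apply: filterS i1 => x; exact: it.
have [V [W [V0 [W0 [fr0 VV0 WW0 frV]]]]] := fs_local frames_system FG ih0 c1 i1.
have [U [X [U0 [X0 [frU0 UU0 _ frU]]]]] := fs_local frames_system FG (it _ ih0) ct i2.
have bU0 := Theta_basis_adapted (base_T1H2 (it _ ih0)) frU0; rewrite bwd_turn in bU0.
have [u0 s0] := nz _ _ _ _ ih0 fr0 bU0.
have cS : (fun x => slope J (V x) (W x) (U x)) @ G --> slope J V0 W0 U0 by exact: cvg_slope.
have ckl : (fun x => slope J (V x) (W x) (U x) k l) @ G --> slope J V0 W0 U0 k l.
  exact: cvg_mx_entry.
have cij : (fun x => slope J (V x) (W x) (U x) i j) @ G --> slope J V0 W0 U0 i j.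
  exact: cvg_mx_entry.
have cq : (fun x => `|slope J (V x) (W x) (U x) i j| * r x.1 (V x) (W x) /
      `|slope J (V x) (W x) (U x) k l|) @ G -->
    `|slope J V0 W0 U0 i j| * r h0 V0 W0 / `|slope J V0 W0 U0 k l|.
  apply: cvgM; first by apply: cvgM; [exact: cvg_norm|exact: (w_cont w)].
  by apply: cvgV; [rewrite normr_eq0|exact: cvg_norm].
set q0 := _ / _ in cq.
have b1 : \forall x \near G, `|slope J (V x) (W x) (U x) i j| * r x.1 (V x) (W x) /
      `|slope J (V x) (W x) (U x) k l| < q0 + 1.
  by apply: (cvgr_lt _ cq); rewrite ltrDl.
have b2 : \forall x \near G, q0 + 1 < x.2.
  by apply: (c3 (fun y : R => q0 + 1 < y)); exists (q0 + 1); split; rewrite ?num_real.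
have H : \forall x \near G, P x.2 x.1.
  near=> x => V' W' U' X' fr fr'.
  have ix : isomH2 x.1 by near: x.
  have frx : frames x.1 (V x) (W x) by near: x.
  have frU' : frames (x.1 *m turn) (U x) (X x) by near: x.
  have bU := Theta_basis_adapted (base_T1H2 (it _ ix)) frU'; rewrite bwd_turn in bU.
  have [ux sx] := nz _ _ _ _ ix frx bU.
  have [c [c0 -> ->]] := fs_scale frames_system ix frx fr.
  have [d [d0 -> _]] := fs_scale frames_system (it _ ix) frU' fr'.
  have ud := diag_unit d0.
  have sx0 : 0 < `|slope J (V x) (W x) (U x) k l| by rewrite normr_gt0.
  rewrite !slope_scale // (w_scale w) // !normrM.
  have nc a : `|c 0 a| != 0 by rewrite normr_eq0.
  have -> : `|c 0 i| * `|c 0 j| * `|slope J (V x) (W x) (U x) i j| *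
      (`|c 0 k| * `|c 0 l| / (`|c 0 i| * `|c 0 j|) * r x.1 (V x) (W x)) =
      (`|c 0 k| * `|c 0 l|) * (`|slope J (V x) (W x) (U x) i j| * r x.1 (V x) (W x)).
    by field; rewrite !nc.
  rewrite [leRHS]mulrCA ler_wpM2l ?mulr_ge0 // -ler_pdivrMr //.
  by apply: ltW; apply: lt_trans (_ : q0 + 1 < _); near: x.
have [[A A'] /= [hA hB] AB] : G0 [set x | isomH2 x.1 -> P x.2 x.1] by exact: H.
by exists (A, A') => //= -[a b] /= [Aa Bb]; exact: (AB (a, b)).
Unshelve. all: by end_near. Qed.

(** As the third point comes close to the backward end point, its projection
    flies backwards along the geodesic and the last coefficient dominates. The
    quotient of Lorentz products measures the position of the projection. *)
Lemma slope_ratio_small (i j : 'I_p) r (e : R) :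
  weight Gamma rho frames (fun c => `|c 0 k * c 0 l| / `|c 0 i * c 0 j|) r -> 0 < e ->
  exists2 d : R, 0 < d & forall h V W U z, isomH2 h -> frames h V W -> bdry z ->
    z <> backward_end (base h) -> z <> forward_end (base h) -> Theta_basis z U ->
    B (col 0 h - col 1 h) z / B (col 0 h + col 1 h) z < d ->
    `|slope J V W U i j| * r h V W <= e * `|slope J V W U k l|.
Proof.
move=> w e0; have [C HC] := slope_ratio_bounded w.
have [a [b [a0 b0 ex]]] := weight_expand frames_system w.
pose C' := `|C| + 1.
have C'0 : 0 < C' by rewrite /C' ltr_wpDl.
have CC' : C <= C' by rewrite /C'; have := ler_norm C; lra.
pose t0 := `|ln (e / (a * C')) / b|.
exists (expR (- (2 * (t0 + 1)))); first exact: expR_gt0.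
move=> h V W U z ih fr bz zx zy bU lt.
have Tu := base_T1H2 ih; have [b1 b2 b3] := T1H2_bdry Tu.
have [h' [ih' e1 e2 e3 e4]] := frame_of_triple b1 b2 bz b3 (nesym zy) (nesym zx).
set x := backward_end (base h) in b1 b3 zx e1 e4 *.
set y := forward_end (base h) in b2 b3 zy e2 e4 *.
have [Tg _ _] := geod_ptP b1 b2 b3.
have [m im bm] := base_surj Tg.
have [_ _ h3 h4 _] := T1H2_ends Tu.
set t1 := ln (B x z / B y z) / 2 in e4.
have := T1H2_geoflow Tu; rewrite -/x -/y -bm -base_boost; set t2 := _ / 2 => E2.
rewrite -bm -base_boost in e4.
have bxz := bdry_neg b1 bz (nesym zx); have byz := bdry_neg b2 bz (nesym zy).
have xE : col 0 h - col 1 h = (col 0 h - col 1 h) 0 0 *: x.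
  by rewrite /x /backward_end scalerA mulfV ?gt_eqF // scale1r.
have yE : col 0 h + col 1 h = (col 0 h + col 1 h) 0 0 *: y.
  by rewrite /y /forward_end scalerA mulfV ?gt_eqF // scale1r.
clearbody x y; move: lt; rewrite xE yE !bilZl.
rewrite /base /= in h3 h4.
move: h3 h4 @t2 E2; set q := (col 0 h - col 1 h) 0 0; set f := (col 0 h + col 1 h) 0 0.
move=> q0 f0 t2 E2 lt.
have tt : t1 - t2 < - (t0 + 1).
  have -> : t1 - t2 = ln (q * B x z / (f * B y z)) / 2.
    have pa : 0 < B x z / B y z by rewrite -mulrNN mulr_gt0 ?oppr_gt0 ?invr_lt0.
    have pb : 0 < f / q by rewrite divr_gt0.
    rewrite /t1 /t2 -mulrBl -ln_div ?posrE //.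
    have nyz : B y z != 0 by rewrite lt_eqF.
    by congr (ln _ / _); field; rewrite (lt0r_neq0 f0) (lt0r_neq0 q0) nyz.
  have pos : 0 < q * B x z / (f * B y z).
    by rewrite -mulrNN mulr_gt0 ?oppr_gt0 ?invr_lt0 ?pmulr_rlt0.
  rewrite ltr_pdivrMr // -ltr_expR lnK ?posrE //.
  by have -> : - (t0 + 1) * 2 = - (2 * (t0 + 1)) by ring.
have t00 : 0 <= t0 by rewrite normr_ge0.
pose t := t2 - t1; have tp : 0 < t by rewrite /t; lra.
have im2 : isomH2 (m *m boost t2) by apply: isomH2M => //; exact: isomH2_boost.
have frm2 : frames (m *m boost t2) V W by rewrite /frames -E2.
have frh' : frames h' V W.
  have frm : frames m V W by apply/(fs_flow frames_system t2).
  by rewrite /frames e4; apply/(fs_flow frames_system t1).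
have := HC h' V W U ih' frh'; rewrite e3 => /(_ bU) le.
have := ex t _ _ _ tp im2 frm2.
rewrite -mulmxA boostD (_ : t2 - t = t1); last by rewrite /t; ring.
rewrite -(w_base w V W E2) -(w_base w V W e4).
have r0 := w_pos w ih fr; move: r0 le.
set D := `|slope _ _ _ _ i j|; set D' := `|slope _ _ _ _ k l|; set r1 := r h _ _.
set r2 := r h' _ _; move=> r0 le le2.
have D0 : 0 <= D by exact: normr_ge0.
have D'0 : 0 <= D' by exact: normr_ge0.
have eb : a * C' <= e * expR (b * t).
  pose X := e / (a * C'); have X0 : 0 < X by rewrite divr_gt0 ?mulr_gt0.
  have lX : - ln X <= b * t.
    have h1 : - (ln X / b) <= t0 by rewrite /t0 -normrN ler_norm.
    have h2 : b * - (ln X / b) <= b * t by rewrite ler_pM2l // /t; lra.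
    by move: h2; rewrite mulrN mulrCA mulfV ?mulr1 // gt_eqF.
  have : X^-1 <= expR (b * t) by rewrite -[X in X^-1]lnK ?posrE // -expRN ler_expR.
  by rewrite /X invf_div ler_pdivrMr // [e * _]mulrC.
have h5 : D * r1 * expR (b * t) <= a * C' * D'.
  have := ler_wpM2l D0 le2; have := ler_wpM2l (ltW a0) le.
  have := ler_wpM2r D'0 (ler_wpM2l (ltW a0) CC').
  move: (expR (b * t)) => ee; lra.
have := ler_wpM2r D'0 eb; have := expR_gt0 (b * t); move: (expR (b * t)) h5 {eb} => ee.
move=> h5 ee0 h6; rewrite -(ler_pM2r ee0); lra.
Qed.

(** If Theta x = Theta z, its slope over Theta x vanishes, while transversality
    for a third point w gives it a nonzero coefficient. *)
Lemma Theta_inj (x z : 'cV[R]_3) : bdry x -> bdry z -> Theta E x = Theta E z -> x = z.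
Proof.
move=> bx bz eq; apply: contrapT => xz.
have [Tu e1 e2] := geod_ptP bx bz xz.
have [h ih bh] := base_surj Tu.
have ih1 : isomH2 (h *m horo 1) by apply: isomH2M => //; exact: isomH2_horo.
have ihr : isomH2 (h *m refl) by apply: isomH2M => //; exact: isomH2_refl.
have ihr1 : isomH2 (h *m refl *m horo 1) by apply: isomH2M => //; exact: isomH2_horo.
have [_ b5 b6] := T1H2_bdry (base_T1H2 ih1); rewrite bwd_horo fwd_horo1 bh e1 in b5 b6.
have [_ _ c6] := T1H2_bdry (base_T1H2 ihr1).
rewrite bwd_horo fwd_horo1 third_refl bwd_refl bh e2 in c6.
have [Tw f1 f2] := geod_ptP bx b5 b6.
have [V [W ad]] := adapted_ex Tw.
have bV := Theta_basis_adapted Tw ad; rewrite f1 in bV.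
have bV' : Theta_basis z V by case: bV => s X; split => //; rewrite s.
have [u] := slope_neq0 bx b5 bz b6 (nesym c6) xz ad bV'.
have [_ _ VV _] := adapted_iso Tw ad.
by rewrite /slope VV mul0mx mxE eqxx.
Qed.

(** * The limit curve in a chart *)

Variables (h0 : 'M[R]_3) (V0 W0 : vect).
Hypothesis ih0 : isomH2 h0.
Hypothesis fr0 : frames h0 V0 W0.
Local Notation slide := (slide h0).
Local Notation stereo := (stereo h0).

Lemma frame_transverse h (V W U : vect) z : isomH2 h -> frames h V W -> bdry z ->
  z <> forward_end (base h) -> Theta_basis z U -> W^T *m J *m U \in unitmx.
Proof.
move=> ih fr bz zy [sU XU]; have Tu := base_T1H2 ih.
have [b1 b2 b3] := T1H2_bdry Tu.
apply: (transverse_Theta b1 b2 bz b3 zy _ sU XU).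
by apply/(adapted_geod_pt _ _ Tu); exact: fr.
Qed.

Lemma frame_basis h (V W : vect) : isomH2 h -> frames h V W -> Theta_basis (backward_end (base h)) V.
Proof. by move=> ih fr; exact: (Theta_basis_adapted (base_T1H2 ih) fr). Qed.

Lemma slide_frame_ex s : exists VW : vect * vect, frames (slide s) VW.1 VW.2.
Proof.
have [V [W ad]] := adapted_ex (base_T1H2 (isomH2_slide ih0 s)).
by exists (V, W).
Qed.

Definition slideV s : vect := (projT1 (cid (slide_frame_ex s))).1.
Definition slideW s : vect := (projT1 (cid (slide_frame_ex s))).2.

Lemma slide_frame s : frames (slide s) (slideV s) (slideW s).
Proof. by rewrite /slideV /slideW; case: cid. Qed.

Definition curve s : 'M[R]_(p + p) := chartmx J V0 W0 (slideV s).

(** The coordinate of a chart value on the last two vectors; the limit curve is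
    parametrised by it. *)
Definition lcoef (F : 'M[R]_(p + p)) : R := (V0^T *m J *m F *m V0) k l.

Lemma klN : (k == l) = false.
Proof. by rewrite -val_eqE /= -kl; lia. Qed.

Lemma lcoefB F G : lcoef (F - G) = lcoef F - lcoef G.
Proof. by rewrite /lcoef mulmxBr mulmxBl !mxE. Qed.

Lemma lcoefZ a F : lcoef (a *: F) = a * lcoef F.
Proof. by rewrite /lcoef -scalemxAr -scalemxAl mxE. Qed.

Lemma lcoef0 : lcoef 0 = 0.
Proof. by rewrite -(scale0r 0) lcoefZ mul0r. Qed.

Lemma cvg_lcoef (T : Type) (Fl : set_system T) (FF : Filter Fl) (f : T -> 'M[R]_(p + p)) G :
  f @ Fl --> G -> lcoef (f x) @[x --> Fl] --> lcoef G.
Proof.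
move=> fG; apply: cvg_mx_entry.
exact: (cvg_mulmx (cvg_mulmx (cvg_cst _) fG) (cvg_cst V0)).
Qed.

Lemma lcoef_cont : continuous lcoef.
Proof.
move=> F; have FF : Filter (nbhs F) by exact: nbhs_filter.
exact: (cvg_lcoef FF cvg_id).
Qed.

Let d0 : dual_bases J V0 W0 := fs_iso frames_system ih0 fr0.

Lemma W0_transverse s U : Theta_basis (stereo s) U -> W0^T *m J *m U \in unitmx.
Proof.
have [b1 b2 b3] := stereo_bdry ih0 s.
exact: (frame_transverse ih0 fr0 b1 b3).
Qed.

Lemma curve_basis s U : Theta_basis (stereo s) U -> curve s = chartmx J V0 W0 U.
Proof.
move=> bU; have bV := frame_basis (isomH2_slide ih0 s) (slide_frame s).
have [g ug ->] := Theta_basis_eq bU bV.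
by rewrite chartmx_mulr //; exact: W0_transverse bV.
Qed.

Lemma curve_diff s s' (V W U : vect) : frames (slide s) V W -> Theta_basis (stereo s') U ->
  curve s' - curve s = chartmx J V W U.
Proof.
move=> fr bU; have ih := isomH2_slide ih0 s.
have d := fs_iso frames_system ih fr; have [_ VW _ _] := d.
have bV := frame_basis ih fr.
have [b1 b2 b3] := stereo_bdry ih0 s'.
have u' : W^T *m J *m U \in unitmx.
  by apply: (frame_transverse ih fr b1 _ bU); rewrite fwd_slide.
have sy := Thetab_cspan (base_T1H2 ih) fr.
have sy0 := Thetab_cspan (base_T1H2 ih0) fr0.
rewrite fwd_slide sy0 in sy.
have [m um Wm] := cspan_eq_unit (esym sy) VW.
rewrite (curve_basis bU) (curve_basis bV).
have -> := chartmx_cocycle d0 d Wm (W0_transverse bV) u'.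
by rewrite addrAC subrr add0r.
Qed.

Lemma curve0 : curve 0 = 0.
Proof.
have [_ _ VV _] := d0.
rewrite (@curve_basis 0 V0); last by rewrite stereo0; exact: frame_basis fr0.
by rewrite /chartmx /slope VV mul0mx mulmx0 mul0mx.
Qed.

Lemma curve_cont s : {for s, continuous curve}.
Proof.
have FF : Filter (nbhs s) by exact: nbhs_filter.
have ih := isomH2_slide ih0.
have [|V [W [V' [W' [fr VV' WW' frs]]]]] := fs_local frames_system FF (ih s) (@slide_cont _ h0 s).
  by near=> s'; exact: ih.
have bV' := frame_basis (ih s) fr.
rewrite /prop_for /continuous_at (curve_basis bV').
have e : \forall s' \near s, chartmx J V0 W0 (V s') = curve s'.
  by apply: filterS frs => s' fr'; rewrite (curve_basis (frame_basis (ih s') fr')).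
apply: cvg_trans (near_eq_cvg e) _.
have cS : slope J V0 W0 (V x) @[x --> nbhs s] --> slope J V0 W0 V'.
  exact: (cvg_slope FF (cvg_cst V0) (cvg_cst W0) VV' (W0_transverse bV')).
exact: (cvg_mulmx (cvg_mulmx (cvg_cst W0) cS) (cvg_cst (W0^T *m J))).
Unshelve. all: by end_near. Qed.

Lemma dirmx_scale (W : vect) c :
  dirmx J k l (W *m diag_mx c) = (c 0 k * c 0 l) *: dirmx J k l W.
Proof.
rewrite /dirmx trmx_mul tr_diag_mx.
have -> : W *m diag_mx c *m last2 R k l *m (diag_mx c *m W^T *m J) =
   W *m (diag_mx c *m last2 R k l *m diag_mx c) *m (W^T *m J) by rewrite !mulmxA.
have -> : diag_mx c *m last2 R k l *m diag_mx c = (c 0 k * c 0 l) *: (last2 R k l).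
  rewrite mul_mx_diag mul_diag_mx; apply/matrixP => i j; rewrite !mxE.
  case: (boolP ((i == k) && (j == l))) => [/andP[/eqP -> /eqP ->]|_].
    by rewrite klN /=; ring.
  by case: (boolP ((i == l) && (j == k))) => [/andP[/eqP -> /eqP ->]|_] /=; ring.
by rewrite -scalemxAr -scalemxAl.
Qed.

Lemma lcoef_dirmx0 : lcoef (dirmx J k l W0) = 1.
Proof.
have [D D' _ _] := d0.
rewrite /lcoef /dirmx !mulmxA D' mul1mx -!mulmxA (mulmxA W0^T) D mulmx1 !mxE !eqxx klN /=.
by rewrite subr0.
Qed.

(** The expected tangent vector of the curve, normalised by its last coordinate
    and thereby independent of the choice of the frame (curve_dirE). *)
Definition curve_dir s := (lcoef (dirmx J k l (slideW s)))^-1 *: dirmx J k l (slideW s).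

Lemma curve_dirE s (V W : vect) : frames (slide s) V W ->
  lcoef (dirmx J k l W) != 0 -> lcoef (dirmx J k l (slideW s)) != 0 /\
  curve_dir s = (lcoef (dirmx J k l W))^-1 *: dirmx J k l W.
Proof.
move=> fr n0; have [c [c0 _ WE]] := fs_scale frames_system (isomH2_slide ih0 s) fr (slide_frame s).
rewrite /curve_dir WE dirmx_scale lcoefZ.
have cc : row_inv c 0 k * row_inv c 0 l != 0 by rewrite !mxE mulf_neq0 // invr_eq0.
split; first by rewrite mulf_neq0.
by rewrite scalerA invfM mulrAC mulVf // mul1r.
Qed.

(** The normalisation makes sense near the base point, where the last coordinate
    of the expected direction is 1. *)
Lemma curve_dir_near : \forall s \near (0 : R), lcoef (dirmx J k l (slideW s)) != 0.
Proof.
have FF : Filter (nbhs (0 : R)) by exact: nbhs_filter.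
have ih := isomH2_slide ih0.
have [|V [W [V' [W' [fr VV' WW' frs]]]]] := fs_local frames_system FF (ih 0) (@slide_cont _ h0 0).
  by near=> s'; exact: ih.
have frs0 : frames (slide 0) V0 W0 by rewrite slide0.
have [c [c0 _ W'E]] := fs_scale frames_system (ih 0) frs0 fr.
have n0 : lcoef (dirmx J k l W') != 0.
  by rewrite W'E dirmx_scale lcoefZ lcoef_dirmx0 mulr1 !mxE mulf_neq0 // invr_eq0.
have cd : lcoef (dirmx J k l (W s)) @[s --> nbhs (0 : R)] --> lcoef (dirmx J k l W').
  apply: cvg_lcoef.
  exact: (cvg_mulmx (cvg_mulmx WW' (cvg_cst (last2 R k l))) (cvg_mulmx (cvg_trmx WW') (cvg_cst J))).
have nz : \forall s \near (0 : R), lcoef (dirmx J k l (W s)) != 0 by exact: cvgr_neq0 cd n0.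
by apply: filterS2 frs nz => s frs' /(curve_dirE frs')[].
Unshelve. all: by end_near. Qed.

(** A chord is the slope of its second end over the frame of the first one
    (curve_diff). When both ends converge to s1, its coefficients other than the
    last one become negligible by slope_ratio_small: the weights converge along
    the frames, and the quotient of Lorentz products tends to 0. *)
Lemma curve_slope s1 : lcoef (dirmx J k l (slideW s1)) != 0 ->
  strict_slope lcoef curve s1 (curve_dir s1).
Proof.
move=> n1 e e0.
have ih := isomH2_slide ih0.
pose N : set_system (R * R) := filter_prod (nbhs s1) (nbhs s1).
have FN : Filter N by exact: filter_prod_filter.
pose G := within [set x : R * R | x.1 != x.2] N.
have FG : Filter G by exact: within_filter.
have NG A : N A -> G A by apply: filterS.
have c1 : (fun x : R * R => x.1) @ G --> s1 by move=> A hA; apply: NG; exact: (cvg_fst hA).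
have c2 : (fun x : R * R => x.2) @ G --> s1 by move=> A hA; apply: NG; exact: (cvg_snd hA).
have cs1 : (fun x : R * R => slide x.1) @ G --> slide s1.
  by move=> A /(@slide_cont _ h0 s1) hA; exact: (c1 _ hA).
have cs2 : (fun x : R * R => slide x.2) @ G --> slide s1.
  by move=> A /(@slide_cont _ h0 s1) hA; exact: (c2 _ hA).
have i1 : \forall x \near G, isomH2 (slide x.1) by near=> x; exact: ih.
have neq : \forall x \near G, x.1 != x.2 by exact: withinT.
have [V [W [V' [W' [fr VV' WW' frs]]]]] := fs_local frames_system FG (ih s1) cs1 i1.
have [n' dE] : lcoef (dirmx J k l W') != 0 /\ curve_dir s1 = (lcoef (dirmx J k l W'))^-1 *: dirmx J k l W'.
  have [c [c0 _ WE]] := fs_scale frames_system (ih s1) (slide_frame s1) fr.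
  have n' : lcoef (dirmx J k l W') != 0.
    rewrite WE dirmx_scale lcoefZ mulf_neq0 // !mxE mulf_neq0 // invr_eq0 //.
  by split => //; have [] := curve_dirE fr n'.
pose D (x : R * R) := slope J (V x) (W x) (slideV x.2).
have bas s : Theta_basis (stereo s) (slideV s) := frame_basis (ih s) (slide_frame s).
have Dfacts : \forall x \near G, D x k l != 0 /\ (D x)^T = - D x.
  apply: filterS2 frs neq => x frx nx.
  have [b1 b2 b3] := stereo_bdry ih0 x.1; have [b4 _ b5] := stereo_bdry ih0 x.2.
  have nst : stereo x.1 <> stereo x.2 by move/(stereo_inj ih0)/eqP; apply/negP.
  have Tu := base_T1H2 (ih x.1).
  have ad : adapted (geod_pt (stereo x.1) (forward_end (base h0))) (V x) (W x).
    by rewrite -(fwd_slide h0 x.1); apply/(adapted_geod_pt _ _ Tu).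
  have [u n] := slope_neq0 b1 b2 b4 b3 (nesym b5) nst ad (bas x.2).
  split => //; apply: (slope_antisym (fs_iso frames_system (ih x.1) frx)) u.
  exact: (Theta_basis_iso b4 (bas x.2)).
have rat : (fun x => B (col 0 (slide x.1) - col 1 (slide x.1)) (stereo x.2) /
      B (col 0 (slide x.1) + col 1 (slide x.1)) (stereo x.2)) @ G --> (0 : R).
  have st : (fun x : R * R => stereo x.2) @ G --> stereo s1.
    have cm : (fun x : R * R => col 0 (slide x.2) - col 1 (slide x.2)) @ G --> col 0 (slide s1) - col 1 (slide s1).
      by apply: cvgB; exact: cvg_col.
    apply: (cvgZ _ cm); apply: cvgV; last exact: (cvg_mx_entry cm).
    have [_ _ q0 _ _] := T1H2_ends (base_T1H2 (ih s1)).
    by rewrite gt_eqF.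
  have cm : (fun x : R * R => col 0 (slide x.1) - col 1 (slide x.1)) @ G --> col 0 (slide s1) - col 1 (slide s1).
    by apply: cvgB; exact: cvg_col.
  have cp : (fun x : R * R => col 0 (slide x.1) + col 1 (slide x.1)) @ G --> col 0 (slide s1) + col 1 (slide s1).
    by apply: cvgD; exact: cvg_col.
  have cB (f g : R * R -> 'cV[R]_3) v w : f @ G --> v -> g @ G --> w -> B (f x) (g x) @[x --> G] --> B v w.
    by move=> fv gw; apply: cvg_mx_entry; exact: (cvg_mulmx (cvg_mulmx (cvg_trmx fv) (cvg_cst _)) gw).
  have [q1 _ q0 f0 q2] := T1H2_ends (base_T1H2 (ih s1)).
  have z0 : B (col 0 (slide s1) - col 1 (slide s1)) (stereo s1) = 0 by rewrite bilZr q1 mulr0.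
  have zn : B (col 0 (slide s1) + col 1 (slide s1)) (stereo s1) != 0.
    by rewrite bilZr lorentzC q2 mulf_neq0 ?invr_neq0 ?(gt_eqF q0) //.
  rewrite -(mul0r (B (col 0 (slide s1) + col 1 (slide s1)) (stereo s1))^-1) -{1}z0.
  by apply: cvgM; [exact: cB|apply: cvgV => //; exact: cB].
(* The slope, normalised by its last coefficient; it converges to last2. *)
pose Nm x := (D x k l)^-1 *: D x.
have small (i j : 'I_p) : (i < j)%N -> (i < k)%N -> (fun x => Nm x i j) @ G --> (0 : R).
  move=> ij ik; have [r w] := weight_ratio lp kl ij ik.
  have cr : r (slide x.1) (V x) (W x) @[x --> G] --> r (slide s1) V' W' by exact: (w_cont w).
  have r0 := w_pos w (ih s1) fr.
  set r1 := r (slide s1) V' W' in cr r0.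
  have hr : \forall x \near G, r1 / 2 < r (slide x.1) (V x) (W x).
    by apply: (cvgr_gt _ cr); lra.
  apply/cvgr0Pnorm_le => et et0.
  have et1 : 0 < et * (r1 / 2) by rewrite mulr_gt0 // divr_gt0.
  have [dd dd0 Hd] := slope_ratio_small w et1.
  have hd : \forall x \near G, B (col 0 (slide x.1) - col 1 (slide x.1)) (stereo x.2) /
      B (col 0 (slide x.1) + col 1 (slide x.1)) (stereo x.2) < dd by exact: (cvgr_lt _ rat).
  near=> x.
  have frx : frames (slide x.1) (V x) (W x) by near: x.
  have [dn _] : D x k l != 0 /\ (D x)^T = - D x by near: x.
  have [b4 _ b5] := stereo_bdry ih0 x.2.
  have nst : stereo x.2 <> stereo x.1.
    by move/(stereo_inj ih0)/eqP; apply/negP; rewrite eq_sym; near: x.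
  have lt : r1 / 2 < r (slide x.1) (V x) (W x) by near: x.
  have := Hd _ _ _ _ _ (ih x.1) frx b4 nst; rewrite fwd_slide => /(_ _ b5 (bas x.2)) le.
  have {}le : `|D x i j| * r (slide x.1) (V x) (W x) <= et * (r1 / 2) * `|D x k l|.
    by apply: le; near: x.
  rewrite /Nm mxE normrM normfV ler_pdivrMl ?normr_gt0 //.
  have r20 : 0 < r1 / 2 by rewrite divr_gt0.
  rewrite -(ler_pM2r r20); apply: le_trans (_ : `|D x i j| * r (slide x.1) (V x) (W x) <= _).
    by rewrite ler_wpM2l // ltW.
  by have -> : `|D x k l| * et * (r1 / 2) = et * (r1 / 2) * `|D x k l| by ring.
have anti : \forall x \near G, forall i j, Nm x i j = - Nm x j i.
  apply: filterS Dfacts => x [_ aD] i j.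
  have sc a (M : 'M[R]_p) i2 j2 : (a *: M) i2 j2 = a * M i2 j2 by rewrite mxE.
  rewrite /Nm !sc -mulrN; congr (_ * _).
  by move/matrixP/(_ j i) : aD; rewrite [LHS]mxE [RHS]mxE.
have upper (i j : 'I_p) : (i < j)%N -> (fun x => Nm x i j) @ G --> last2 R k l i j.
  move=> ij; have jl : (j <= l)%N by rewrite -ltnS lp.
  case: (ltnP i k) => [ik|ki].
    have -> : last2 R k l i j = 0 by rewrite !mxE -!val_eqE /=; case: eqP; case: eqP; case: eqP; case: eqP => //=; rewrite ?subrr //; move: kl; lia.
    exact: small.
  have ei : i = k by apply: val_inj => /=; move: kl; lia.
  have ej : j = l by apply: val_inj => /=; move: kl; lia.
  have -> : last2 R k l i j = 1 by rewrite !mxE ei ej !eqxx klN /= subr0.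
  apply: cvg_trans (near_eq_cvg (_ : \forall x \near G, 1 = Nm x i j)) (cvg_cst _).
  by apply: filterS Dfacts => x [dn _]; rewrite ei ej /Nm mxE mulVf.
have cNm : Nm @ G --> (last2 R k l).
  apply: cvg_mx_entries => i j; case: (ltngtP i j) => [|ji|/val_inj <-]; first exact: upper.
    have -> : last2 R k l i j = - last2 R k l j i by rewrite !mxE opprB [(j == l) && _]andbC [(j == k) && _]andbC.
    apply: cvg_trans (near_eq_cvg (_ : \forall x \near G, - Nm x j i = Nm x i j)) _.
      by apply: filterS anti => x aN; rewrite [RHS]aN.
    by apply: cvgN; exact: upper.
  have -> : last2 R k l i i = 0 by rewrite !mxE andbC subrr.
  apply: cvg_trans (near_eq_cvg (_ : \forall x \near G, 0 = Nm x i i)) (cvg_cst _).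
  apply: filterS anti => x aN; have /eqP := aN i i.
  by rewrite -addr_eq0 -mulr2n mulrn_eq0 /= => /eqP ->.
have cA : (fun x => W x *m Nm x *m ((W x)^T *m J)) @ G --> dirmx J k l W'.
  exact: (cvg_mulmx (cvg_mulmx WW' cNm) (cvg_mulmx (cvg_trmx WW') (cvg_cst J))).
pose A x := W x *m Nm x *m ((W x)^T *m J).
have cphi := cvg_lcoef FG cA.
have cq : (fun x => (lcoef (A x))^-1 *: A x) @ G --> curve_dir s1.
  by rewrite dE; apply: cvgZ cA; apply: cvgV.
have hn : \forall x \near G, lcoef (A x) != 0 by exact: cvgr_neq0 cphi n'.
have hc : \forall x \near G, `|(lcoef (A x))^-1 *: A x - curve_dir s1| <= e.
  move/cvgrPdist_le : cq => /(_ e e0); apply: filterS => x; by rewrite distrC.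
have H : \forall x \near G, lcoef (curve x.2) != lcoef (curve x.1) /\
    `|curve x.2 - curve x.1 - (lcoef (curve x.2) - lcoef (curve x.1)) *: curve_dir s1|
       <= e * `|lcoef (curve x.2) - lcoef (curve x.1)|.
  near=> x.
  have frx : frames (slide x.1) (V x) (W x) by near: x.
  have [dn _] : D x k l != 0 /\ (D x)^T = - D x by near: x.
  have an : lcoef (A x) != 0 by near: x.
  have CE : curve x.2 - curve x.1 = D x k l *: A x.
    rewrite (curve_diff frx (bas x.2)) /chartmx /A /Nm -/(D x).
    by rewrite -scalemxAr -scalemxAl scalerA mulfV // scale1r.
  rewrite -lcoefB CE lcoefZ; split.
    by rewrite -subr_eq0 -lcoefB CE lcoefZ mulf_neq0.
  have -> : D x k l *: A x - (D x k l * lcoef (A x)) *: curve_dir s1 =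
      (D x k l * lcoef (A x)) *: ((lcoef (A x))^-1 *: A x - curve_dir s1).
    by move: an; move: (lcoef (A x)) (A x) (curve_dir s1) => b X Y b0; rewrite scalerBr scalerA mulfK.
  by rewrite normrZ mulrC ler_wpM2r //; near: x.
have [[A1 A2] /= [hA1 hA2] AB] : N [set x | x.1 != x.2 -> lcoef (curve x.2) != lcoef (curve x.1) /\
    `|curve x.2 - curve x.1 - (lcoef (curve x.2) - lcoef (curve x.1)) *: curve_dir s1|
       <= e * `|lcoef (curve x.2) - lcoef (curve x.1)|] by exact: H.
move: hA1 hA2 => /nbhs_ballP[r1 /= r10 B1] /nbhs_ballP[r2 /= r20 B2].
exists (Num.min r1 r2); first by rewrite lt_min r10.
move=> s s'; rewrite !lt_min => /andP[s1r _] /andP[_ s2r] ns.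
apply: (AB (s, s')) => //=; split.
  by apply: B1; rewrite /ball /= distrC.
by apply: B2; rewrite /ball /= distrC.
Unshelve. all: by end_near. Qed.

(** Since the circle is compact, it is enough to treat each z1 separately: away
    from the base point, Theta z1 differs from the base Lagrangian by injectivity,
    so that nearby points are not close to it. *)
Lemma Theta_proper (d : R) : 0 < d -> exists2 r : R, 0 < r &
  forall (F : 'M[R]_(p + p)) z, bdry z -> `|F| < r ->
    cspan ((1%:M + F) *m V0) = Theta E z ->
    z <> forward_end (base h0) /\ `|stereo_inv h0 z| < d.
Proof.
move=> dd0; set x0 := backward_end (base h0).
have Tu0 := base_T1H2 ih0.
have [bx0 _ _] := T1H2_bdry Tu0; rewrite -/x0 in bx0.
have bV0 := frame_basis ih0 fr0; rewrite -/x0 in bV0.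
pose N : set_system 'M[R]_(p + p) := nbhs (0 : 'M[R]_(p + p)).
have FN : Filter N by exact: nbhs_filter.
pose P (F : 'M[R]_(p + p)) z := bdry z -> cspan ((1%:M + F) *m V0) = Theta E z ->
    z <> forward_end (base h0) /\ `|stereo_inv h0 z| < d.
suff : \forall F \near N, @bdry R `<=` P F.
  move=> /nbhs_ballP[r /= r0 Hr]; exists r => // F z bz Fr_ e.
  by apply: (Hr F) => //; rewrite -ball_normE /ball_ /= sub0r normrN.
apply: ((compact_near_coveringP _).1 (@compact_bdry R) _ N P FN) => z1 bz1.
have FG0 : Filter (filter_prod (nbhs z1) N) by exact: filter_prod_filter.
have [->|zx] := pselect (z1 = x0).
  have := stereo_inv_near ih0 dd0; rewrite -/x0 => near1.
  exists ([set z | bdry z -> z <> forward_end (base h0) /\ `|stereo_inv h0 z| < d], setT).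
    by split => //; exact: filterT.
  by move=> [z F] /= [Hz _] bz _; exact: Hz.
pose G := within [set x : 'cV[R]_3 * 'M[R]_(p + p) | bdry x.1] (filter_prod (nbhs z1) N).
have FG : Filter G by exact: within_filter.
have NG A : filter_prod (nbhs z1) N A -> G A by apply: filterS.
have c1 : (fun x : 'cV[R]_3 * 'M[R]_(p + p) => x.1) @ G --> z1.
  by move=> A hA; apply: NG; exact: (cvg_fst hA).
have c2 : (fun x : 'cV[R]_3 * 'M[R]_(p + p) => x.2) @ G --> (0 : 'M[R]_(p + p)).
  by move=> A hA; apply: NG; exact: (cvg_snd hA).
(* geod_pt z (antipode z), written so that it is visibly continuous in z. *)
pose g (z : 'cV[R]_3) : 'cV[R]_3 * 'cV[R]_3 := (2^-1 *: (z + antipode z), 2^-1 *: (antipode z - z)).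
have gE z : bdry z -> g z = geod_pt z (antipode z).
  move=> [zz z0]; rewrite /geod_pt.
  have -> : - (2 * B z (antipode z)) = 2 ^+ 2.
    move: zz; rewrite !bil_lorentzE -/o2 !mxE /= o2_n0 z0 => zz; lra.
  by rewrite sqrtr_sqr gtr0_norm.
have gT z : bdry z -> T1H2 (g z) /\ backward_end (g z) = z.
  move=> bz; rewrite gE //; have [b1 b2] := antipode_bdry bz.
  by have [] := geod_ptP bz b1 b2.
have ca : (fun x : 'cV[R]_3 * 'M[R]_(p + p) => antipode x.1) @ G --> antipode z1.
  apply: cvg_mx_entries => i j; rewrite mxE; under eq_fun do rewrite mxE.
  by case: (i == 0); [|apply: cvgN]; exact: cvg_mx_entry.
have cg : (fun x : 'cV[R]_3 * 'M[R]_(p + p) => g x.1) @ G --> g z1.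
  exact: (cvg_pair (cvgZ (cvg_cst _) (cvgD c1 ca)) (cvgZ (cvg_cst _) (cvgB ca c1))).
have iG : \forall x \near G, bdry x.1 by exact: withinT.
have i1 : \forall x \near G, T1H2 (g x.1) by apply: filterS iG => x /gT[].
have [T1 e1] := gT _ bz1.
have [U [X [U1 [X1 [ad UU1 _ adx]]]]] := adapted_local FG T1 cg i1.
have d1 := adapted_iso T1 ad.
have bU1 := Theta_basis_adapted T1 ad; rewrite e1 in bU1.
have cM : (fun x => (U x)^T *m J *m ((1%:M + x.2) *m V0)) @ G --> U1^T *m J *m V0.
  have c3 : (fun x : 'cV[R]_3 * 'M[R]_(p + p) => 1%:M + x.2) @ G --> (1%:M : 'M[R]_(p + p)).
    by have := cvgD (cvg_cst (1%:M : 'M[R]_(p + p))) c2; rewrite addr0; apply.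
  have := cvg_mulmx (cvg_mulmx (cvg_trmx UU1) (cvg_cst J)) (cvg_mulmx c3 (cvg_cst V0)).
  by rewrite mul1mx; apply.
have n0 : U1^T *m J *m V0 != 0.
  apply/eqP => UV; apply: zx; apply: (Theta_inj bz1 bx0).
  by have [<- _] := bU1; have [<- _] := bV0; rewrite (dual_bases_span d1 d0 UV).
have H : \forall x \near G, P x.2 x.1.
  near=> x => bz e; exfalso.
  have adx' : adapted (g x.1) (U x) (X x) by near: x.
  have [Tx ex] := gT _ bz.
  have bU := Theta_basis_adapted Tx adx'; rewrite ex in bU.
  have nx : (U x)^T *m J *m ((1%:M + x.2) *m V0) != 0.
    by near: x; exact: cvgr_neq0 cM n0.
  move/eqP: nx; apply; apply/matrixP => i j; rewrite bil_entries mxE.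
  have iso := (isotropic_cspan J (U x)).2 (Theta_basis_iso bz bU).
  apply: iso; first exact: cspan_col.
  by have [-> _] := bU; rewrite -e; exact: cspan_col.
have [[A1 A2] /= [hA1 hA2] AB] : filter_prod (nbhs z1) N [set x | bdry x.1 -> P x.2 x.1] by exact: H.
by exists (A1, A2) => //= -[a b] /= [Aa Bb] bz; exact: (AB (a, b)).
Unshelve. all: by end_near. Qed.

(** * The limit curve is smooth *)

Local Notation M := (Theta E @` @bdry R).
Local Notation y := (forward_end (base h0)).
Local Notation stereo_inv := (stereo_inv h0).

Lemma curve_graph s : graph (cspan V0) (curve s) = Theta E (stereo s).
Proof.
have bV := frame_basis (isomH2_slide ih0 s) (slide_frame s).
have u := W0_transverse bV.
have [g ug e] := graph_chartmx d0 u.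
by rewrite /graph mximg_cspan e cspan_mulr //; case: bV.
Qed.

Lemma curve_dom s : chart_dom J (cspan W0) (curve s).
Proof.
have bV := frame_basis (isomH2_slide ih0 s) (slide_frame s).
have [b1 _ _] := stereo_bdry ih0 s.
apply: (chartmx_dom J_sym d0 (Theta_basis_iso b1 bV)).
exact: (W0_transverse bV).
Qed.

Lemma chart_curve F z : chart_dom J (cspan W0) F -> bdry z -> z <> y ->
  graph (cspan V0) F = Theta E z -> F = curve (stereo_inv z).
Proof.
move=> Fd bz zy; rewrite /graph mximg_cspan => e.
have [D _ _ WW] := d0.
have [FW WF] := chart_domP erefl WW Fd.
have X : W0^T *m J *m ((1%:M + F) *m V0) = 1%:M.
  by rewrite mulmxA mulmxDr mulmx1 WF addr0.
have bV := frame_basis (isomH2_slide ih0 (stereo_inv z)) (slide_frame _).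
have zE : backward_end (base (slide (stereo_inv z))) = z by exact: stereo_invK.
rewrite zE in bV; have [sV _] := bV.
have [g ug eg] := cspan_eq_unit (etrans e (esym sV)) X.
exact: (chart_unique d0 FW WF ug eg).
Qed.

(** The curve is parametrised by a^-1 times its last coordinate, so that its
    velocity at the base point is any given nonzero multiple of the direction. *)
Lemma C1_param (a : R) : a != 0 ->
  exists (e : R) (c : R -> 'M[R]_(p + p)) (O : set 'M[R]_(p + p)),
    let I := [set t : R | `|t| < e] in
    [/\ 0 < e /\ c 0 = 0, C1_near e c,
        forall t, I t -> velocity c t != 0,
        open O /\ c @` I =
          [set F | [/\ O F, chart_dom J (cspan W0) F & M (graph (cspan V0) F)]] &
        (forall t, I t -> a^-1 * lcoef (c t) = t) /\ velocity c 0 = a *: curve_dir 0].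
Proof.
move=> an.
have := curve_dir_near => /nbhs_ballP[d /= dd0 Hd].
pose phi F := a^-1 * lcoef F.
have phi_cont : continuous phi.
  move=> F; have FF : Filter (nbhs F) by exact: nbhs_filter.
  exact: (cvgM (cvg_cst a^-1) (@lcoef_cont F)).
have cc s : `|s| < d -> {for s, continuous curve}.
  by move=> _; exact: curve_cont.
have sl s : `|s| < d -> strict_slope phi curve s (a *: curve_dir s).
  move=> sd eps eps0.
  have nd := Hd s _; rewrite /ball /= sub0r normrN in nd.
  have epsa : 0 < eps / `|a| by rewrite divr_gt0 // normr_gt0.
  have [r r0 H] := curve_slope (nd sd) epsa.
  exists r => // s2 s' h1 h2 n; have [n' le] := H s2 s' h1 h2 n.
  rewrite /phi -mulrBr scalerA -mulrA (mulrC _ a) mulrA mulVf // mul1r.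
  split; last by rewrite normrM normfV mulrA.
  by apply: contra n' => /eqP/(mulfI (invr_neq0 an))/eqP.
have phi0 : phi 0 = 0.
  by rewrite /phi lcoef0 mulr0.
have cu0 : curve 0 = 0 by exact: curve0.
have [d' [e [sigma [/andP[d'0 d'd] e0 H1 H2 [H3 H4]]]]] :=
  strict_slope_param phi_cont dd0 cc sl cu0 phi0.
have sigma0 : sigma 0 = 0.
  have := H2 0; rewrite normr0 cu0 phi0 normr0; exact.
have [r r0 Hr] := Theta_proper d'0.
pose c := curve \o sigma.
have c0 : c 0 = 0 by rewrite /c /= sigma0.
have [e1 /= e10 He1] : exists2 e1 : R, 0 < e1 & forall t, `|t| < e1 -> `|c t| < r.
  have cc0 : c @ nbhs (0 : R) --> c 0.
    apply: cvg_mx_entries => i j; have [dr _] := H3 i j.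
    have : derivable (fun s => c s i j) 0 1 by apply: dr; rewrite normr0.
    by move/derivable1_diffP/differentiable_continuous.
  have /nbhs_ballP[e1 /= e10 He1] : \forall t \near (0 : R), `|c t| < r.
    by have /cvgr_norm_lt := cc0; rewrite c0 normr0; apply.
  by exists e1 => // t te; apply: He1; rewrite /ball /= sub0r normrN.
(* Below e the curve is controlled by its parameter; below e1 it stays in the
   ball where properness recovers the parameter from the point. *)
pose e2 := Num.min e e1.
have e20 : 0 < e2 by rewrite lt_min e0.
have lt2 (t : R) : `|t| < e2 -> `|t| < e /\ `|t| < e1 by rewrite lt_min => /andP[].
have dirn s : `|s| < d -> a *: curve_dir s != 0.
  move=> sd; have nd := Hd s; rewrite /ball /= sub0r normrN in nd.
  rewrite scaler_eq0 negb_or an /=.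
  apply/eqP => cd; have : lcoef (curve_dir s) = 1.
    by rewrite /curve_dir lcoefZ mulVf // nd.
  by rewrite cd lcoef0 => /esym/eqP; rewrite oner_eq0.
exists e2, c, ([set F | `|phi F| < e2] `&` [set F | `|F| < r]); split.
- by [].
- by move=> i j; have [h1 h2] := H3 i j; split=> t /lt2[te _]; [exact: h1|exact: h2].
- move=> t /lt2[te _]; rewrite H4 //; apply: dirn; apply: lt_le_trans d'd.
  by have [] := H1 t te.
- split.
    apply: openI.
      apply: (@open_comp _ _ (fun F => `|phi F|) [set u | u < e2]); last exact: open_lt.
      by move=> F _; exact: (cvg_norm (phi_cont F)).
    apply: (@open_comp _ _ (fun F : 'M[R]_(p + p) => `|F|) [set u | u < r]); last exact: open_lt.
    by move=> F _; exact: norm_continuous.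
  rewrite eqEsubset; split=> [_ [t /lt2[te te1] <-]|F [[pF rF] Fd [z bz zF]]].
    have [_ pt] := H1 t te; split.
    + split; last exact: He1.
      by rewrite /= /c /= pt lt_min te.
    + exact: curve_dom.
    + rewrite /c /= curve_graph; exists (stereo (sigma t)) => //.
      by have [] := stereo_bdry ih0 (sigma t).
  have zF' : cspan ((1%:M + F) *m V0) = Theta E z by rewrite zF /graph mximg_cspan.
  have [zy sd] := Hr F z bz rF zF'.
  have FE := chart_curve Fd bz zy (esym zF).
  have [pe _] := lt2 _ pF.
  exists (phi F); first exact: pF.
  by rewrite /c /= {1}FE H2 // -FE.
split; last by rewrite H4 ?normr0 // sigma0.
by move=> t /lt2[te _]; have [] := H1 t te.
Qed.

Lemma chart_dom0 : chart_dom J (cspan W0) 0.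
Proof. by rewrite -curve0; exact: curve_dom. Qed.

(** The chords of a curve drawn on the limit curve are chords of the limit curve,
    which are almost parallel to its direction. *)
Lemma tangent_velocity (e : R) (c : R -> 'M[R]_(p + p)) : 0 < e -> c 0 = 0 ->
  C1_near e c ->
  (forall t, `|t| < e -> chart_dom J (cspan W0) (c t) /\ M (graph (cspan V0) (c t))) ->
  velocity c 0 = lcoef (velocity c 0) *: curve_dir 0.
Proof.
move=> e0 c0 C1 cM.
have n0 : lcoef (dirmx J k l (slideW 0)) != 0.
  by have := curve_dir_near => /nbhs_singleton.
have sl := curve_slope n0.
have cu0 : curve 0 = 0 by exact: curve0.
set v := velocity c 0.
pose Q t := t^-1 *: c t.
have FD : Filter ((0 : R)^') by exact: dnbhs_filter.
have cQ : Q @ (0 : R)^' --> v.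
  apply: cvg_mx_entries => i j; rewrite !mxE derive1E.
  have [dr _] := C1 i j.
  have dv : derivable (fun s => c s i j) 0 1 by apply: dr; rewrite normr0.
  apply: cvg_trans _ dv; apply: near_eq_cvg; apply: nearW => t /=.
  by rewrite mxE c0 mxE subr0 addr0 (_ : t%:A = t) //; exact: mulr1.
have cc0 : c @ nbhs (0 : R) --> (0 : 'M[R]_(p + p)).
  rewrite -c0; apply: cvg_mx_entries => i j; have [dr _] := C1 i j.
  have : derivable (fun s => c s i j) 0 1 by apply: dr; rewrite normr0.
  by move/derivable1_diffP/differentiable_continuous.
have clos (eps : R) : 0 < eps -> \forall t \near (0 : R)^',
    `|Q t - lcoef (Q t) *: curve_dir 0| <= eps * `|lcoef (Q t)|.
  move=> eps0; have [r r0 H] := sl eps eps0.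
  have [r1 r10 Hr1] := Theta_proper r0.
  have nr : \forall t \near (0 : R)^', `|c t| < r1.
    by apply: nbhs_dnbhs; have /cvgr_norm_lt := cc0; rewrite normr0; apply.
  have ne : \forall t \near (0 : R)^', `|t| < e.
    apply: nbhs_dnbhs; have /cvgr_norm_lt := @cvg_id _ (nbhs (0 : R)).
    by rewrite normr0; apply.
  have nt : \forall t \near (0 : R)^', t != 0 by exact: nbhs_dnbhs_neq.
  apply: filterS3 nr ne nt => t tr te tn.
  have [Fd [z bz zF]] := cM t te.
  have zF' : cspan ((1%:M + c t) *m V0) = Theta E z by rewrite zF /graph mximg_cspan.
  have [zy sd] := Hr1 _ z bz tr zF'.
  have FE := chart_curve Fd bz zy (esym zF).
  have le : `|c t - lcoef (c t) *: curve_dir 0| <= eps * `|lcoef (c t)|.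
    rewrite FE; set s := stereo_inv z in sd FE *.
    have [->|sn] := eqVneq s 0.
      rewrite cu0 lcoef0 scale0r subr0.
      by rewrite !normr0 mulr0.
    have := H 0 s; rewrite subrr normr0 subr0 => /(_ r0 sd); rewrite eq_sym sn => /(_ isT)[_].
    rewrite cu0 subr0.
    by rewrite lcoef0 subr0.
  rewrite /Q lcoefZ -scalerA -scalerBr normrZ normrM mulrCA.
  by rewrite ler_wpM2l // normr_ge0.
have cco : lcoef (Q t) @[t --> (0 : R)^'] --> lcoef v by exact: cvg_lcoef.
have cL : `|Q t - lcoef (Q t) *: curve_dir 0| @[t --> (0 : R)^'] --> `|v - lcoef v *: curve_dir 0|.
  apply: cvg_norm; apply: cvgB => //; apply: cvgZ => //; exact: cvg_cst.
apply/eqP; rewrite -subr_eq0 -normr_le0; apply/ler_addgt0Pr => eps eps0; rewrite add0r.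
have eps1 : 0 < eps / (`|lcoef v| + 1) by rewrite divr_gt0 // ltr_wpDl.
have cR : eps / (`|lcoef v| + 1) * `|lcoef (Q t)| @[t --> (0 : R)^'] -->
    eps / (`|lcoef v| + 1) * `|lcoef v|.
  by apply: cvgM; [exact: cvg_cst|exact: cvg_norm].
have PF : ProperFilter ((0 : R)^') by exact: Proper_dnbhs_numFieldType.
apply: le_trans (ler_cvg_to cL cR (clos _ eps1)) _.
rewrite mulrAC ler_pdivrMr ?ltr_wpDl // ler_pM2l // lerDl //.
Qed.

End Anosov.

Theorem theorem0p4p1 (R : realType) (p : nat) (J : 'M[R]_(p + p))
  (Gamma : set 'M[R]_3) (rho : 'M[R]_3 -> 'M[R]_(p + p))
  (E Eb : nat -> subbundle R (p + p))
  (hp : (2 <= p)%N)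
  (hJ : split_signature J)
  (hGamma : closed_surface_group Gamma)
  (hrho : representation J Gamma rho)
  (hBA : borel_anosov_splitting J Gamma rho E Eb)
  (htrans : forall x y z : 'cV[R]_3, bdry x -> bdry y -> bdry z ->
    x <> y -> y <> z -> x <> z ->
    transverse (Theta E z)
      (fib (E p) x y + (orth J (fib (E p.-1) x y) :&: Thetab Eb y))%VS) :
  smooth_curve J (Theta E @` @bdry R) /\
  forall x y : 'cV[R]_3, bdry x -> bdry y -> x <> y ->
    tangent_space J (Theta E @` @bdry R) (Theta E x) (Thetab Eb y) =
    wedge2 (Thetab Eb y + \sum_(1 <= i < p.-1) fib (E i) x y)%VS.
Proof.
have lp0 : (p.-1 < p)%N by lia.
have kp0 : (p.-2 < p)%N by lia.
pose l : 'I_p := Ordinal lp0; pose k : 'I_p := Ordinal kp0.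
have lp : l.+1 = p by rewrite /=; lia.
have kl : k.+1 = l by rewrite /=; lia.
have geod x y : bdry x -> bdry y -> x <> y -> exists h V W,
    [/\ isomH2 h, adapted J E Eb (geod_pt x y) V W, base h = geod_pt x y,
        Theta E x = cspan V & Thetab Eb y = cspan W].
  move=> bx by_ xy; have [Tu e1 e2] := geod_ptP bx by_ xy.
  have [h ih bh] := base_surj Tu; have [V [W ad]] := adapted_ex hJ hBA Tu.
  exists h, V, W; split => //.
    by rewrite -{1}e1 (Theta_cspan hp hJ hGamma hrho hBA Tu ad).
  by rewrite -{1}e2 (Thetab_cspan hp hJ hGamma hrho hBA Tu ad).
have lagr x y V W : bdry x -> bdry y -> x <> y -> adapted J E Eb (geod_pt x y) V W ->
    [/\ dual_bases J V W, Lagr J (cspan V) & Lagr J (cspan W)].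
  move=> bx by_ xy ad; have [Tu _ _] := geod_ptP bx by_ xy.
  have d := adapted_iso hJ hBA Tu ad; have [D D' VV WW] := d.
  by split => //; split; rewrite ?(dim_cspan D) ?(dim_cspan D') //; apply/isotropic_cspan.
split; first split.
- move=> _ [x bx <-]; have [bx' xx'] := antipode_bdry bx.
  have [h [V [W [ih ad bh -> _]]]] := geod _ _ bx bx' xx'.
  by have [] := lagr _ _ _ _ bx bx' xx' ad.
- move=> _ [x bx <-]; have [by_ xy] := antipode_bdry bx.
  have [h [V [W [ih ad bh eT eTb]]]] := geod _ _ bx by_ xy.
  have [d LV LW] := lagr _ _ _ _ bx by_ xy ad.
  have fr : frames J E Eb h V W by rewrite /frames bh.
  exists (cspan W); first by split => //; rewrite eT; exact: transverse_cspan d.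
  have [e [c [Oc [h1 h2 h3 h4 [h5 _]]]]] :=
    C1_param hp hJ hGamma hrho hBA htrans lp kl ih fr (oner_neq0 R).
  exists e, c, (lcoef J k l V), Oc; split => //.
    by rewrite eT.
  split; first by move=> t /h5; rewrite invr1 mul1r.
  apply: continuous_subspaceT; exact: lcoef_cont.
move=> x y bx by_ xy.
have [h [V [W [ih ad bh eT eTb]]]] := geod _ _ bx by_ xy.
have [d LV LW] := lagr _ _ _ _ bx by_ xy ad.
have fr : frames J E Eb h V W by rewrite /frames bh.
have KP v : v \in (Thetab Eb y + \sum_(1 <= i < p.-1) fib (E i) x y)%VS <->
    exists (i : 'I_p -> R) w, v = \sum_(j < p | (j < k)%N) i j *: col j V + W *m w.
  have [_ vE _] := ad.
  have lines : (\sum_(1 <= i < p.-1) fib (E i) x y)%VS =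
      (\sum_(j < p | (j < k)%N) <[col j V]>)%VS.
    have -> : p.-1 = k.+1 by move: lp kl; lia.
    rewrite big_add1 big_mkord (big_ord_widen p (fun j => fib (E j.+1) x y)); last first.
      by move: lp kl; lia.
    by apply: eq_bigr => j _; rewrite -vE.
  rewrite lines eTb; split=> [/memv_addP[w /mem_cspan[b ->] [_ /memv_sumP[f fP ->] ->]]|[i [w ->]]].
    have ex (j : 'I_p) : exists a, (j < k)%N -> f j = a *: col j V.
      case: (ltnP j k) => jk; last by exists 0.
      by have /vlineP[a ->] := fP j jk; exists a.
    exists (fun j => projT1 (cid (ex j))), b; rewrite addrC; congr (_ + _).
    by apply: eq_bigr => j jk; case: cid => a /= ->.
  rewrite addrC; apply: memv_add; first by apply/mem_cspan; exists w.
  by apply: memv_sumr => j _; rewrite rpredZ // memv_line.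
rewrite (wedge2_last (J_sym hJ) lp kl d KP) eT eTb.
have frs0 : frames J E Eb (slide h 0) V W by rewrite slide0.
have co1 : lcoef J k l V (dirmx J k l W) = 1 := lcoef_dirmx0 hp hJ hrho hBA lp kl ih fr.
have [_ dir0] : lcoef J k l V (dirmx J k l (slideW hJ hBA ih 0)) != 0 /\
    curve_dir hJ hBA k l V ih 0 = dirmx J k l W.
  have n0 : lcoef J k l V (dirmx J k l W) != 0 by rewrite co1 oner_neq0.
  have [] := curve_dirE hp hJ hrho hBA lp kl ih frs0 n0.
  by rewrite co1 invr1 scale1r.
rewrite eqEsubset; split=> [A [e [c [[e0 c0] C1 cM] ->]]|A [a ->]].
  exists (lcoef J k l V (velocity c 0)).
  have := tangent_velocity hp hJ hGamma hrho hBA htrans lp kl ih fr e0 c0 C1 cM.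
  by rewrite dir0 => {1}->; rewrite /omega -scalemxAr.
(* The zero form is the velocity of a constant curve. *)
have [->|an] := eqVneq a 0.
  exists 1, (fun=> 0); split => //.
  - move=> i j; split=> t _; first exact: derivable_cst.
    rewrite (_ : derive1 _ = fun=> 0); first exact: cst_continuous.
    by apply/funext => s; rewrite derive1_cst.
  - move=> t _; split; first exact: (chart_dom0 hp hJ hGamma hrho hBA ih fr).
    exists x => //; rewrite /graph addr0 mximg_cspan mul1mx.
    by rewrite eT.
  - rewrite scale0r /omega (_ : velocity _ 0 = 0) ?mulmx0 //.
    by apply/matrixP => i j; rewrite !mxE derive1_cst.
have [e [c [Oc [[e0 c0] C1 h3 [_ h4] [_ h5]]]]] :=
  C1_param hp hJ hGamma hrho hBA htrans lp kl ih fr an.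
exists e, c; split => //.
  move=> t te; have : (c @` [set t : R | `|t| < e]) (c t) by exists t.
  by rewrite h4 => -[].
by rewrite h5 dir0 /omega -scalemxAr.
Qed.
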